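(* Let $\mu$ be a probability distribution on $\mathbb{R}^d$ with finite second moments, and let $X \sim \mu$. Let $\delta_1, \delta_2, \dots > 0$ be step sizes, let $N_1, N_2, \dots$ be i.i.d. standard Gaussian vectors in $\mathbb{R}^d$ independent of $X$, and define the comparison process $Y_0 = 0$, $Y_k = Y_{k-1} + \delta_k X + \sqrt{\delta_k} N_k$ for $k \ge 1$. Let $f_1, f_2, \dots \colon \mathbb{R}^d \to \mathbb{R}^d$ be measurable functions, let $\tilde N_1, \tilde N_2, \dots$ be i.i.d. standard Gaussian vectors in $\mathbb{R}^d$, and define the sampling process $Z_0 = 0$, $Z_k = Z_{k-1} + \delta_k f_k(Z_{k-1}) + \sqrt{\delta_k}\tilde N_k$ for $k \ge 1$. Fix $n \ge 1$ and assume $\mathbb{E}\|f_k(Y_{k-1})\|^2 < \infty$ for all $k = 1, \dots, n$. Let $$\Delta_n = D\big(\mathrm{Law}(Y_1,\dots,Y_n) \,\|\, \mathrm{Law}(Z_1,\dots,Z_n)\big)$$ be the Kullback–Leibler divergence. Then $$\Delta_n \le \frac{\delta_{\max}}{2}\operatorname{tr}(\operatorname{cov}(X)) + \sum_{k=1}^n \frac{\delta_k}{2}\,\mathbb{E}\big\|f_k(Y_{k-1}) - \mathbb{E}[X \mid Y_{k-1}]\big\|^2,$$ where $\delta_{\max} = \max\{\delta_1,\dots,\delta_n\}$.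
   Context: $D(P\|Q)$ denotes the Kullback–Leibler divergence (relative entropy) with natural logarithms. $\mathbb{E}[X\mid Y_{k-1}]$ is the conditional expectation of $X$ given $Y_{k-1}$ in the comparison process. *)

(* Defs.v *)
From HB Require Import structures.
From mathcomp Require Import all_boot all_order all_algebra.
From mathcomp Require Import all_classical all_reals all_analysis.

Set Implicit Arguments.
Unset Strict Implicit.
Unset Printing Implicit Defensive.

Import Order.TTheory GRing.Theory Num.Theory.

Local Open Scope classical_set_scope.
Local Open Scope ring_scope.

(* R^d is represented by [d.-tuple R], with its canonical product
   (coordinate) sigma-algebra from mathcomp-analysis; (R^d)^n by
   [n.-tuple (d.-tuple R)]. *)

Section vectors.
Context {R : realType} {d : nat}.

Definition vzero : d.-tuple R := [tuple (0 : R) | i < d].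
Definition vadd (u v : d.-tuple R) : d.-tuple R :=
  [tuple tnth u i + tnth v i | i < d].
Definition vsub (u v : d.-tuple R) : d.-tuple R :=
  [tuple tnth u i - tnth v i | i < d].
Definition vscale (a : R) (u : d.-tuple R) : d.-tuple R :=
  [tuple a * tnth u i | i < d].
Definition sqnorm (u : d.-tuple R) : R := \sum_(i < d) tnth u i ^+ 2.

End vectors.

Section processes.
Context {R : realType} {d : nat} {dO : measure_display} {Omega : measurableType dO}.

Fixpoint Yproc (delta : nat -> R) (X : Omega -> d.-tuple R)
    (N : nat -> Omega -> d.-tuple R) (k : nat) (w : Omega) : d.-tuple R :=
  match k with
  | 0 => vzero
  | k'.+1 => vadd (vadd (Yproc delta X N k' w) (vscale (delta k) (X w)))
                  (vscale (Num.sqrt (delta k)) (N k w))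
  end.

Fixpoint Zproc (delta : nat -> R) (f : nat -> d.-tuple R -> d.-tuple R)
    (Nt : nat -> Omega -> d.-tuple R) (k : nat) (w : Omega) : d.-tuple R :=
  match k with
  | 0 => vzero
  | k'.+1 => vadd (vadd (Zproc delta f Nt k' w)
                        (vscale (delta k) (f k (Zproc delta f Nt k' w))))
                  (vscale (Num.sqrt (delta k)) (Nt k w))
  end.

Definition path_of (V : nat -> Omega -> d.-tuple R) (n : nat) (w : Omega)
  : n.-tuple (d.-tuple R) := [tuple V i.+1 w | i < n].

Definition law {dT} {T : measurableType dT} (P : probability Omega R)
  (V : Omega -> T) : set T -> \bar R := pushforward P V.

(* N_1, N_2, ... are i.i.d. standard Gaussian vectors in R^d (i.e. all their
   coordinates are mutually independent N(0,1)), and the whole family is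
   independent of X: the joint law of (X, N_1, ..., N_m) is
   Law(X) (x) N(0,1)^{(x) d m} for every m (checked on measurable rectangles). *)
Definition iid_std_gaussian_indep_of (P : probability Omega R)
    {dT} {T : measurableType dT} (X : Omega -> T)
    (N : nat -> Omega -> d.-tuple R) : Prop :=
  forall (m : nat) (A : set T) (B : nat -> 'I_d -> set R),
    measurable A -> (forall k i, measurable (B k i)) ->
    P (X @^-1` A `&`
       [set w | forall k i, (1 <= k <= m)%N -> B k i (tnth (N k w) i)])
    = (P (X @^-1` A) *
       \prod_(1 <= k < m.+1) \prod_(i < d) normal_prob 0 1 (B k i))%E.

Definition iid_std_gaussian (P : probability Omega R)
    (N : nat -> Omega -> d.-tuple R) : Prop :=
  forall (m : nat) (B : nat -> 'I_d -> set R),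
    (forall k i, measurable (B k i)) ->
    P [set w | forall k i, (1 <= k <= m)%N -> B k i (tnth (N k w) i)]
    = (\prod_(1 <= k < m.+1) \prod_(i < d) normal_prob 0 1 (B k i))%E.

Definition expect (P : probability Omega R) (V : Omega -> R) : \bar R :=
  (\int[P]_w (V w)%:E)%E.

Definition trace_cov (P : probability Omega R) (X : Omega -> d.-tuple R)
  : \bar R :=
  (\sum_(i < d)
     expect P (fun w => ((tnth (X w) i - fine (expect P (fun v => tnth (X v) i))) ^+ 2)%R))%E.

(* [h \o V] is a version of the conditional expectation E[X | V]:
   h is measurable (so h(V) is sigma(V)-measurable), h(V) is integrable, and
   E[X 1_{V in B}] = E[h(V) 1_{V in B}] for every measurable B (coordinatewise). *)
Definition cond_exp_version (P : probability Omega R)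
    (X : Omega -> d.-tuple R) {dT} {T : measurableType dT} (V : Omega -> T)
    (h : T -> d.-tuple R) : Prop :=
  measurable_fun setT h /\
  (forall i : 'I_d, P.-integrable setT (fun w => (tnth (h (V w)) i)%:E)) /\
  (forall (B : set T) (i : 'I_d), measurable B ->
     (\int[P]_(w in V @^-1` B) (tnth (X w) i)%:E
      = \int[P]_(w in V @^-1` B) (tnth (h (V w)) i)%:E)%E).

End processes.

Section KL.
Context {R : realType} {dT : measure_display} {T : measurableType dT}.

Definition is_density (mu nu : set T -> \bar R) (g : T -> R) : Prop :=
  measurable_fun setT g /\ (forall x, 0 <= g x) /\
  (forall A, measurable A -> mu A = (\int[nu]_(x in A) (g x)%:E)%E).

(* Kullback-Leibler divergence D(mu || nu) with natural logarithm:
   int ln(dmu/dnu) dmu if mu << nu (i.e. mu has a density w.r.t. nu),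
   and +oo otherwise.  (The value of ln on {g = 0}, a mu-null set,
   is irrelevant.) *)
Definition KL (mu nu : set T -> \bar R) : \bar R :=
  match pselect (exists g, is_density mu nu g) with
  | left h => (\int[mu]_x (ln (projT1 (cid h) x))%:E)%E
  | right _ => +oo%E
  end.

End KL.

(* Main.v *)
(* Write [lik x y t = exp (x.y - t |x|^2 / 2)], [G t y = E lik X y t], and [t_k]
   for the sum of the first [k] steps.  Relative to the driftless Gaussian walk,
   the law of [(Y_1, ..., Y_n)] has density [G t_n y_n] and that of
   [(Z_1, ..., Z_n)] is an explicit product of Gaussian factors.  Hence the
   divergence is [E ln (G t_n Y_n)] plus a sum of terms which, since the
   posterior mean [hhat = E[X | Y_k]] may replace [X] and the fresh noise is
   centred, equal [delta/2 (E |f - hhat|^2 - E |hhat|^2)].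
   It remains to bound [E ln (G t_n Y_n)], the relative entropy of [Y_n] with
   respect to the driftless walk, by [dmax/2 tr cov X] plus the sum of the
   [delta/2 E |hhat|^2].  In continuous time the derivative of this entropy is
   half of the Fisher information [a t = E |E[X | Y_t]|^2], which increases from
   [|E X|^2] to at most [E |X|^2].  So the entropy gained during a step is at
   most [delta/2] times the value of [a] at the end of the step, and replacing it
   by the value at the start costs at most the telescoping sum
   [dmax/2 (E |X|^2 - |E X|^2)].  The derivative is never formed: for bounded
   [X], a time increment [e] raises the entropy by at most [e/2 a t + O(e^2)],
   and steps are subdivided; the general case follows by truncation, with Fatou's
   lemma for the entropy and dominated convergence for [a]. *)

Require Import Defs.
From HB Require Import structures.
From mathcomp Require Import all_boot all_order all_algebra.
From mathcomp Require Import all_classical all_reals all_analysis.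
From mathcomp Require Import measurable_realfun.
From mathcomp Require Import ring lra.

Set Implicit Arguments.
Unset Strict Implicit.
Unset Printing Implicit Defensive.

Import Order.TTheory GRing.Theory Num.Theory.
Import numFieldNormedType.Exports.
Import HBNNSimple.
Local Open Scope classical_set_scope.
Local Open Scope ring_scope.

(** * Transfer of weighted integrals between measure spaces *)

Section weighted_transfer.
Context {R : realType} {dU : measure_display} {U : measurableType dU}.

(** The noise is described only through probabilities of rectangles. Every change of measure is
    therefore an equality of weighted integrals, tested on indicators (of rectangles, when the
    values are tuples) and extended to all integrands by simple functions. Integrands are kept
    nonnegative wherever possible, so that Tonelli's theorem applies without integrability. The
    estimate over a short time [e] compares the mixture likelihood with that of a Gaussian walk
    whose drift is frozen at the posterior mean [h]. The tangent of the logarithm there yields the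
    Fisher term exactly and leaves a chi-square divergence, the average of [exp (e <X - h, X' - h>)]
    over two independent copies drawn from the posterior. Its linear term vanishes because [X - h]
    is centred, hence the order [e^2]; the constant comes from a uniform bound on [<X - h, X' - h>],
    which is why [X] is first taken bounded. Cutting a step into [n] pieces divides the total error
    by [n], so none remains in the limit. *)

Lemma ge0_integral_weightE (d1 : measure_display) (T : measurableType d1)
    (mu : {measure set T -> \bar R}) (V : T -> U) (w : T -> R)
    (psi : U -> \bar R) (mpsi : measurable_fun setT psi) :
  measurable_fun setT V -> measurable_fun setT w -> (forall x, 0 <= w x) ->
  (forall u, 0 <= psi u)%E ->
  let f_ := nnsfun_approx (@measurableT _ U) mpsi in
  (\int[mu]_x (psi (V x) * (w x)%:E)
   = limn (fun n => \sum_(k \in range (f_ n))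
       k%:E * \int[mu]_x (\1_(f_ n @^-1` [set k]) (V x) * w x)%:E))%E.
Proof.
move=> mV mw w0 psi0 f_.
have mfV n : measurable_fun setT (fun x => f_ n (V x)).
  by apply: (@measurableT_comp _ _ _ _ _ _ (f_ n)) => //; exact/measurable_funP.
transitivity (limn (fun n => \int[mu]_x (f_ n (V x) * w x)%:E))%E.
  rewrite -monotone_convergence//.
  - apply: eq_integral => x _; apply/esym/cvg_lim => //.
    under eq_fun do rewrite EFinM.
    apply: cvgeZr => //.
    exact: (cvg_nnsfun_approx _ _ (fun u _ => psi0 u)).
  - by move=> n; apply/measurable_EFinP/measurable_funM.
  - by move=> n x _; rewrite lee_fin mulr_ge0.
  - move=> x _ m n mn; rewrite lee_fin ler_wpM2r//.
    exact/lefP/nd_nnsfun_approx.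
congr (limn _); apply/funext => n.
under eq_integral.
  move=> x _; rewrite fimfunE mulr_fsuml -fsumEFin//.
  over.
rewrite ge0_integral_fsum//; last 2 first.
- move=> r; apply/measurable_EFinP/measurable_funM => //.
  apply: measurable_funM => //; apply: measurableT_comp => //.
- move=> r x _; rewrite lee_fin mulr_ge0//.
  exact: nnfun_muleindic_ge0.
apply: eq_fsbigr => r /[!inE] -[u _ <-].
rewrite -ge0_integralZl_EFin//.
- by apply: eq_integral => x _; rewrite -EFinM mulrA.
- by move=> x _; rewrite lee_fin mulr_ge0.
- apply/measurable_EFinP/measurable_funM => //.
  by apply: measurableT_comp.
Qed.

(* No integrability is needed, as positive and negative parts are compared
   separately. *)
Lemma eq_integral_weight (d1 d2 : measure_display) (T1 : measurableType d1)
    (T2 : measurableType d2)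
    (mu1 : {measure set T1 -> \bar R}) (mu2 : {measure set T2 -> \bar R})
    (V1 : T1 -> U) (V2 : T2 -> U) (w1 : T1 -> R) (w2 : T2 -> R) :
  measurable_fun setT V1 -> measurable_fun setT w1 -> (forall x, 0 <= w1 x) ->
  measurable_fun setT V2 -> measurable_fun setT w2 -> (forall x, 0 <= w2 x) ->
  (forall B, measurable B -> \int[mu1]_x (\1_B (V1 x) * w1 x)%:E
                           = \int[mu2]_x (\1_B (V2 x) * w2 x)%:E)%E ->
  forall psi : U -> \bar R, measurable_fun setT psi ->
  (\int[mu1]_x (psi (V1 x) * (w1 x)%:E)
   = \int[mu2]_x (psi (V2 x) * (w2 x)%:E))%E.
Proof.
move=> mV1 mw1 w10 mV2 mw2 w20 H psi mpsi.
have ge0 phi : measurable_fun setT phi -> (forall u, 0 <= phi u)%E ->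
    (\int[mu1]_x (phi (V1 x) * (w1 x)%:E)
     = \int[mu2]_x (phi (V2 x) * (w2 x)%:E))%E.
  move=> mphi phi0.
  rewrite (ge0_integral_weightE mu1 mphi)// (ge0_integral_weightE mu2 mphi)//.
  congr (limn _); apply/funext => n; apply: eq_fsbigr => r _; congr (_ * _)%E.
  by apply: H; rewrite -[X in measurable X]setTI; exact: measurable_funP.
rewrite integralE [RHS]integralE.
have posE dd (T : measurableType dd) (V : T -> U) (w : T -> R) :
    (forall x, 0 <= w x) ->
    (fun x => psi (V x) * (w x)%:E)^\+%E = (fun x => psi^\+ (V x) * (w x)%:E)%E.
  by move=> w0; apply/funext => x; rewrite !funeposE maxe_pMl ?lee_fin// mul0e.
have negE dd (T : measurableType dd) (V : T -> U) (w : T -> R) :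
    (forall x, 0 <= w x) ->
    (fun x => psi (V x) * (w x)%:E)^\-%E = (fun x => psi^\- (V x) * (w x)%:E)%E.
  by move=> w0; apply/funext => x; rewrite !funenegE maxe_pMl ?lee_fin// mul0e mulNe.
rewrite !posE// !negE//; congr (_ - _)%E; apply: ge0 => //.
- exact: measurable_funepos.
- exact: measurable_funeneg.
Qed.

End weighted_transfer.

Section weighted_image.
Context {R : realType} {dT dU : measure_display} {T : measurableType dT}
  {U : measurableType dU} (mu : {measure set T -> \bar R})
  (V : T -> U) (w : T -> R).
Hypotheses (mV : measurable_fun setT V) (mw : measurable_fun setT w)
  (w0 : forall x, 0 <= w x).

(** The image under [V] of the measure with density [w]. It turns an identity between weighted
    integrals of indicators into an equality of two measures, to which uniqueness theorems apply. *)
Definition wimage (B : set U) : \bar R := (\int[mu]_(x in V @^-1` B) (w x)%:E)%E.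

Lemma wimageE (B : set U) : wimage B = (\int[mu]_x (\1_B (V x) * w x)%:E)%E.
Proof.
rewrite /wimage integral_mkcond; apply: eq_integral => x _.
by rewrite epatch_indic /= muleC -EFinM /=; congr (_ * _)%:E.
Qed.

Let wimage0 : wimage set0 = 0%E.
Proof. by rewrite /wimage preimage_set0 integral_set0. Qed.

Let wimage_ge0 B : (0 <= wimage B)%E.
Proof. by apply: integral_ge0 => x _; rewrite lee_fin. Qed.

Let wimage_sigma_additive : semi_sigma_additive wimage.
Proof.
move=> /= F mF tF mUF.
rewrite /wimage preimage_bigcup ge0_integral_bigcup//.
- by apply: is_cvg_ereal_nneg_natsum_cond => n _ _; exact: wimage_ge0.
- by move=> k; rewrite -[X in measurable X]setTI; exact: mV.
- by apply: measurable_funTS; exact/measurable_EFinP.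
- by move=> x _; rewrite lee_fin.
- by apply/trivIsetP => i j _ _ ij; rewrite -preimage_setI;
    move/trivIsetP : tF => ->//; rewrite preimage_set0.
Qed.

Definition wmeasure : {measure set U -> \bar R} :=
  HB.pack wimage (isMeasure.Build _ _ _ wimage wimage0 wimage_ge0
                    wimage_sigma_additive).

End weighted_image.

Section tuple_rectangles.
Context {R : realType} {dT : measure_display} {T : measurableType dT} {n : nat}.

Definition rect (B : 'I_n -> set T) : set (n.-tuple T) :=
  [set z | forall i, B i (tnth z i)].

Lemma measurable_rect (B : 'I_n -> set T) :
  (forall i, measurable (B i)) -> measurable (rect B).
Proof.
move=> mB; rewrite (_ : rect B = \bigcap_(i in [set: 'I_n]) (@tnth _ T ^~ i @^-1` B i)).
  apply: fin_bigcap_measurable => // i _.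
  by rewrite -[X in measurable X]setTI; exact: measurable_tnth.
by apply/seteqP; split => z /= Hz i => [_|]; [exact: Hz|exact: (Hz i I)].
Qed.

(** Rectangles form a pi-system that generates the product sigma-algebra, since the preimage of [D]
    under one coordinate is the rectangle with [setT] in all the others. The full space is itself a
    rectangle, of finite mass, and serves as the exhausting sequence. *)
Lemma tuple_measure_unique (m1 m2 : {measure set (n.-tuple T) -> \bar R}) :
  (m1 setT < +oo)%E ->
  (forall B, (forall i, measurable (B i)) -> m1 (rect B) = m2 (rect B)) ->
  forall A, measurable A -> m1 A = m2 A.
Proof.
move=> m1oo H.
pose G : set (set (n.-tuple T)) :=
  [set A | exists2 B, (forall i, measurable (B i)) & A = rect B].
have GT : G setT.
  exists (fun=> setT) => //; apply/seteqP; split => //.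
apply: (@measure_unique _ _ _ G (fun=> setT)) => //.
- apply/seteqP; split => A.
  + move=> mA; apply: (smallest_sub _ _ mA); first exact: smallest_sigma_algebra.
    rewrite -bigcup_seq; apply: bigcup_sub => i _ /= C [D mD <-].
    apply: sub_sigma_algebra.
    exists (fun j => if j == i then D else setT).
      by move=> j; case: ifP.
    rewrite setTI; apply/seteqP; split => z /=.
      by move=> Dz j; case: eqP => // ->.
    by move=> /(_ i); rewrite eqxx.
  + move=> GA; apply: (smallest_sub _ _ GA); first exact: sigma_algebra_measurable.
    by move=> _ [B mB ->]; exact: measurable_rect.
- move=> _ _ [B mB ->] [C mC ->]; exists (fun i => B i `&` C i).
    by move=> i; exact: measurableI.
  apply/seteqP; split => z /=; first by move=> [Bz Cz] i; split; [exact: Bz|exact: Cz].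
  by move=> BC; split => i; have [] := BC i.
- by apply/seteqP; split => // z _; exists 0%N.
- by move=> _ [B mB ->]; exact: H.
Qed.

End tuple_rectangles.

Lemma measurable_ge0_integral_snd {R : realType} (d1 d2 : measure_display)
    (T1 : measurableType d1) (T2 : measurableType d2)
    (m : {sigma_finite_measure set T2 -> \bar R}) (f : T1 -> T2 -> \bar R) :
  measurable_fun setT (fun p : T1 * T2 => f p.1 p.2) ->
  (forall x y, 0 <= f x y)%E ->
  measurable_fun setT (fun x => \int[m]_y f x y)%E.
Proof.
move=> mf f0.
exact: (@measurable_fun_fubini_tonelli_F _ _ _ _ _ m (fun p => f p.1 p.2)).
Qed.

Lemma ge0_fubini {R : realType} (d1 d2 : measure_display)
    (T1 : measurableType d1) (T2 : measurableType d2)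
    (m1 : {sigma_finite_measure set T1 -> \bar R})
    (m2 : {sigma_finite_measure set T2 -> \bar R}) (f : T1 -> T2 -> \bar R) :
  measurable_fun setT (fun p : T1 * T2 => f p.1 p.2) ->
  (forall x y, 0 <= f x y)%E ->
  (\int[m1]_x \int[m2]_y f x y = \int[m2]_y \int[m1]_x f x y)%E.
Proof.
move=> mf f0; exact: (@fubini_tonelli _ _ _ _ _ m1 m2 (fun p => f p.1 p.2)).
Qed.

Lemma integral_prob_cst {R : realType} (dT : measure_display)
    (T : measurableType dT) (P : probability T R) (c : \bar R) :
  (\int[P]_x c = c)%E.
Proof.
rewrite (eq_integral (cst c))// integral_cst//= -[RHS]mule1.
by congr (_ * _)%E; exact: probability_setT.
Qed.

Lemma integral_prob_le1 {R : realType} (dT : measure_display)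
    (T : measurableType dT) (P : probability T R) (f : T -> R) :
  measurable_fun setT f -> (forall x, 0 <= f x <= 1) ->
  (\int[P]_x (f x)%:E <= 1)%E.
Proof.
move=> mf f01; rewrite -(@integral_prob_cst _ _ _ P 1).
apply: ge0_le_integral => //.
- by move=> x _; rewrite lee_fin; have /andP[] := f01 x.
- exact/measurable_EFinP.
- by move=> x _; rewrite lee_fin; have /andP[] := f01 x.
Qed.

(** * Shifts and rotations of the one-dimensional Gaussian *)

Section one_dimensional_gaussian.
Context {R : realType}.
Local Notation lam := (@lebesgue_measure R).
Local Notation gam := (normal_prob (0 : R) 1).
Local Notation phi := (normal_pdf (0 : R) 1).

Lemma measurable_affine (a c : R) : measurable_fun setT (fun x : R => a * x + c).
Proof. by apply: measurable_funD => //; exact: measurable_funM. Qed.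

(** As a function of [B], the right-hand side is a measure (the image of [a] times Lebesgue measure
    under the affine map) that gives every interval its length, so it is Lebesgue measure. *)
Lemma lebesgue_affine (a c : R) (B : set R) : 0 < a -> measurable B ->
  lam B = (a%:E * lam ((fun x => a * x + c)%R @^-1` B))%E.
Proof.
move=> a0 mB.
have maff : @measurable_fun _ _ (measurableTypeR R) (measurableTypeR R) setT
    (fun x : R => a * x + c) by exact: measurable_affine.
pose nu : {measure set (measurableTypeR R) -> \bar R} :=
  @wmeasure R _ _ (measurableTypeR R) (measurableTypeR R) lam _ (cst a) maff
    (measurable_cst a) (fun=> ltW a0).
have nuE A : measurable A -> nu A = (a%:E * lam ((fun x => a * x + c)%R @^-1` A))%E.
  move=> mA; rewrite /nu /= /wimage (eq_integral (cst a%:E))// integral_cst//.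
  by rewrite -[X in measurable X]setTI; exact: measurable_affine.
rewrite -nuE//; apply: (@lebesgue_measure_unique R nu _ B mB) => X [[x y] /= _ <-].
have mxy : measurable (`]x, y]%classic : set R) by exact: measurable_itv.
pose J := `](x - c) / a, (y - c) / a]%classic.
have nuJ := nuE _ mxy; rewrite (_ : _ @^-1` _ = J) in nuJ; last first.
  apply/seteqP; rewrite /J; split => z /=; rewrite !in_itv/= ltr_pdivrMr// ler_pdivlMr//;
    by rewrite ltrBlDr lerBrDr [z * a]mulrC.
transitivity (a%:E * lam J)%E; last exact/esym/nuJ.
rewrite /J !lebesgue_measure_itv/= !lte_fin ltr_pM2r ?invr_gt0// ltrD2r.
case: ifP => _; last by rewrite mule0.
by rewrite -!EFinD -EFinM; congr EFin; field; rewrite gt_eqF.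
Qed.

Lemma integral_affine (a c : R) (psi : R -> \bar R) : 0 < a ->
  measurable_fun setT psi ->
  (\int[lam]_u psi u = \int[lam]_x (psi (a * x + c)%R * a%:E))%E.
Proof.
move=> a0 mpsi.
rewrite -(@eq_integral_weight _ _ _ _ _ _ _ lam lam id _ (cst 1) (cst a))//.
- by apply: eq_integral => x _; rewrite /= mule1.
- exact: measurable_affine.
- by move=> x; exact: ltW.
move=> B mB /=.
under eq_integral do rewrite mulr1.
rewrite integral_indic// setIT.
under [RHS]eq_integral do rewrite mulrC EFinM.
rewrite ge0_integralZl_EFin//; last 2 first.
- by apply/measurable_EFinP; apply: measurableT_comp => //; exact: measurable_affine.
- exact: ltW.
apply: (etrans (lebesgue_affine c a0 mB)); congr (_ * _)%E.
under [RHS]eq_integral do rewrite -[\1_B _]/(\1_((fun x => a * x + c) @^-1` B) _).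
rewrite integral_indic ?setIT//.
by rewrite -[X in measurable X]setTI; exact: measurable_affine.
Qed.

Lemma integral_gaussE (psi : R -> \bar R) : measurable_fun setT psi ->
  (\int[gam]_x psi x = \int[lam]_x (psi x * (phi x)%:E))%E.
Proof.
move=> mpsi.
transitivity (\int[gam]_x (psi x * (cst 1 x)%:E))%E.
  by apply: eq_integral => x _; rewrite /= mule1.
apply: (@eq_integral_weight _ _ _ _ _ _ _ gam lam id id (cst 1) phi) => //.
- exact: measurable_normal_pdf.
- exact: normal_pdf_ge0.
move=> B mB /=; under eq_integral do rewrite mulr1.
rewrite integral_indic// setIT.
transitivity (\int[lam]_(x in B) (phi x)%:E)%E => //.
rewrite integral_mkcond.
by apply: eq_integral => x _; rewrite epatch_indic /= muleC EFinM.
Qed.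

Lemma normal_pdf01E (x : R) :
  phi x = (Num.sqrt (pi *+ 2))^-1 * expR (- (x ^+ 2) / 2).
Proof.
rewrite normal_pdfE ?oner_eq0// /normal_peak /normal_fun expr1n mul1r subr0.
by [].
Qed.

(** The Cameron--Martin formula on the line: after a translation by [v] of the Lebesgue integral on
    the right, the two exponents agree by completing the square. *)
Lemma integral_gauss_shift (v : R) (psi : R -> \bar R) : measurable_fun setT psi ->
  (\int[gam]_z psi (z + v)%R
   = \int[gam]_z (psi z * (expR (v * z - v ^+ 2 / 2))%:E))%E.
Proof.
move=> mpsi.
have mexp : measurable_fun setT (fun z : R => (expR (v * z - v ^+ 2 / 2))%:E).
  by apply/measurable_EFinP/measurableT_comp => //; exact: measurable_affine.
have msh : measurable_fun setT (fun z : R => z + v) by exact: measurable_funD.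
rewrite integral_gaussE; last exact: measurableT_comp.
rewrite integral_gaussE; last exact: emeasurable_funM.
rewrite [RHS](@integral_affine 1 v)//; last first.
  apply: emeasurable_funM; first exact: emeasurable_funM.
  by apply/measurable_EFinP; exact: measurable_normal_pdf.
apply: eq_integral => x _; rewrite mule1 mul1r -muleA; congr (_ * _)%E.
rewrite -EFinM !normal_pdf01E mulrCA -expRD; congr (_ * expR _)%:E.
by field.
Qed.

(** Rotation invariance in density form. For fixed [y] the variable [u = a x + b y] replaces [x];
    after exchanging the integrals, the joint density of [y] and [u] is the Gaussian density of [u]
    times a normal density in [y], which integrates to one. *)
Lemma ge0_integral_gauss_conv (a b : R) (psi : R -> \bar R) : 0 < a ->
  a ^+ 2 + b ^+ 2 = 1 -> measurable_fun setT psi -> (forall x, 0 <= psi x)%E ->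
  (\int[gam]_y \int[gam]_x psi (a * x + b * y)%R = \int[gam]_u psi u)%E.
Proof.
move=> a0 ab mpsi psi0.
have a_neq0 : a != 0 by rewrite gt_eqF.
(* Joint density of [y] and [u = a x + b y]; the division by [a] is the Jacobian. *)
pose k (y u : R) : R := phi y * phi ((u - b * y) / a) / a.
have k0 y u : 0 <= k y u.
  by rewrite mulr_ge0 ?invr_ge0 ?(ltW a0)// mulr_ge0// normal_pdf_ge0.
have mk : measurable_fun setT (fun p : R * R => (k p.1 p.2)%:E).
  apply/measurable_EFinP; apply: measurable_funM => //.
  apply: measurable_funM; apply: measurableT_comp => //; try exact: measurable_normal_pdf.
  apply: measurable_funM => //; apply: measurable_funB => //.
  exact: measurable_funM.
have inner y : ((phi y)%:E * (\int[gam]_x psi (a * x + b * y)%R)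
             = \int[lam]_u (psi u * (k y u)%:E))%E.
  rewrite integral_gaussE; last first.
    by apply: measurableT_comp => //; exact: measurable_affine.
  rewrite (@integral_affine a (b * y) (fun u => psi u * (k y u)%:E)%E)//; last first.
    apply: emeasurable_funM => //.
    exact: (measurableT_comp mk (measurable_pair1 y)).
  rewrite -ge0_integralZl//; last 3 first.
  - apply: emeasurable_funM; last by apply/measurable_EFinP; exact: measurable_normal_pdf.
    by apply: measurableT_comp => //; exact: measurable_affine.
  - by move=> x _; rewrite mule_ge0// lee_fin normal_pdf_ge0.
  - by rewrite lee_fin normal_pdf_ge0.
  apply: eq_integral => x _; rewrite muleCA -muleA; congr (_ * _)%E.
  rewrite -!EFinM /k; congr EFin.
  by rewrite addrK [a * x]mulrC mulfK// divfK.
have mG : measurable_fun setT (fun y : R => \int[gam]_x psi (a * x + b * y)%R)%E.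
  apply: (@measurable_ge0_integral_snd _ _ _ R (measurableTypeR R) gam
    (fun y x => psi (a * x + b * y)%R)) => //.
  apply: measurableT_comp => //; apply: measurable_funD; exact: measurable_funM.
rewrite integral_gaussE//.
under eq_integral do rewrite muleC inner.
rewrite (@ge0_fubini _ _ _ _ _ lam lam (fun y u => psi u * (k y u)%:E)%E); last 2 first.
- by apply: emeasurable_funM => //; exact: measurableT_comp.
- by move=> y u; rewrite mule_ge0// lee_fin.
rewrite integral_gaussE//; apply: eq_integral => u _.
(* Given [u], the variable [y] is normal with mean [b u] and standard deviation [a]. *)
have kE y : (k y u)%:E = ((phi u)%:E * (normal_pdf (b * u) a y)%:E)%E.
  rewrite -EFinM /k !normal_pdf01E normal_pdfE// /normal_peak /normal_fun.
  rewrite -[in RHS]mulrnAr sqrtrM ?sqr_ge0// sqrtr_sqr gtr0_norm// invfM.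
  set s := (Num.sqrt _)^-1.
  congr EFin; rewrite [LHS](_ : _ = s * (a^-1 * s) *
    (expR (- y ^+ 2 / 2) * expR (- ((u - b * y) / a) ^+ 2 / 2))); last by ring.
  rewrite [RHS](_ : _ = s * (a^-1 * s) *
    (expR (- u ^+ 2 / 2) * expR (- (y - b * u) ^+ 2 / (a ^+ 2 *+ 2)))); last by ring.
  rewrite -!expRD; congr (_ * expR _).
  (* The exponents agree only modulo [a^2 + b^2 = 1], so the discrepancy is isolated as a multiple
     of [1 - (a^2 + b^2)]. *)
  rewrite [LHS](_ : _ = - u ^+ 2 / 2 + - (y - b * u) ^+ 2 / (a ^+ 2 *+ 2) +
    (1 - (a ^+ 2 + b ^+ 2)) * (y ^+ 2 - u ^+ 2) / (2 * a ^+ 2)); last by field.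
  by rewrite ab subrr !mul0r addr0.
rewrite ge0_integralZl//; last 2 first.
- exact: (measurableT_comp mk (measurable_pair2 u)).
- by move=> y _; rewrite lee_fin.
under eq_integral do rewrite kE.
rewrite ge0_integralZl//; last 3 first.
- by apply/measurable_EFinP; exact: measurable_normal_pdf.
- by move=> y _; rewrite lee_fin normal_pdf_ge0.
- by rewrite lee_fin normal_pdf_ge0.
by rewrite integral_normal_pdf mule1.
Qed.
End one_dimensional_gaussian.

(** * Standard Gaussian vectors: factorization, Cameron--Martin formula, convolution *)

Section gaussian_vectors.
Context {R : realType} {d : nat}.
Local Notation vec := (d.-tuple R).
Local Notation gam1 := (normal_prob (0 : R) 1).

Definition dot (u v : vec) : R := \sum_(i < d) tnth u i * tnth v i.

(** Formulated on rectangles because this is what the hypotheses on the noise provide; the measure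
    used in the end is the law of [N 1]. *)
Definition std_gaussian (gam : probability vec R) : Prop :=
  forall B : 'I_d -> set R, (forall i, measurable (B i)) ->
    gam (rect B) = (\prod_(i < d) gam1 (B i))%E.

Lemma indic_rect (B : 'I_d -> set R) (z : vec) :
  \1_(rect B) z = \prod_(i < d) \1_(B i) (tnth z i) :> R.
Proof.
rewrite indicE; case: (boolP (z \in rect B)) => [|zB] /=.
  by rewrite inE => zB; rewrite big1// => i _; rewrite indicE mem_set//; exact: zB.
have [i Bi] : exists i, ~ B i (tnth z i).
  by apply/existsNP => H; move: zB; rewrite notin_setE; exact.
by rewrite (bigD1 i)//= indicE memNset//= mul0r.
Qed.

Lemma measurable_prod_tnth (phi : 'I_d -> R -> R) (P : pred 'I_d) :
  (forall i, measurable_fun setT (phi i)) ->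
  measurable_fun setT (fun z : vec => \prod_(i < d | P i) phi i (tnth z i)).
Proof.
move=> mphi.
have H i : measurable_fun setT (fun z : vec => phi i (tnth z i)).
  by apply: measurableT_comp => //; exact: measurable_tnth.
elim: (index_enum _) => [|i s IH].
  by under eq_fun do rewrite big_nil; exact: measurable_cst.
under eq_fun do rewrite big_cons.
by case: (P i) => //; exact: measurable_funM.
Qed.

(** Independence of the coordinates is known only for indicators. They are traded for general
    functions one coordinate at a time: [claim j] lets the first [j] factors be arbitrary and keeps
    the others indicators, so that [j = 0] is the definition of [std_gaussian]. *)
Lemma ge0_integral_prod (gam : probability vec R) (phi : 'I_d -> R -> R) :
  std_gaussian gam ->
  (forall i, measurable_fun setT (phi i)) -> (forall i x, 0 <= phi i x) ->
  (forall i, \int[gam1]_x (phi i x)%:E < +oo)%E ->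
  (\int[gam]_z (\prod_(i < d) phi i (tnth z i))%:E
   = \prod_(i < d) \int[gam1]_x (phi i x)%:E)%E.
Proof.
move=> Hg mphi phi0 phioo.
suff claim j : (j <= d)%N -> forall phi : 'I_d -> R -> R,
  (forall i, measurable_fun setT (phi i)) -> (forall i x, 0 <= phi i x) ->
  (forall i, \int[gam1]_x (phi i x)%:E < +oo)%E ->
  (forall i : 'I_d, (j <= i)%N -> exists2 B : set R, measurable B & phi i = \1_B) ->
  (\int[gam]_z (\prod_(i < d) phi i (tnth z i))%:E
   = \prod_(i < d) \int[gam1]_x (phi i x)%:E)%E.
  by apply: (claim d) => // i; rewrite leqNgt ltn_ord.
elim: j => [_|j IH jd] {mphi phi0 phioo} {}phi mphi phi0 phioo Hphi.
  have /choice[B HB] : forall i : 'I_d, exists B : set R,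
      measurable B /\ phi i = \1_B.
    by move=> i; have [//|B mB pB] := Hphi i; exists B.
  transitivity (gam (rect B)).
    rewrite -[in RHS](setIT (rect B)) -integral_indic//; last first.
      by apply: measurable_rect => i; have [] := HB i.
    apply: eq_integral => z _; rewrite indic_rect; congr EFin.
    by apply: eq_bigr => i _; have [_ ->] := HB i.
  rewrite Hg; last by move=> i; have [] := HB i.
  apply: eq_bigr => i _; have [mB ->] := HB i.
  by rewrite integral_indic// setIT.
pose i0 := Ordinal jd.
pose w z := \prod_(i < d | i != i0) phi i (tnth z i).
have mw : measurable_fun setT w by exact: measurable_prod_tnth.
have w0 z : 0 <= w z by apply: prodr_ge0.
pose K : \bar R := (\prod_(i < d | i != i0) \int[gam1]_x (phi i x)%:E)%E.
have I0 i : (0 <= \int[gam1]_x (phi i x)%:E)%E.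
  by apply: integral_ge0 => x _; rewrite lee_fin.
have Kfin : K \is a fin_num.
  rewrite /K; elim/big_ind : _ => // [x y|i _]; first exact: fin_numM.
  by rewrite ge0_fin_numE.
have K0 : (0 <= K)%E by rewrite /K; apply: prode_ge0.
have -> : (\int[gam]_z (\prod_(i < d) phi i (tnth z i))%:E =
           \int[gam]_z ((phi i0 (tnth z i0))%:E * (w z)%:E))%E.
  by apply: eq_integral => z _; rewrite (bigD1 i0)//= EFinM.
have -> : (\prod_(i < d) \int[gam1]_x (phi i x)%:E =
           \int[gam1]_x ((phi i0 x)%:E * (cst (fine K) x)%:E))%E.
  rewrite (bigD1 i0)//= -/K; under [RHS]eq_integral do rewrite muleC.
  rewrite ge0_integralZl//.
  - by rewrite fineK// muleC.
  - by apply/measurable_EFinP; exact: mphi.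
  - by move=> x _; rewrite lee_fin.
  - by rewrite lee_fin fine_ge0.
(* The other factors act as a weight. It remains to test indicators in the coordinate [i0], and with
   an indicator there the induction hypothesis applies. *)
apply: (@eq_integral_weight R _ R _ _ _ _ gam gam1 (fun z => tnth z i0) id w (cst (fine K))
  _ mw w0 _ _ _ _ (EFin \o phi i0)) => //.
- exact: measurable_tnth.
- by move=> x; exact: fine_ge0.
- move=> B mB.
  pose phi' i := if i == i0 then \1_B else phi i.
  have mphi' i : measurable_fun setT (phi' i).
    by rewrite /phi'; case: ifP => // _; exact: measurable_indic.
  have phi'0 i x : 0 <= phi' i x by rewrite /phi'; case: ifP.
  have := IH (ltnW jd) phi' mphi' phi'0.
  have -> : (\int[gam]_z (\prod_(i < d) phi' i (tnth z i))%:E =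
           \int[gam]_z (\1_B (tnth z i0) * w z)%:E)%E.
    apply: eq_integral => z _; rewrite (bigD1 i0)//= /phi' eqxx.
    by congr (_ * _)%:E; apply: eq_bigr => i /negPf ->.
  move=> ->.
  + rewrite (bigD1 i0)//= {1}/phi' eqxx.
    transitivity (gam1 B * K)%E.
      rewrite integral_indic// setIT; congr (_ * _)%E.
      by apply: eq_bigr => i /negPf; rewrite /phi' => ->.
    under eq_integral do rewrite mulrC EFinM.
    rewrite ge0_integralZl//.
    * by rewrite integral_indic// setIT fineK// muleC.
    * by apply/measurable_EFinP; exact: measurable_indic.
    * by rewrite lee_fin fine_ge0.
  + move=> i; rewrite /phi'; case: ifP => // _.
    by rewrite integral_indic// setIT (le_lt_trans (probability_le1 gam1 mB))// ltry.
  + move=> i; rewrite leq_eqVlt => /orP[/eqP ji|ji].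
      by exists B => //; rewrite /phi' (_ : i == i0 = true)//; apply/eqP/val_inj.
    rewrite /phi' ifF; first exact: Hphi.
    by apply/eqP => ii0; move: ji; rewrite ii0 ltnn.
- by apply/measurable_EFinP; exact: mphi.
Qed.

End gaussian_vectors.

Lemma eq_integral_weight_rect {R : realType} (dT d1 d2 : measure_display)
    (T : measurableType dT) (n : nat)
    (T1 : measurableType d1) (T2 : measurableType d2)
    (mu1 : {measure set T1 -> \bar R}) (mu2 : {measure set T2 -> \bar R})
    (V1 : T1 -> n.-tuple T) (V2 : T2 -> n.-tuple T) (w1 : T1 -> R) (w2 : T2 -> R) :
  measurable_fun setT V1 -> measurable_fun setT w1 -> (forall x, 0 <= w1 x) ->
  measurable_fun setT V2 -> measurable_fun setT w2 -> (forall x, 0 <= w2 x) ->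
  (\int[mu1]_x (w1 x)%:E < +oo)%E ->
  (forall B : 'I_n -> set T, (forall i, measurable (B i)) ->
     \int[mu1]_x (\1_(rect B) (V1 x) * w1 x)%:E
     = \int[mu2]_x (\1_(rect B) (V2 x) * w2 x)%:E)%E ->
  forall psi : n.-tuple T -> \bar R, measurable_fun setT psi ->
  (\int[mu1]_x (psi (V1 x) * (w1 x)%:E)
   = \int[mu2]_x (psi (V2 x) * (w2 x)%:E))%E.
Proof.
move=> mV1 mw1 w10 mV2 mw2 w20 w1oo H; apply: eq_integral_weight => // A mA.
pose m1 := wmeasure mu1 mV1 mw1 w10; pose m2 := wmeasure mu2 mV2 mw2 w20.
rewrite -!wimageE; apply: (@tuple_measure_unique _ _ _ _ m1 m2) => //.
by move=> B mB; rewrite /m1 /m2 /= !wimageE; exact: H.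
Qed.

Section measurable_vectors.
Context {R : realType} {d : nat} {dT : measure_display} {T : measurableType dT}.
Local Notation vec := (d.-tuple R).
Implicit Types F G : T -> vec.

Lemma measurable_fun_tnth F i : measurable_fun setT F ->
  measurable_fun setT (fun x => tnth (F x) i).
Proof. by move=> /measurable_fun_tnthP/(_ i). Qed.

Lemma measurable_fun_vadd F G : measurable_fun setT F -> measurable_fun setT G ->
  measurable_fun setT (fun x => vadd (F x) (G x)).
Proof.
move=> mF mG; apply/measurable_fun_tnthP => i; rewrite /comp /=.
under eq_fun do rewrite tnth_mktuple.
by apply: measurable_funD; exact: measurable_fun_tnth.
Qed.

Lemma measurable_fun_vsub F G : measurable_fun setT F -> measurable_fun setT G ->
  measurable_fun setT (fun x => vsub (F x) (G x)).
Proof.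
move=> mF mG; apply/measurable_fun_tnthP => i; rewrite /comp /=.
under eq_fun do rewrite tnth_mktuple.
by apply: measurable_funB; exact: measurable_fun_tnth.
Qed.

Lemma measurable_fun_vscale (a : R) F : measurable_fun setT F ->
  measurable_fun setT (fun x => vscale a (F x)).
Proof.
move=> mF; apply/measurable_fun_tnthP => i; rewrite /comp /=.
under eq_fun do rewrite tnth_mktuple.
by apply: measurable_funM => //; exact: measurable_fun_tnth.
Qed.

Lemma measurable_fun_dot F G : measurable_fun setT F -> measurable_fun setT G ->
  measurable_fun setT (fun x => dot (F x) (G x)).
Proof.
move=> mF mG; apply: measurable_sum => i.
by apply: measurable_funM; exact: measurable_fun_tnth.
Qed.

Lemma measurable_fun_sqnorm F : measurable_fun setT F ->
  measurable_fun setT (fun x => sqnorm (F x)).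
Proof.
move=> mF; apply: measurable_sum => i.
by apply: measurable_funX; exact: measurable_fun_tnth.
Qed.

End measurable_vectors.

Section vector_algebra.
Context {R : realType} {d : nat}.
Local Notation vec := (d.-tuple R).
Implicit Types u v x : vec.

Lemma dotC u v : dot u v = dot v u.
Proof. by apply: eq_bigr => i _; rewrite mulrC. Qed.

Lemma dotDr u v x : dot u (vadd v x) = dot u v + dot u x.
Proof. by rewrite /dot -big_split; apply: eq_bigr => i _; rewrite tnth_mktuple mulrDr. Qed.

Lemma dotZr u (a : R) v : dot u (vscale a v) = a * dot u v.
Proof. by rewrite /dot mulr_sumr; apply: eq_bigr => i _; rewrite tnth_mktuple mulrCA. Qed.

Lemma dotZl u (a : R) v : dot (vscale a v) u = a * dot v u.
Proof. by rewrite dotC dotZr (dotC u). Qed.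

Lemma dot0r u : dot u vzero = 0.
Proof. by rewrite /dot big1// => i _; rewrite tnth_mktuple mulr0. Qed.

Lemma sqnormE u : sqnorm u = dot u u.
Proof. by apply: eq_bigr => i _; rewrite expr2. Qed.

Lemma sqnorm_ge0 u : 0 <= sqnorm u.
Proof. by apply: sumr_ge0 => i _; exact: sqr_ge0. Qed.

Lemma vscale0 u : vscale 0 u = vzero.
Proof. by apply: eq_from_tnth => i; rewrite !tnth_mktuple mul0r. Qed.

Lemma vscaleA (a b : R) u : vscale a (vscale b u) = vscale (a * b) u.
Proof. by apply: eq_from_tnth => i; rewrite !tnth_mktuple mulrA. Qed.

Lemma vscaleDr (a : R) u v : vscale a (vadd u v) = vadd (vscale a u) (vscale a v).
Proof. by apply: eq_from_tnth => i; rewrite !tnth_mktuple mulrDr. Qed.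

End vector_algebra.

Section gaussian_calculus.
Context {R : realType} {d : nat}.
Local Notation vec := (d.-tuple R).
Local Notation gam1 := (normal_prob (0 : R) 1).
Variable gam : probability vec R.
Hypothesis Hg : std_gaussian gam.

(** On a rectangle both integrands are products over the coordinates, and the factors match by the
    one-dimensional shift formula. *)
Lemma integral_cameron_martin (v : vec) (psi : vec -> \bar R) :
  measurable_fun setT psi ->
  (\int[gam]_z psi (vadd z v)
   = \int[gam]_z (psi z * (expR (dot v z - sqnorm v / 2))%:E))%E.
Proof.
move=> mpsi.
transitivity (\int[gam]_z (psi (vadd z v) * (cst 1 z)%:E))%E.
  by apply: eq_integral => z _; rewrite mule1.
have mexp : measurable_fun setT (fun z : vec => expR (dot v z - sqnorm v / 2)).
  apply: measurableT_comp => //; apply: measurable_funB => //.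
  exact: measurable_fun_dot.
apply: (@eq_integral_weight_rect R _ _ _ _ _ _ _ gam gam (fun z => vadd z v) id) => //.
- exact: measurable_fun_vadd.
- by rewrite /= integral_prob_cst ltry.
move=> B mB.
pose f1 i (x : R) : R := \1_(B i) (x + tnth v i).
pose f2 i (x : R) : R := \1_(B i) x * expR (tnth v i * x - tnth v i ^+ 2 / 2).
have msh i : measurable_fun setT (fun x : R => x + tnth v i) by exact: measurable_funD.
have mf1 i : measurable_fun setT (f1 i) by apply: measurableT_comp => //; exact: measurable_indic.
have mf2 i : measurable_fun setT (f2 i).
  apply: measurable_funM; first exact: measurable_indic.
  by apply: measurableT_comp => //; exact: measurable_affine.
have f12 i : (\int[gam1]_x (f1 i x)%:E = \int[gam1]_x (f2 i x)%:E)%E.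
  rewrite /f1 (@integral_gauss_shift _ (tnth v i) (EFin \o \1_(B i))).
    by apply: eq_integral => x _; rewrite /= -EFinM.
  by apply/measurable_EFinP; exact: measurable_indic.
have f1oo i : (\int[gam1]_x (f1 i x)%:E < +oo)%E.
  apply: (@le_lt_trans _ _ 1%E); last by rewrite ltry.
  by apply: integral_prob_le1 => [|x]; [exact: mf1|rewrite /f1 indicE ler0n lern1 leq_b1].
transitivity (\int[gam]_z (\prod_(i < d) f1 i (tnth z i))%:E)%E.
  apply: eq_integral => z _; rewrite indic_rect mulr1; congr EFin.
  by apply: eq_bigr => i _; rewrite /f1 tnth_mktuple.
rewrite ge0_integral_prod//.
transitivity (\int[gam]_z (\prod_(i < d) f2 i (tnth z i))%:E)%E.
  rewrite ge0_integral_prod//; first by apply: eq_bigr => i _.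
  by move=> i x; rewrite mulr_ge0// expR_ge0.
  by move=> i; rewrite -f12.
apply: eq_integral => z _; rewrite indic_rect; congr EFin.
rewrite big_split/=; congr (_ * _).
rewrite -expR_sum; congr expR; rewrite big_split/= sumrN -mulr_suml //.
Qed.

(** On a rectangle the inner integral is a product of functions [kap i] of one coordinate each, and
    the outer integral factorizes in turn; each factor is a one-dimensional rotation. *)
Lemma ge0_gauss_conv (a b : R) (psi : vec -> \bar R) : 0 < a ->
  a ^+ 2 + b ^+ 2 = 1 -> measurable_fun setT psi -> (forall x, 0 <= psi x)%E ->
  (\int[gam]_z \int[gam]_z' psi (vadd (vscale b z) (vscale a z'))
   = \int[gam]_z psi z)%E.
Proof.
move=> a0 ab mpsi psi0.
pose V (p : vec * vec) := vadd (vscale b p.1) (vscale a p.2).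
have mV : measurable_fun setT V.
  by apply: measurable_fun_vadd; exact: measurable_fun_vscale.
transitivity (\int[gam \x gam]_p (psi (V p) * (cst 1 p)%:E))%E.
  rewrite fubini_tonelli1//.
  - by apply: eq_integral => z _; apply: eq_integral => z' _; rewrite mule1.
  - by apply: emeasurable_funM => //; exact: measurableT_comp.
  - by move=> p; rewrite mule1.
transitivity (\int[gam]_z (psi z * (cst 1 z)%:E))%E; last first.
  by apply: eq_integral => z _; rewrite mule1.
apply: (@eq_integral_weight_rect R _ _ _ _ _ _ _ (gam \x gam)%E gam V id) => //.
  by rewrite /= integral_prob_cst ltry.
move=> B mB.
rewrite fubini_tonelli1//; last 2 first.
- apply/measurable_EFinP/measurable_funM => //; apply: measurableT_comp => //.
  by apply: measurable_indic; exact: measurable_rect.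
- by move=> p; rewrite lee_fin mulr_ge0.
pose ff i (x y : R) : R := \1_(B i) (a * x + b * y).
pose kap i (y : R) : R := fine (\int[gam1]_x (ff i x y)%:E)%E.
have mff i : measurable_fun setT (fun p : R * R => ff i p.1 p.2).
  apply: measurableT_comp; first exact: measurable_indic.
  by apply: measurable_funD; exact: measurable_funM.
have mffy i y : measurable_fun setT (ff i ^~ y).
  apply: measurableT_comp; first exact: measurable_indic.
  exact: measurable_affine.
have ff1 i y : (\int[gam1]_x (ff i x y)%:E <= 1)%E.
  by apply: integral_prob_le1 => [|x]; [exact: mffy|rewrite /ff indicE ler0n lern1 leq_b1].
have kapE i y : (kap i y)%:E = (\int[gam1]_x (ff i x y)%:E)%E.
  rewrite fineK// ge0_fin_numE ?(le_lt_trans (ff1 i y)) ?ltry//.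
  by apply: integral_ge0 => x _; rewrite lee_fin.
have kap0 i y : 0 <= kap i y.
  by rewrite -lee_fin kapE; apply: integral_ge0 => x _; rewrite lee_fin.
have mkap i : measurable_fun setT (kap i).
  apply/measurable_EFinP.
  have -> : EFin \o kap i = (fun y => (\int[gam1]_x (ff i x y)%:E)%E).
    by apply: funext => y; exact: kapE.
  apply: (@measurable_ge0_integral_snd _ _ _ R (measurableTypeR R) gam1
    (fun y x => (ff i x y)%:E)); last by move=> y x; rewrite lee_fin.
  apply/measurable_EFinP; apply: measurableT_comp; first exact: measurable_indic.
  by apply: measurable_funD; exact: measurable_funM.
have Ikap i : (\int[gam1]_y (kap i y)%:E = gam1 (B i))%E.
  under eq_integral do rewrite kapE.
  transitivity (\int[gam1]_u (\1_(B i) u)%:E)%E; last first.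
    have mBi : measurable (B i : set (measurableTypeR R)) by exact: mB.
    by rewrite integral_indic// setIT.
  apply: (@ge0_integral_gauss_conv _ a b (EFin \o \1_(B i))) => //.
  - by apply/measurable_EFinP; exact: measurable_indic.
  - by move=> x; rewrite lee_fin.
transitivity (\int[gam]_z (\prod_(i < d) kap i (tnth z i))%:E)%E.
  apply: eq_integral => z _; rewrite /fubini_F.
  transitivity (\int[gam]_z' (\prod_(i < d) ff i (tnth z' i) (tnth z i))%:E)%E.
    apply: eq_integral => z' _; rewrite indic_rect mulr1; congr EFin.
    by apply: eq_bigr => i _; rewrite /ff !tnth_mktuple addrC.
  rewrite (@ge0_integral_prod _ _ gam (fun i x => ff i x (tnth z i)))//.
    rewrite -prodEFin; apply: eq_bigr => i _; by rewrite kapE.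
  by move=> i; rewrite (le_lt_trans (ff1 _ _)) ?ltry.
rewrite ge0_integral_prod//; last first.
  by move=> i; rewrite Ikap (le_lt_trans (probability_le1 gam1 (mB i)))// ltry.
under eq_integral do rewrite mulr1.
rewrite integral_indic//; last exact: measurable_rect.
by rewrite setIT; apply: (etrans _ (esym (Hg mB))); apply: eq_bigr => i _; exact: Ikap.
Qed.

(** Semigroup property of the heat flow: dividing by [sqrt (s + e)] turns the sum of two independent
    increments into a rotation. Only the coefficient of the second increment has to be positive, so
    the flow may start at time [0]. *)
Lemma ge0_gauss_step (s e : R) (psi : vec -> \bar R) : 0 <= s -> 0 < e ->
  measurable_fun setT psi -> (forall x, 0 <= psi x)%E ->
  (\int[gam]_z \int[gam]_z' psi (vadd (vscale (Num.sqrt s) z) (vscale (Num.sqrt e) z'))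
   = \int[gam]_z psi (vscale (Num.sqrt (s + e)) z))%E.
Proof.
move=> s0 e0 mpsi psi0.
have se0 : 0 < s + e by rewrite ltr_wpDl.
have r0 : 0 < Num.sqrt (s + e) by rewrite sqrtr_gt0.
pose a := Num.sqrt e / Num.sqrt (s + e); pose b := Num.sqrt s / Num.sqrt (s + e).
have a0 : 0 < a by rewrite divr_gt0// sqrtr_gt0.
have ab : a ^+ 2 + b ^+ 2 = 1.
  rewrite !expr_div_n !sqr_sqrtr ?(ltW e0) ?(ltW se0)// -mulrDl addrC divff//.
  by rewrite gt_eqF.
have mp : measurable_fun setT (fun z => psi (vscale (Num.sqrt (s + e)) z)).
  by apply: measurableT_comp => //; exact: measurable_fun_vscale.
apply: (etrans _ (ge0_gauss_conv a0 ab mp (fun z => psi0 _))).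
apply: eq_integral => z _; apply: eq_integral => z' _; congr psi.
rewrite vscaleDr !vscaleA; congr (vadd (vscale _ _) (vscale _ _));
  by rewrite mulrC divfK// gt_eqF.
Qed.

End gaussian_calculus.

(** * Laws of random variables, and independence of the fresh noise from the past *)

Section image_probability.
Context {R : realType} {dO dU : measure_display} {Omega : measurableType dO}
  {U : measurableType dU}.

(** The same set function as [law], packaged as a probability so that integration theory applies to
    it. *)
Definition dist (P : probability Omega R) (V : Omega -> U)
    (mV : measurable_fun setT V) : probability U R :=
  distribution P (HB.pack V (isMeasurableFun.Build _ _ _ _ V mV)
                  : {mfun Omega >-> U}).

Lemma ge0_integral_dist (P : probability Omega R) (V : Omega -> U)
    (mV : measurable_fun setT V) (psi : U -> \bar R) :
  measurable_fun setT psi -> (forall u, 0 <= psi u)%E ->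
  (\int[dist P mV]_u psi u = \int[P]_w psi (V w))%E.
Proof. by move=> mpsi psi0; exact: ge0_integral_pushforward. Qed.

End image_probability.

Section fresh_noise.
Context {R : realType} {d : nat} {dO : measure_display} {Omega : measurableType dO}.
Local Notation vec := (d.-tuple R).
Variables (P : probability Omega R) (X : Omega -> vec) (N : nat -> Omega -> vec).
Variable gam : probability vec R.
Hypotheses (mX : measurable_fun setT X) (mN : forall k, measurable_fun setT (N k)).
Hypothesis Hiid : iid_std_gaussian_indep_of P X N.
Hypothesis Hg : std_gaussian gam.

(** Cylinder events in [X, N 1, ..., N m]. They form a pi-system on which the independence
    hypothesis can be read off, and they generate all the information available before step
    [m.+1]. *)
Definition past (m : nat) : set (set Omega) :=
  [set E | exists A (B : nat -> 'I_d -> set R),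
    [/\ measurable A, (forall k i, measurable (B k i)) &
     E = X @^-1` A `&`
       [set w | forall k i, (1 <= k <= m)%N -> B k i (tnth (N k w) i)]]].

Lemma measurable_past m E : past m E -> measurable E.
Proof.
move=> [A [B [mA mB ->]]]; apply: measurableI.
  by rewrite -[X in measurable X]setTI; exact: mX.
rewrite (_ : [set w | _] = \bigcap_(k in [set k | (1 <= k <= m)%N])
    \bigcap_(i in [set: 'I_d]) ((fun w => tnth (N k w) i) @^-1` B k i)).
  apply: bigcap_measurableType => k _; apply: fin_bigcap_measurable => // i _.
  by rewrite -[X in measurable X]setTI; apply: measurable_fun_tnth => //; exact: mN.
apply/seteqP; split => w /= H.
  by move=> k km i _; exact: H.
by move=> k i km; exact: (H k km i I).
Qed.

Lemma pastT m : past m setT.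
Proof.
exists setT, (fun _ _ => setT); split => //.
by rewrite preimage_setT setTI; apply/seteqP; split.
Qed.

Lemma pastI m : setI_closed (past m).
Proof.
move=> _ _ [A [B [mA mB ->]]] [A' [B' [mA' mB' ->]]].
exists (A `&` A'), (fun k i => B k i `&` B' k i); split.
- exact: measurableI.
- by move=> k i; exact: measurableI.
- apply/seteqP; split => w /=.
    by move=> [[Aw Bw] [A'w B'w]]; split => // k i km; split; [exact: Bw|exact: B'w].
  by move=> [[Aw A'w] BB]; split; split => // k i km; have [] := BB k i km.
Qed.

(** For a cylinder and a rectangle this is the hypothesis [Hiid] at length [m.+1]. Uniqueness of
    finite measures extends it first in [C], then in [E]. *)
Lemma past_indep m E C : <<s past m >> E -> measurable C ->
  P (E `&` N m.+1 @^-1` C) = (P E * gam C)%E.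
Proof.
have step1 E' (B' : 'I_d -> set R) : past m E' -> (forall i, measurable (B' i)) ->
    P (E' `&` N m.+1 @^-1` rect B') = (P E' * gam (rect B'))%E.
  move=> [A [B [mA mB ->]]] mB'.
  (* The cylinder of length [m] and the rectangle for the next noise vector merge into one cylinder
     of length [m.+1]. *)
  pose B2 k i := if k == m.+1 then B' i else B k i.
  have mB2 k i : measurable (B2 k i) by rewrite /B2; case: ifP.
  rewrite (_ : _ `&` _ = X @^-1` A `&`
       [set w | forall k i, (1 <= k <= m.+1)%N -> B2 k i (tnth (N k w) i)]).
    rewrite (Hiid _ mA mB2) (Hiid _ mA mB) -muleA; congr (_ * _)%E.
    rewrite big_nat_recr//= Hg//; congr (_ * _)%E.
      apply: eq_big_nat => k /andP[_ km]; apply: eq_bigr => i _.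
      by rewrite /B2 ifF//; apply/eqP => kE; move: km; rewrite kE ltnn.
    by apply: eq_bigr => i _; rewrite /B2 eqxx.
  apply/seteqP; split => w /=.
    move=> [[Aw Bw] B'w]; split => // k i /andP[k1 km].
    rewrite /B2; case: eqP => [->|/eqP kE]; first exact: B'w.
    by apply: Bw; rewrite k1 /= -ltnS ltn_neqAle kE.
  move=> [Aw B2w]; split; first split => //.
    move=> k i /andP[k1 km]; have := B2w k i; rewrite k1 (leq_trans km)// => /(_ isT).
    by rewrite /B2 ifF//; apply/eqP => kE; move: km; rewrite kE ltnn.
  by move=> i; have := B2w m.+1 i; rewrite leqnn /B2 eqxx; exact.
have step2 E' C' : past m E' -> measurable C' ->
    P (E' `&` N m.+1 @^-1` C') = (P E' * gam C')%E.
  move=> pE mC'.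
  have mE := measurable_past pE.
  have mind : measurable_fun setT (\1_E' : Omega -> R) by exact: measurable_indic.
  have ind0 w : 0 <= \1_E' w :> R by [].
  have c0 : 0 <= fine (P E') by exact: fine_ge0.
  pose m1 := wmeasure P (mN m.+1) mind ind0.
  pose m2 := @wmeasure _ _ _ _ _ gam id (cst (fine (P E'))) (@measurable_id _ _ _)
     (measurable_cst _) (fun=> c0).
  have m1E D : measurable D -> m1 D = P (E' `&` N m.+1 @^-1` D).
    move=> mD; rewrite /m1 /= /wimage integral_indic//.
    by rewrite -[X in measurable X]setTI; exact: mN.
  have m2E D : measurable D -> m2 D = (P E' * gam D)%E.
    move=> mD; rewrite /m2 /= /wimage preimage_id.
    rewrite (eq_integral (cst (P E')))//; first by rewrite integral_cst.
    by move=> x _; rewrite /cst fineK// fin_num_measure.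
  rewrite -m1E// -m2E//; apply: tuple_measure_unique => //.
    by rewrite m1E// (le_lt_trans (probability_le1 _ _)) ?ltry// preimage_setT setIT.
  move=> B mB; rewrite m1E ?m2E ?step1//; exact: measurable_rect.
move=> sE mC.
have mNC : measurable (N m.+1 @^-1` C) by rewrite -[X in measurable X]setTI; exact: mN.
have mind : measurable_fun setT (\1_(N m.+1 @^-1` C) : Omega -> R) by exact: measurable_indic.
have ind0 w : 0 <= \1_(N m.+1 @^-1` C) w :> R by [].
have c0 : 0 <= fine (gam C) by exact: fine_ge0.
pose m1 := @wmeasure _ _ _ _ _ P id _ (@measurable_id _ _ _) mind ind0.
pose m2 := @wmeasure _ _ _ _ _ P id (cst (fine (gam C))) (@measurable_id _ _ _)
     (measurable_cst _) (fun=> c0).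
have m1E D : measurable D -> m1 D = P (D `&` N m.+1 @^-1` C).
  by move=> mD; rewrite /m1 /= /wimage integral_indic// setIC.
have m2E D : measurable D -> m2 D = (P D * gam C)%E.
  move=> mD; rewrite /m2 /= /wimage preimage_id.
  rewrite (eq_integral (cst (gam C)))//; first by rewrite integral_cst// muleC.
  by move=> x _; rewrite /cst fineK// fin_num_measure.
have mE : measurable E.
  apply: (smallest_sub _ _ sE); first exact: sigma_algebra_measurable.
  by move=> A; exact: measurable_past.
rewrite -m1E// -m2E//.
apply: (@g_sigma_algebra_measure_unique _ _ _ (past m) _ (fun=> setT)) => //.
- by move=> A; exact: measurable_past.
- by move=> _; exact: pastT.
- by apply/seteqP; split => // w _; exists 0%N.
- exact: pastI.
- by move=> A pA; rewrite m1E ?m2E ?step2//; exact: measurable_past pA.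
- by move=> _; rewrite m1E// (le_lt_trans (probability_le1 _ _)) ?ltry// setTI.
Qed.

(** By independence the joint law of [S] and the fresh noise is the product of their laws, so
    Tonelli's theorem lets the noise be integrated with [S] frozen. *)
Lemma ge0_integral_fresh (dU : measure_display) (U : measurableType dU) (m : nat)
    (S : Omega -> U) (psi : U -> vec -> \bar R) :
  (forall A, measurable A -> <<s past m >> (S @^-1` A)) ->
  measurable_fun setT (fun p : U * vec => psi p.1 p.2) ->
  (forall u z, 0 <= psi u z)%E ->
  (\int[P]_w psi (S w) (N m.+1 w) = \int[P]_w \int[gam]_z psi (S w) z)%E.
Proof.
move=> sS mpsi psi0.
have mS : measurable_fun setT S.
  move=> _ A mA; rewrite setTI.
  apply: (smallest_sub _ _ (sS A mA)); first exact: sigma_algebra_measurable.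
  by move=> E; exact: measurable_past.
have mSN : measurable_fun setT (fun w => (S w, N m.+1 w)).
  exact: measurable_fun_pair.
pose f p := psi p.1 p.2.
transitivity (\int[dist P mSN]_p f p)%E.
  by rewrite ge0_integral_dist// => p; exact: psi0.
transitivity (\int[(dist P mS \x gam)%E]_p f p)%E.
  apply: eq_measure_integral => A mA _; apply/esym.
  apply: product_measure_unique => // B C mB mC.
  exact: (past_indep (sS B mB) mC).
rewrite fubini_tonelli1//; last by move=> p; exact: psi0.
rewrite ge0_integral_dist//.
- exact: (@measurable_ge0_integral_snd _ _ _ _ _ gam psi).
- by move=> u; apply: integral_ge0 => z _; exact: psi0.
Qed.

Lemma measurable_past_X m :
  measurable_fun (setT : set (g_sigma_algebraType (past m))) X.
Proof.
move=> _ A mA; rewrite setTI; apply: sub_sigma_algebra.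
exists A, (fun _ _ => setT); split => //.
by rewrite (_ : [set w | _] = setT) ?setIT//; apply/seteqP; split.
Qed.

Lemma measurable_past_N m k : (1 <= k <= m)%N ->
  measurable_fun (setT : set (g_sigma_algebraType (past m))) (N k).
Proof.
move=> km; apply/measurable_fun_tnthP => i _ A mA; rewrite setTI; apply: sub_sigma_algebra.
exists setT, (fun k' i' => if (k' == k) && (i' == i) then A else setT); split => //.
  by move=> k' i'; case: ifP.
rewrite preimage_setT setTI; apply/seteqP; split => w /=.
  by move=> Aw k' i' _; case: ifP => // /andP[/eqP-> /eqP->].
by move=> /(_ k i km); rewrite !eqxx.
Qed.

End fresh_noise.

(** * Walks with drift, expressed through driftless Gaussian increments *)

Section drifted_walk.
Context {R : realType} {d : nat}.
Local Notation vec := (d.-tuple R).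

(* [drift k x y] is the drift of step [k] from position [y] when the hidden
   variable is [x]: this covers both the comparison process ([drift k x y = x])
   and the sampling process ([drift k x y = f k y]). *)
Fixpoint gproc {Omega : Type} (delta : nat -> R) (drift : nat -> vec -> vec -> vec)
    (X : Omega -> vec) (N : nat -> Omega -> vec) (k : nat) (w : Omega) : vec :=
  if k is k'.+1 then
    vadd (vadd (gproc delta drift X N k' w)
               (vscale (delta k) (drift k (X w) (gproc delta drift X N k' w))))
         (vscale (Num.sqrt (delta k)) (N k w))
  else vzero.

Variables (delta : nat -> R) (drift : nat -> vec -> vec -> vec).
Hypothesis delta_gt0 : forall k, 0 < delta k.+1.
Hypothesis mdrift : forall k,
  measurable_fun setT (fun p : vec * vec => drift k.+1 p.1 p.2).

Lemma measurable_gproc {dO : measure_display} {Omega : measurableType dO}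
    (X : Omega -> vec) (N : nat -> Omega -> vec) n :
  measurable_fun setT X ->
  (forall k, (1 <= k <= n)%N -> measurable_fun setT (N k)) ->
  measurable_fun setT (gproc delta drift X N n).
Proof.
move=> mX; elim: n => [|n IH] mN /=; first exact: measurable_cst.
have mV : measurable_fun setT (gproc delta drift X N n).
  by apply: IH => k /andP[k1 kn]; apply: mN; rewrite k1 (leq_trans kn).
apply: measurable_fun_vadd; last first.
  by apply: measurable_fun_vscale; apply: mN; rewrite leqnn.
apply: measurable_fun_vadd => //; apply: measurable_fun_vscale.
exact: (measurableT_comp (mdrift n) (measurable_fun_pair mX mV)).
Qed.

Variable gam : probability vec R.
Hypothesis Hg : std_gaussian gam.
Variable q : nat -> vec -> vec -> vec -> R.
Hypothesis q0 : forall k x y y', 0 <= q k x y y'.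
Hypothesis mq : forall k,
  measurable_fun setT (fun p : (vec * vec) * vec => q k.+1 p.1.1 p.1.2 p.2).

(** Cameron--Martin factor of one step. A displacement [delta * drift] is a shift of the noise by
    [sqrt delta * drift], because the noise enters with amplitude [sqrt delta]. *)
Definition tilt k (x y z : vec) : R :=
  let v := vscale (Num.sqrt (delta k)) (drift k x y) in
  expR (dot v z - sqnorm v / 2).

Definition step_int k (x : vec) (u : vec -> \bar R) (y : vec) : \bar R :=
  (\int[gam]_z (let y' := vadd y (vscale (Num.sqrt (delta k)) z) in
     u y' * (q k x y y' * tilt k x y z)%:E))%E.

(* The weighted expectation of the walk, integrated out step by step against
   driftless Gaussian increments. *)
Fixpoint walk_int n (x : vec) (u : vec -> \bar R) : \bar R :=
  if n is n'.+1 then walk_int n' x (step_int n x u) else u vzero.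

Lemma measurable_step_int k (u : vec -> vec -> \bar R) :
  measurable_fun setT (fun p : vec * vec => u p.1 p.2) ->
  (forall x y, 0 <= u x y)%E ->
  measurable_fun setT (fun p : vec * vec => step_int k.+1 p.1 (u p.1) p.2).
Proof.
move=> mu u0.
apply: (@measurable_ge0_integral_snd _ _ _ _ _ gam (fun (p : vec * vec) z =>
  let y' := vadd p.2 (vscale (Num.sqrt (delta k.+1)) z) in
  u p.1 y' * (q k.+1 p.1 p.2 y' * tilt k.+1 p.1 p.2 z)%:E)%E); last first.
  by move=> x y; rewrite mule_ge0// lee_fin mulr_ge0// expR_ge0.
have m1 : measurable_fun setT (fun p : vec * vec * vec => p.1.1) by exact: measurableT_comp.
have m2 : measurable_fun setT (fun p : vec * vec * vec => p.1.2) by exact: measurableT_comp.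
have my : measurable_fun setT
    (fun p : vec * vec * vec => vadd p.1.2 (vscale (Num.sqrt (delta k.+1)) p.2)).
  by apply: measurable_fun_vadd => //; exact: measurable_fun_vscale.
apply: emeasurable_funM.
  exact: (measurableT_comp mu (measurable_fun_pair m1 my)).
apply/measurable_EFinP; apply: measurable_funM.
  exact: (measurableT_comp (mq k) (measurable_fun_pair measurable_fst my)).
have mv : measurable_fun setT (fun p : vec * vec * vec =>
    vscale (Num.sqrt (delta k.+1)) (drift k.+1 p.1.1 p.1.2)).
  apply: measurable_fun_vscale.
  exact: (measurableT_comp (mdrift k) (measurable_fun_pair m1 m2)).
apply: measurableT_comp => //; apply: measurable_funB.
  exact: measurable_fun_dot.
by apply: measurable_funM => //; exact: measurable_fun_sqnorm.
Qed.

Lemma step_int_ge0 k x (u : vec -> \bar R) y :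
  (forall y, 0 <= u y)%E -> (0 <= step_int k x u y)%E.
Proof.
move=> u0; apply: integral_ge0 => z _.
by rewrite mule_ge0// lee_fin mulr_ge0// expR_ge0.
Qed.

Context {dO : measure_display} {Omega : measurableType dO}.
Variables (P : probability Omega R) (X : Omega -> vec) (N : nat -> Omega -> vec).
Hypotheses (mX : measurable_fun setT X) (mN : forall k, measurable_fun setT (N k)).
Hypothesis Hiid : iid_std_gaussian_indep_of P X N.
Local Notation V := (gproc delta drift X N).

(** [q] gathers the factors attached to single transitions: indicators describing a rectangle of
    paths and, for the sampling process, also the inverse likelihood of the step. *)
Definition weight n (w : Omega) : R :=
  \prod_(k < n) q k.+1 (X w) (V k w) (V k.+1 w).

Lemma weight_ge0 n w : 0 <= weight n w.
Proof. by apply: prodr_ge0. Qed.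

(** The last step is peeled off: given the past its noise is Gaussian, and the Cameron--Martin
    formula trades the drift for the factor [tilt]. The function [u] absorbs the step, so the
    induction runs over all [u]. *)
Lemma integral_walk n (u : vec -> vec -> \bar R) :
  measurable_fun setT (fun p : vec * vec => u p.1 p.2) ->
  (forall x y, 0 <= u x y)%E ->
  (\int[P]_w (u (X w) (V n w) * (weight n w)%:E)
   = \int[P]_w walk_int n (X w) (u (X w)))%E.
Proof.
elim: n u => [|n IH] u mu u0.
  by apply: eq_integral => w _; rewrite /weight big_ord0 mule1.
rewrite /= -(IH (fun x => step_int n.+1 x (u x))); last 2 first.
- exact: measurable_step_int.
- by move=> x y; exact: step_int_ge0.
pose nxt (x y z : vec) := vadd (vadd y (vscale (delta n.+1) (drift n.+1 x y)))
         (vscale (Num.sqrt (delta n.+1)) z).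
(* The absolute value makes [psi] nonnegative for every [s]; it has no effect at the weights that
   occur. *)
pose psi (s : R * (vec * vec)) (z : vec) :=
  (u s.2.1 (nxt s.2.1 s.2.2 z) *
   (`|s.1| * q n.+1 s.2.1 s.2.2 (nxt s.2.1 s.2.2 z))%:E)%E.
(* The past enters only through the accumulated weight, the hidden variable and the current
   position. *)
pose S w := (weight n w, (X w, V n w)).
transitivity (\int[P]_w psi (S w) (N n.+1 w))%E.
  apply: eq_integral => w _; rewrite /psi /S /=; congr (_ * _)%E.
  rewrite ger0_norm ?weight_ge0// /weight big_ord_recr/=; congr EFin.
(* Stated over an arbitrary measurable space because it is applied to the sigma-algebra of the past,
   where only [N 1, ..., N n] are known to be measurable. *)
have mW (dd : measure_display) (O' : measurableType dd) (X' : O' -> vec)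
    (N' : nat -> O' -> vec) : measurable_fun setT X' ->
    (forall k, (1 <= k <= n)%N -> measurable_fun setT (N' k)) ->
    measurable_fun setT (fun w => \prod_(k < n) q k.+1 (X' w)
      (gproc delta drift X' N' k w) (gproc delta drift X' N' k.+1 w)).
  move=> mX' mN'; apply: measurable_prod => k _.
  have mVk j : (j <= n)%N -> measurable_fun setT (gproc delta drift X' N' j).
    move=> jn; apply: measurable_gproc => // i /andP[i1 ij].
    by apply: mN'; rewrite i1 (leq_trans ij).
  apply: (measurableT_comp (mq k) (measurable_fun_pair (measurable_fun_pair mX' _) _)).
    by apply: mVk; exact: ltnW.
  exact: (mVk k.+1 (ltn_ord k)).
rewrite (@ge0_integral_fresh _ _ _ _ P X N gam mX mN Hiid Hg _ _ n S psi); last 3 first.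
- move=> A mA.
  have mS : measurable_fun (setT : set (g_sigma_algebraType (past X N n))) S.
    have mX' := @measurable_past_X _ _ _ _ X N n.
    have mN' k : (1 <= k <= n)%N -> measurable_fun
      (setT : set (g_sigma_algebraType (past X N n))) (N k).
      exact: measurable_past_N.
    apply: measurable_fun_pair; first exact: (mW _ (g_sigma_algebraType (past X N n)) X N mX' mN').
    apply: measurable_fun_pair => //.
    exact: (@measurable_gproc _ (g_sigma_algebraType (past X N n)) X N n mX' mN').
  by have := mS measurableT A mA; rewrite setTI.
- have m1 : measurable_fun setT (fun p : R * (vec * vec) * vec => p.1.2.1).
    by do 2 apply: measurableT_comp => //.
  have m2 : measurable_fun setT (fun p : R * (vec * vec) * vec => p.1.2.2).
    by do 2 apply: measurableT_comp => //.
  have my : measurable_fun setT (fun p : R * (vec * vec) * vec => nxt p.1.2.1 p.1.2.2 p.2).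
    apply: measurable_fun_vadd; last exact: measurable_fun_vscale.
    apply: measurable_fun_vadd => //; apply: measurable_fun_vscale.
    exact: (measurableT_comp (mdrift n) (measurable_fun_pair m1 m2)).
  apply: emeasurable_funM.
    exact: (measurableT_comp mu (measurable_fun_pair m1 my)).
  apply/measurable_EFinP; apply: measurable_funM.
    by do 2 apply: measurableT_comp => //.
  exact: (measurableT_comp (mq n) (measurable_fun_pair (measurable_fun_pair m1 m2) my)).
- by move=> s z; rewrite mule_ge0// lee_fin mulr_ge0.
apply: eq_integral => w _; rewrite /S; set x := X w; set y := V n w.
pose v := vscale (Num.sqrt (delta n.+1)) (drift n.+1 x y).
pose F z := (let y' := vadd y (vscale (Num.sqrt (delta n.+1)) z) in
   u x y' * (q n.+1 x y y')%:E)%E.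
have mF : measurable_fun setT F.
  have my : measurable_fun setT (fun z : vec => vadd y (vscale (Num.sqrt (delta n.+1)) z)).
    by apply: measurable_fun_vadd => //; exact: measurable_fun_vscale.
  apply: emeasurable_funM.
    exact: (measurableT_comp mu (measurable_fun_pair (measurable_cst x) my)).
  apply/measurable_EFinP.
  exact: (measurableT_comp (mq n) (measurable_fun_pair (measurable_cst (x, y)) my)).
have F0 z : (0 <= F z)%E by rewrite mule_ge0// lee_fin.
have mFv : measurable_fun setT (fun z => F (vadd z v)).
  by apply: measurableT_comp => //; exact: measurable_fun_vadd.
transitivity (\int[gam]_z ((weight n w)%:E * F (vadd z v)))%E.
  apply: eq_integral => z _; rewrite /psi /F /=.
  (* The drift is absorbed into the noise as the shift [v], by [delta = sqrt delta * sqrt delta]. *)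
  have -> : nxt x y z = vadd y (vscale (Num.sqrt (delta n.+1)) (vadd z v)).
    apply: eq_from_tnth => i; rewrite !tnth_mktuple.
    rewrite mulrDr mulrA -expr2 sqr_sqrtr ?(ltW (delta_gt0 _))//; ring.
  by rewrite ger0_norm ?weight_ge0// EFinM muleCA.
rewrite ge0_integralZl//; last by rewrite lee_fin weight_ge0.
rewrite muleC; congr (_ * _)%E.
rewrite (integral_cameron_martin Hg v mF).
by apply: eq_integral => z _; rewrite /F /= -muleA -EFinM.
Qed.

End drifted_walk.

Section driftless_walk.
Context {R : realType} {d : nat}.
Local Notation vec := (d.-tuple R).
Variables (delta : nat -> R) (gam : probability vec R).
Hypothesis delta_gt0 : forall k, 0 < delta k.+1.
Hypothesis Hg : std_gaussian gam.

Definition elapsed n : R := \sum_(k < n) delta k.+1.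

Lemma elapsed0 : elapsed 0 = 0.
Proof. by rewrite /elapsed big_ord0. Qed.

Lemma elapsedS n : elapsed n.+1 = elapsed n + delta n.+1.
Proof. by rewrite /elapsed big_ord_recr. Qed.

Lemma elapsed_ge0 n : 0 <= elapsed n.
Proof. by apply: sumr_ge0 => k _; exact: ltW. Qed.

Lemma elapsed_gt0 n : 0 < elapsed n.+1.
Proof. by rewrite elapsedS ltr_wpDl// elapsed_ge0. Qed.

(* The likelihood at time [t] and position [y] of the Gaussian walk with drift
   [x], relative to the driftless one. *)
Definition lik (x y : vec) (t : R) : R := expR (dot x y - t / 2 * sqnorm x).

Lemma lik_gt0 x y t : 0 < lik x y t.
Proof. exact: expR_gt0. Qed.

Lemma lik_ge0 x y t : 0 <= lik x y t.
Proof. exact: expR_ge0. Qed.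

Lemma lik00 x : lik x vzero 0 = 1.
Proof. by rewrite /lik dot0r mul0r mul0r subrr expR0. Qed.

Lemma likD x y z s t :
  lik x (vadd y z) (s + t) = lik x y s * lik x z t.
Proof. by rewrite /lik dotDr -expRD; congr expR; ring. Qed.

Lemma measurable_fun_lik (dT : measure_display) (T : measurableType dT)
    (F H : T -> vec) t :
  measurable_fun setT F -> measurable_fun setT H ->
  measurable_fun setT (fun p => lik (F p) (H p) t).
Proof.
move=> mF mH; apply: measurableT_comp => //; apply: measurable_funB.
  exact: measurable_fun_dot.
by apply: measurable_funM => //; exact: measurable_fun_sqnorm.
Qed.

Variable A : nat -> set vec.
Hypothesis mA : forall k, measurable (A k).

(** The common reference of both processes: the driftless walk restricted to paths whose position
    [k] lies in [A k]. *)
Fixpoint rwalk n (u : vec -> \bar R) : \bar R :=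
  if n is n'.+1 then
    rwalk n' (fun y => \int[gam]_z
      (let y' := vadd y (vscale (Num.sqrt (delta n)) z) in
       u y' * (\1_(A n) y')%:E))%E
  else u vzero.

Let measurable_next (dT : measure_display) (T : measurableType dT)
    (F H : T -> vec) a : measurable_fun setT F -> measurable_fun setT H ->
  measurable_fun setT (fun p => vadd (F p) (vscale a (H p))).
Proof. by move=> mF mH; apply: measurable_fun_vadd => //; exact: measurable_fun_vscale. Qed.

(** When the drift is the same vector at all steps, the likelihoods of successive increments
    multiply to one that depends only on the end point and the elapsed time ([likD]). *)
Lemma walk_int_const_drift n x (u : vec -> \bar R) :
  measurable_fun setT u -> (forall y, 0 <= u y)%E ->
  walk_int delta (fun _ x _ => x) gam (fun k _ _ y' => \1_(A k) y') n x u
  = rwalk n (fun y => u y * (lik x y (elapsed n))%:E)%E.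
Proof.
elim: n u => [|n IH] u mu u0; first by rewrite /= elapsed0 lik00 mule1.
have mstep : measurable_fun setT
    (step_int delta (fun _ x _ => x) gam (fun k _ _ y' => \1_(A k) y') n.+1 x u).
  have mdr (k : nat) : measurable_fun setT (fun p : vec * vec => p.1) by exact: measurable_fst.
  have q0 (k : nat) (x' y y' : vec) : 0 <= \1_(A k) y' :> R by [].
  have mq k : measurable_fun setT (fun p : vec * vec * vec => \1_(A k.+1) p.2 : R).
    by apply: measurableT_comp => //; exact: measurable_indic.
  have mu' : measurable_fun setT (fun p : vec * vec => u p.2).
    by apply: measurableT_comp.
  have H := @measurable_step_int _ _ delta (fun _ x _ => x) mdr gam
    (fun k _ _ y' => \1_(A k) y') q0 mq n (fun=> u) mu' (fun=> u0).
  exact: (measurableT_comp H (measurable_pair1 x)).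
rewrite /= IH//; last by move=> y; apply: step_int_ge0.
congr (rwalk n _); apply: funext => y.
rewrite muleC -ge0_integralZl//; last 3 first.
- have my : measurable_fun setT (fun z : vec => vadd y (vscale (Num.sqrt (delta n.+1)) z)).
    exact: measurable_next.
  apply: emeasurable_funM; first exact: measurableT_comp.
  apply/measurable_EFinP; apply: measurable_funM.
    by apply: measurableT_comp => //; exact: measurable_indic.
  apply: measurableT_comp => //; apply: measurable_funB => //.
  exact: measurable_fun_dot.
- by move=> z _; rewrite mule_ge0// lee_fin mulr_ge0// expR_ge0.
- by rewrite lee_fin lik_ge0.
apply: eq_integral => z _ /=; rewrite muleCA -!muleA; congr (_ * _)%E.
rewrite -!EFinM; congr EFin.
rewrite [RHS]mulrC mulrCA; congr (_ * _); rewrite elapsedS likD; congr (_ * _).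
rewrite /lik /tilt; congr expR; rewrite dotZr dotZl; congr (_ - _).
rewrite !sqnormE dotZr dotZl mulrA -expr2 sqr_sqrtr ?(ltW (delta_gt0 _))//.
by ring.
Qed.

Variable f : nat -> vec -> vec.

(* Inverse of the likelihood of one step of the sampling process. *)
Definition invlik k (y y' : vec) : R :=
  expR (- dot (f k y) (vsub y' y) + delta k / 2 * sqnorm (f k y)).

(** Along a driftless increment [invlik] is the reciprocal of [tilt], so the two factors cancel step
    by step. *)
Lemma walk_int_sampling n x (u : vec -> \bar R) :
  walk_int delta (fun k _ y => f k y) gam
    (fun k _ y y' => \1_(A k) y' * invlik k y y') n x u = rwalk n u.
Proof.
elim: n u => [//|n IH] u /=; rewrite IH; congr (rwalk n _); apply: funext => y.
apply: eq_integral => z _ /=; congr (_ * _%:E)%E.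
rewrite -mulrA -[RHS]mulr1; congr (_ * _); rewrite /invlik /tilt -expRD.
rewrite -[RHS]expR0; congr expR.
have -> : vsub (vadd y (vscale (Num.sqrt (delta n.+1)) z)) y =
          vscale (Num.sqrt (delta n.+1)) z.
  by apply: eq_from_tnth => i; rewrite !tnth_mktuple addrC addKr.
rewrite !sqnormE !dotZr !dotZl mulrA -expr2 sqr_sqrtr ?(ltW (delta_gt0 _))//.
by ring.
Qed.

(** Tonelli's theorem at every step; it moves the average over the hidden variable inside the walk,
    where it forms the mixture likelihood. *)
Lemma integral_rwalk (dO : measure_display) (Omega : measurableType dO)
    (P : probability Omega R) n (u : Omega -> vec -> \bar R) :
  measurable_fun setT (fun p : Omega * vec => u p.1 p.2) ->
  (forall w y, 0 <= u w y)%E ->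
  (\int[P]_w rwalk n (u w) = rwalk n (fun y => \int[P]_w u w y))%E.
Proof.
elim: n u => [//|n IH] u mu u0 /=.
have mnext : measurable_fun setT (fun p : (Omega * vec) * vec =>
    let y' := vadd p.1.2 (vscale (Num.sqrt (delta n.+1)) p.2) in
    (u p.1.1 y' * (\1_(A n.+1) y')%:E)%E).
  have my : measurable_fun setT (fun p : (Omega * vec) * vec =>
      vadd p.1.2 (vscale (Num.sqrt (delta n.+1)) p.2)).
    by apply: measurable_next => //; exact: measurableT_comp.
  apply: emeasurable_funM.
    apply: (measurableT_comp mu (measurable_fun_pair _ my)).
    exact: measurableT_comp.
  by apply/measurable_EFinP; apply: measurableT_comp => //; exact: measurable_indic.
rewrite IH; last 2 first.
- apply: (@measurable_ge0_integral_snd _ _ _ _ _ gam (fun (p : Omega * vec) z =>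
    let y' := vadd p.2 (vscale (Num.sqrt (delta n.+1)) z) in
    (u p.1 y' * (\1_(A n.+1) y')%:E)%E)) => //.
  by move=> p z; rewrite mule_ge0.
- by move=> w y; apply: integral_ge0 => z _; rewrite mule_ge0.
congr (rwalk n _); apply: funext => y.
rewrite (@ge0_fubini _ _ _ _ _ P gam (fun w z =>
    let y' := vadd y (vscale (Num.sqrt (delta n.+1)) z) in
    (u w y' * (\1_(A n.+1) y')%:E)%E)); last 2 first.
- apply: (measurableT_comp mnext (measurable_fun_pair (measurable_fun_pair _ _) _)) => //.
- by move=> w z; rewrite mule_ge0.
apply: eq_integral => z _ /=.
under eq_integral do rewrite muleC.
rewrite ge0_integralZl//; first by rewrite muleC.
exact: (measurableT_comp mu (measurable_pair2 _)).
Qed.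

End driftless_walk.

Section unrestricted_walk.
Context {R : realType} {d : nat}.
Local Notation vec := (d.-tuple R).
Variables (delta : nat -> R) (gam : probability vec R).
Hypothesis delta_gt0 : forall k, 0 < delta k.+1.
Hypothesis Hg : std_gaussian gam.

(** Without restrictions the independent increments add up to a single Gaussian, by the semigroup
    property. *)
Lemma rwalk_setT n (u : vec -> \bar R) :
  measurable_fun setT u -> (forall y, 0 <= u y)%E ->
  rwalk delta gam (fun=> setT) n u
  = (\int[gam]_z u (vscale (Num.sqrt (elapsed delta n)) z))%E.
Proof.
elim: n u => [|n IH] u mu u0 /=.
  rewrite elapsed0 sqrtr0; under eq_integral do rewrite vscale0.
  by rewrite integral_prob_cst.
have mnext : measurable_fun setT (fun p : vec * vec =>
    let y' := vadd p.1 (vscale (Num.sqrt (delta n.+1)) p.2) in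
    (u y' * (\1_(setT : set vec) y')%:E)%E).
  have my : measurable_fun setT (fun p : vec * vec =>
      vadd p.1 (vscale (Num.sqrt (delta n.+1)) p.2)).
    by apply: measurable_fun_vadd => //; exact: measurable_fun_vscale.
  apply: emeasurable_funM; first exact: measurableT_comp.
  by apply/measurable_EFinP; apply: measurableT_comp => //; exact: measurable_indic.
rewrite IH; last 2 first.
- apply: (@measurable_ge0_integral_snd _ _ _ _ _ gam (fun y z =>
    let y' := vadd y (vscale (Num.sqrt (delta n.+1)) z) in
    (u y' * (\1_(setT : set vec) y')%:E)%E)) => //.
  by move=> p z; rewrite mule_ge0.
- by move=> y; apply: integral_ge0 => z _; rewrite mule_ge0.
rewrite elapsedS -ge0_gauss_step//; last exact: elapsed_ge0.
apply: eq_integral => z _; apply: eq_integral => z' _ /=.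
by rewrite indicT mule1.
Qed.

End unrestricted_walk.

(** * The density of one path law with respect to the other *)

Section path_laws.
Context {R : realType} {d : nat} {dO : measure_display} {Omega : measurableType dO}.
Local Notation vec := (d.-tuple R).
Variables (P : probability Omega R) (X : Omega -> vec) (N Nt : nat -> Omega -> vec).
Variables (delta : nat -> R) (f : nat -> vec -> vec) (gam : probability vec R).
Hypotheses (mX : measurable_fun setT X) (mN : forall k, measurable_fun setT (N k)).
Hypothesis mNt : forall k, measurable_fun setT (Nt k).
Hypothesis delta_gt0 : forall k, 0 < delta k.+1.
Hypothesis mf : forall k, measurable_fun setT (f k.+1).
Hypothesis Hg : std_gaussian gam.
Hypothesis Hiid : iid_std_gaussian_indep_of P X N.
Hypothesis Hiidt : iid_std_gaussian P Nt.
Local Notation Y := (Yproc delta X N).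
Local Notation Z := (Zproc delta f Nt).
Local Notation ydrift := (fun (_ : nat) (x _ : vec) => x).
Local Notation zdrift := (fun (k : nat) (_ y : vec) => f k y).

Lemma YprocE n w : Y n w = gproc delta ydrift X N n w.
Proof. by elim: n => //= n ->. Qed.

Lemma ZprocE n w : Z n w = gproc delta zdrift (cst vzero) Nt n w.
Proof. by elim: n => //= n ->. Qed.

Lemma mydrift k : measurable_fun setT (fun p : vec * vec => ydrift k.+1 p.1 p.2).
Proof. exact: measurable_fst. Qed.

Lemma mzdrift k : measurable_fun setT (fun p : vec * vec => zdrift k.+1 p.1 p.2).
Proof. exact: (measurableT_comp (mf k) measurable_snd). Qed.

Lemma measurable_Y n : measurable_fun setT (Y n).
Proof.
rewrite (_ : Y n = gproc delta ydrift X N n).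
  by apply: measurable_gproc => //; exact: mydrift.
by apply: funext => w; exact: YprocE.
Qed.

Lemma measurable_Z n : measurable_fun setT (Z n).
Proof.
rewrite (_ : Z n = gproc delta zdrift (cst vzero) Nt n).
  by apply: measurable_gproc => //; exact: mzdrift.
by apply: funext => w; exact: ZprocE.
Qed.

(** Lets the sampling process be treated as a drifted walk with a trivial hidden variable. *)
Lemma iid_std_gaussian_indep_cst : iid_std_gaussian_indep_of P (cst (vzero : vec)) Nt.
Proof.
move=> m A B mA mB; case: (pselect (A vzero)) => A0.
  rewrite (_ : cst vzero @^-1` A = setT); last by apply/seteqP; split.
  by rewrite setTI Hiidt// probability_setT mul1e.
rewrite (_ : cst vzero @^-1` A = set0); last by apply/seteqP; split.
by rewrite set0I measure0 mul0e.
Qed.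

(** The mixture likelihood as an extended real; its finiteness is required only once a real-valued
    density is formed. *)
Definition evidence t y : \bar R := (\int[P]_w (lik (X w) y t)%:E)%E.

Lemma measurable_lik_X t : measurable_fun setT (fun p : Omega * vec => (lik (X p.1) p.2 t)%:E).
Proof.
apply/measurable_EFinP; apply: measurable_fun_lik => //.
exact: (measurableT_comp mX).
Qed.

Lemma measurable_evidence t : measurable_fun setT (evidence t).
Proof.
apply: (@measurable_ge0_integral_snd _ _ _ _ _ P (fun y w => (lik (X w) y t)%:E)).
  apply/measurable_EFinP; apply: measurable_fun_lik => //.
  exact: (measurableT_comp mX).
by move=> x y; rewrite lee_fin lik_ge0.
Qed.

Lemma evidence_ge0 t y : (0 <= evidence t y)%E.
Proof. by apply: integral_ge0 => w _; rewrite lee_fin lik_ge0. Qed.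

Section restricted.
Variable A : nat -> set vec.
Hypothesis mA : forall k, measurable (A k).

Lemma integral_comparison n (u : vec -> vec -> \bar R) :
  measurable_fun setT (fun p : vec * vec => u p.1 p.2) ->
  (forall x y, 0 <= u x y)%E ->
  (\int[P]_w (u (X w) (Y n w) * (\prod_(k < n) \1_(A k.+1) (Y k.+1 w))%:E)
   = rwalk delta gam A n (fun y => \int[P]_w (u (X w) y * (lik (X w) y (elapsed delta n))%:E)))%E.
Proof.
move=> mu u0.
pose q (k : nat) (x y y' : vec) : R := \1_(A k) y'.
have q0 k x y y' : 0 <= q k x y y' by rewrite /q.
have mq k : measurable_fun setT (fun p : vec * vec * vec => q k.+1 p.1.1 p.1.2 p.2).
  by apply: measurableT_comp => //; exact: measurable_indic.
transitivity (\int[P]_w (u (X w) (gproc delta ydrift X N n w) *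
   (weight delta ydrift q X N n w)%:E))%E.
  apply: eq_integral => w _; rewrite YprocE; congr (_ * _%:E)%E.
  by apply: eq_bigr => k _; rewrite YprocE.
rewrite (integral_walk delta_gt0 mydrift Hg)//.
rewrite -integral_rwalk//; last 2 first.
- apply: emeasurable_funM; last exact: measurable_lik_X.
  exact: (measurableT_comp mu (measurable_fun_pair (measurableT_comp mX measurable_fst) measurable_snd)).
- by move=> w y; rewrite mule_ge0// lee_fin lik_ge0.
apply: eq_integral => w _; rewrite walk_int_const_drift//.
exact: (measurableT_comp mu (measurable_pair1 _)).
Qed.

Lemma integral_sampling n (u : vec -> \bar R) :
  measurable_fun setT u -> (forall y, 0 <= u y)%E ->
  (\int[P]_w (u (Z n w) * (\prod_(k < n) (\1_(A k.+1) (Z k.+1 w) *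
      invlik delta f k.+1 (Z k w) (Z k.+1 w)))%:E)
   = rwalk delta gam A n u)%E.
Proof.
move=> mu u0.
pose q (k : nat) (x y y' : vec) : R := \1_(A k) y' * invlik delta f k y y'.
have q0 k x y y' : 0 <= q k x y y' by rewrite /q mulr_ge0// expR_ge0.
have mq k : measurable_fun setT (fun p : vec * vec * vec => q k.+1 p.1.1 p.1.2 p.2).
  have m2 : measurable_fun setT (fun p : vec * vec * vec => p.1.2) by exact: measurableT_comp.
  have mfk : measurable_fun setT (fun p : vec * vec * vec => f k.+1 p.1.2).
    exact: (measurableT_comp (mf k)).
  apply: measurable_funM; first by apply: measurableT_comp => //; exact: measurable_indic.
  apply: measurableT_comp => //; apply: measurable_funD.
    apply: measurableT_comp => //; apply: measurable_fun_dot => //.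
    exact: measurable_fun_vsub.
  by apply: measurable_funM => //; exact: measurable_fun_sqnorm.
transitivity (\int[P]_w (u (gproc delta zdrift (cst vzero) Nt n w) *
   (weight delta zdrift q (cst vzero) Nt n w)%:E))%E.
  apply: eq_integral => w _; rewrite ZprocE; congr (_ * _%:E)%E.
  by apply: eq_bigr => k _; rewrite !ZprocE.
rewrite (@integral_walk _ _ delta zdrift delta_gt0 mzdrift gam Hg q q0 mq _ _ P
  (cst vzero) Nt _ _ iid_std_gaussian_indep_cst n (fun=> u))//; last first.
  exact: measurableT_comp.
under eq_integral do rewrite walk_int_sampling//.
by rewrite integral_prob_cst.
Qed.

End restricted.

(** The unrestricted case of [integral_comparison]. It says that the joint law of [X] and [Y n] has
    density [lik] relative to an independent pair formed by [X] and a Gaussian of variance the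
    elapsed time. *)
Lemma ge0_expect_comparison n (u : vec -> vec -> \bar R) :
  measurable_fun setT (fun p : vec * vec => u p.1 p.2) ->
  (forall x y, 0 <= u x y)%E ->
  (\int[P]_w u (X w) (Y n w)
   = \int[P]_w \int[gam]_z (let y := vscale (Num.sqrt (elapsed delta n)) z in
        u (X w) y * (lik (X w) y (elapsed delta n))%:E))%E.
Proof.
move=> mu u0.
have := @integral_comparison (fun=> setT) (fun=> measurableT) n u mu u0.
under eq_integral.
  move=> w _; rewrite big1; last by move=> k _; rewrite indicT.
  rewrite mule1; over.
move=> ->.
have m1 : measurable_fun setT (fun p : Omega * vec =>
    (u (X p.1) p.2 * (lik (X p.1) p.2 (elapsed delta n))%:E)%E).
  apply: emeasurable_funM; last exact: measurable_lik_X.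
  exact: (measurableT_comp mu (measurable_fun_pair (measurableT_comp mX measurable_fst) measurable_snd)).
have p0 w y : (0 <= u (X w) y * (lik (X w) y (elapsed delta n))%:E)%E.
  by rewrite mule_ge0// lee_fin lik_ge0.
rewrite rwalk_setT//; last 2 first.
- apply: (@measurable_ge0_integral_snd _ _ _ _ _ P
    (fun y w => u (X w) y * (lik (X w) y (elapsed delta n))%:E)%E) => //.
  exact: (measurableT_comp m1 (measurable_fun_pair measurable_snd measurable_fst)).
- by move=> y; apply: integral_ge0 => w _.
rewrite -(@ge0_fubini _ _ _ _ _ P gam (fun w z =>
    let y := vscale (Num.sqrt (elapsed delta n)) z in
        u (X w) y * (lik (X w) y (elapsed delta n))%:E)%E)//.
apply: (measurableT_comp m1 (measurable_fun_pair _ _)) => //.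
exact: measurable_fun_vscale.
Qed.

Variable n : nat.
Local Notation ppath := (n.-tuple vec).

(** Restores the starting point: entry [i] of a path is the position at time [i.+1], and time [0] is
    the origin. *)
Definition pos (p : ppath) (k : nat) : vec :=
  if k is k'.+1 then nth vzero p k' else vzero.

Lemma measurable_pos k : measurable_fun setT (pos^~ k).
Proof.
case: k => [|k]; first exact: measurable_cst.
rewrite /pos; have [kn|nk] := ltnP k n.
  rewrite (_ : (fun p : ppath => _) = fun p : ppath => tnth p (Ordinal kn)).
    exact: measurable_tnth.
  by apply: funext => p; rewrite (tnth_nth vzero).
rewrite (_ : (fun p : ppath => _) = fun p : ppath => vzero); first exact: measurable_cst.
by apply: funext => p; rewrite nth_default// size_tuple.
Qed.

Lemma pos_path (V : nat -> Omega -> vec) w k : V 0%N w = vzero -> (k <= n)%N ->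
  pos (path_of V n w) k = V k w.
Proof.
case: k => [->//|k] _ kn /=.
by have := tnth_nth vzero (path_of V n w) (Ordinal kn); rewrite tnth_mktuple => /= <-.
Qed.

Lemma measurable_path_of (V : nat -> Omega -> vec) :
  (forall k, measurable_fun setT (V k)) -> measurable_fun setT (path_of V n).
Proof.
move=> mV; apply/measurable_fun_tnthP => i; rewrite /comp /=.
by under eq_fun do rewrite tnth_mktuple; exact: mV.
Qed.

(** Ratio of the two densities relative to the driftless walk: the mixture likelihood of the end
    point, divided by the product of the step likelihoods of the sampling process. *)
Definition path_density (p : ppath) : R :=
  fine (evidence (elapsed delta n) (pos p n)) *
  \prod_(k < n) invlik delta f k.+1 (pos p k) (pos p k.+1).

Hypothesis evidence_fin : forall y, evidence (elapsed delta n) y \is a fin_num.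

Lemma path_density_ge0 p : 0 <= path_density p.
Proof.
rewrite mulr_ge0//; first by rewrite fine_ge0// evidence_ge0.
by apply: prodr_ge0 => k _; exact: expR_ge0.
Qed.

Lemma measurable_path_density : measurable_fun setT path_density.
Proof.
apply: measurable_funM.
  apply: measurableT_comp => //.
  exact: (measurableT_comp (measurable_evidence _) (measurable_pos n)).
apply: measurable_prod => k _.
have mfk : measurable_fun setT (fun p => f k.+1 (pos p k)).
  exact: (measurableT_comp (mf k) (measurable_pos k)).
apply: measurableT_comp => //; apply: measurable_funD.
  apply: measurableT_comp => //; apply: measurable_fun_dot => //.
  by apply: measurable_fun_vsub; exact: measurable_pos.
by apply: measurable_funM => //; exact: measurable_fun_sqnorm.
Qed.

(** On a rectangle both sides equal the same integral over the restricted driftless walk: on the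
    left the mixture likelihood appears, on the right [invlik] removes the likelihood of the
    sampling process. *)
Lemma integral_path_change (psi : ppath -> \bar R) : measurable_fun setT psi ->
  (\int[P]_w psi (path_of Y n w)
   = \int[P]_w (psi (path_of Z n w) * (path_density (path_of Z n w))%:E))%E.
Proof.
move=> mpsi.
have mYp := measurable_path_of measurable_Y.
have mZp := measurable_path_of measurable_Z.
transitivity (\int[P]_w (psi (path_of Y n w) * (cst 1 w)%:E))%E.
  by apply: eq_integral => w _; rewrite mule1.
apply: (@eq_integral_weight_rect R _ _ _ _ _ _ _ P P) => //.
- by apply: measurableT_comp => //; exact: measurable_path_density.
- by move=> w; exact: path_density_ge0.
- by rewrite /= integral_prob_cst ltry.
move=> B mB.
(* Entry [i] of a path is the position at time [i.+1], hence the shift to [k.-1]; times beyond the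
   path are left unrestricted. *)
pose A k := if insub k.-1 is Some i then B i else setT.
have mA k : measurable (A k) by rewrite /A; case: insubP.
have AE (i : 'I_n) : A i.+1 = B i by rewrite /A /= valK.
have rectE (V : nat -> Omega -> vec) w :
    \1_(rect B) (path_of V n w) = \prod_(k < n) \1_(A k.+1) (V k.+1 w) :> R.
  rewrite indicE; case: (boolP (path_of V n w \in rect B)) => [|wB] /=.
    rewrite inE => wB; rewrite big1// => i _; rewrite AE indicE mem_set//.
    by have := wB i; rewrite tnth_mktuple.
  have [i Bi] : exists i, ~ B i (tnth (path_of V n w) i).
    by apply/existsNP => H; move: wB; rewrite notin_setE; exact.
  rewrite (bigD1 i)//= AE indicE memNset//= ?mul0r//.
  by move: Bi; rewrite tnth_mktuple.
transitivity (rwalk delta gam A n (evidence (elapsed delta n))).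
  have -> : evidence (elapsed delta n) =
      (fun y => \int[P]_w (1 * (lik (X w) y (elapsed delta n))%:E))%E.
    by apply: funext => y; apply: eq_integral => w _; rewrite mul1e.
  rewrite -(@integral_comparison A mA n (fun _ _ => 1%E) (measurable_cst _) (fun _ _ => lee01)).
  by apply: eq_integral => w _; rewrite rectE mulr1 mul1e.
rewrite -(integral_sampling mA)//; last 2 first.
- exact: measurable_evidence.
- exact: evidence_ge0.
apply: eq_integral => w _; rewrite rectE /path_density.
rewrite pos_path// -[evidence _ _]fineK// -EFinM big_split/= mulrCA.
congr (_ * (_ * _))%:E.
apply: eq_bigr => k _.
rewrite -[nth vzero _ k]/(pos (path_of Z n w) k.+1) !pos_path//.
exact: ltnW.
Qed.

Lemma is_density_path :
  is_density (law P (path_of Y n)) (law P (path_of Z n)) path_density.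
Proof.
split; first exact: measurable_path_density.
split; first exact: path_density_ge0.
have mYp := measurable_path_of measurable_Y.
have mZp := measurable_path_of measurable_Z.
move=> A mA.
rewrite /law (@ge0_integral_pushforward _ _ _ _ _ _ mZp P)//; last 2 first.
- by apply: measurable_funTS; apply/measurable_EFinP; exact: measurable_path_density.
- by move=> p _; rewrite lee_fin path_density_ge0.
transitivity (\int[P]_w (\1_A (path_of Y n w))%:E)%E.
  rewrite (_ : (fun w => _) = fun w => (\1_(path_of Y n @^-1` A) w)%:E)//.
  by rewrite integral_indic ?setIT//; rewrite -[X in measurable X]setTI; exact: mYp.
rewrite (@integral_path_change (EFin \o \1_A)); last first.
  by apply/measurable_EFinP; exact: measurable_indic.
rewrite [RHS]integral_mkcond; apply: eq_integral => w _.
by rewrite epatch_indic /= muleC.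
Qed.

End path_laws.

(** [KL] selects an unspecified density. Two densities agree [nu]-almost everywhere, hence
    [mu]-almost everywhere by absolute continuity, so the selection does not affect the integral. *)
Lemma KL_density {R : realType} (dT : measure_display) (T : measurableType dT)
    (mu nu : probability T R) (g : T -> R) :
  is_density mu nu g -> KL mu nu = (\int[mu]_x (ln (g x))%:E)%E.
Proof.
move=> Hgd; rewrite /KL; case: pselect => [H|]; last by case; exists g.
case: cid => g' /= [mg' [g'0 Hg']].
move: Hgd => [mg [g0 Hgd]].
have intg : nu.-integrable setT (EFin \o g).
  apply/integrableP; split; first exact/measurable_EFinP.
  under eq_integral do rewrite /= ger0_norm//.
  by rewrite -Hgd// probability_setT ltry.
have gg' : ae_eq nu setT (EFin \o g) (EFin \o g').
  apply: integral_ae_eq => //; first exact/measurable_EFinP.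
  by move=> E _ mE; rewrite -Hgd// -Hg'.
have numu : mu `<< nu.
  apply/null_content_dominatesP => A mA nuA; rewrite Hgd//.
  by apply: null_set_integral => //; apply/measurable_funTS/measurable_EFinP.
apply: ae_eq_integral => //.
- by apply/measurable_EFinP; apply: measurableT_comp => //; exact: measurable_ln.
- by apply/measurable_EFinP; apply: measurableT_comp => //; exact: measurable_ln.
have := null_dominates_ae_eq measurableT numu gg'.
by apply: filterS => x H1 _; have /= := H1 I; case=> ->.
Qed.

(** * Integrability tools and Gaussian moments *)

Section bounded_integrals.
Context {R : realType} {dT : measure_display} {T : measurableType dT}.
Variable P : probability T R.

Lemma integrable_bounded (f : T -> R) (C : R) : measurable_fun setT f ->
  (forall x, `|f x| <= C) -> P.-integrable setT (EFin \o f).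
Proof.
move=> mf fC.
apply: (le_integrable measurableT _ _ (finite_measure_integrable_cst P C measurableT)).
- exact/measurable_EFinP.
- by move=> x _; rewrite /= lee_fin (le_trans (fC x))// ler_norm.
Qed.

Lemma EFin_Rintegral (f : T -> R) : P.-integrable setT (EFin \o f) ->
  (\int[P]_x (f x)%:E)%E = (\int[P]_x f x)%:E.
Proof. by move=> /(integrable_fin_num measurableT) /fineK. Qed.

Lemma Rintegral_prob_cst (c : R) : \int[P]_x c = c.
Proof. by rewrite /Rintegral integral_prob_cst. Qed.

Lemma integrable_dominated (f g : T -> R) : measurable_fun setT f ->
  (forall x, `|f x| <= g x) -> P.-integrable setT (EFin \o g) ->
  P.-integrable setT (EFin \o f).
Proof.
move=> mf fg ig; apply: (le_integrable measurableT _ _ ig).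
  exact/measurable_EFinP.
by move=> x _; rewrite /= lee_fin (le_trans (fg x))// ler_norm.
Qed.

Lemma integrableDR (f g : T -> R) : P.-integrable setT (EFin \o f) ->
  P.-integrable setT (EFin \o g) -> P.-integrable setT (EFin \o (fun x => f x + g x)).
Proof. by move=> hf hg; exact: (integrableD measurableT hf hg). Qed.

Lemma integrableZR (a : R) (f : T -> R) : P.-integrable setT (EFin \o f) ->
  P.-integrable setT (EFin \o (fun x => a * f x)).
Proof. by move=> hf; exact: (integrableZl measurableT a hf). Qed.

Lemma integrable_sumR (I : Type) (s : seq I) (F : I -> T -> R) :
  (forall i, P.-integrable setT (EFin \o F i)) ->
  P.-integrable setT (EFin \o (fun x => \sum_(i <- s) F i x)).
Proof.
move=> hF; elim: s => [|i s IH].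
  rewrite (_ : _ \o _ = EFin \o (fun=> 0)); last by apply: funext => x /=; rewrite big_nil.
  by apply: (@integrable_bounded _ 0) => // x; rewrite normr0.
rewrite (_ : _ \o _ = EFin \o (fun x => F i x + \sum_(i <- s) F i x)); last first.
  by apply: funext => x /=; rewrite big_cons.
exact: integrableDR.
Qed.

Lemma Rintegral_sumR (I : Type) (s : seq I) (F : I -> T -> R) :
  (forall i, P.-integrable setT (EFin \o F i)) ->
  \int[P]_x (\sum_(i <- s) F i x) = \sum_(i <- s) \int[P]_x F i x.
Proof.
move=> hF; elim: s => [|i s IH].
  rewrite big_nil -[RHS](Rintegral_prob_cst 0); apply: eq_Rintegral => x _.
  by rewrite big_nil.
rewrite big_cons -IH -RintegralD//; last exact: integrable_sumR.
by apply: eq_Rintegral => x _; rewrite big_cons.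
Qed.

End bounded_integrals.

(** From [exp (- v) >= 1 - v] one gets [exp v <= 1 / (1 - v)], and the product of [1 + v + 2 v^2]
    with [1 - v] is [1 + v^2 (1 - 2 v)], which is at least [1]. *)
Lemma expR_le_quadratic {R : realType} (v : R) : v <= 1 / 2 ->
  expR v <= 1 + v + 2 * v ^+ 2.
Proof.
move=> v2.
have v1 : 0 < 1 - v by lra.
have h1 : 1 - v <= expR (- v) by have := expR_ge1Dx (- v).
have h2 : expR v <= (1 - v)^-1.
  by rewrite -[expR v]invrK -expRN lef_pV2 ?posrE ?expR_gt0.
apply: (le_trans h2); rewrite -[leLHS]mul1r ler_pdivrMr//.
have : 0 <= v ^+ 2 * (1 - 2 * v) by rewrite mulr_ge0 ?sqr_ge0//; lra.
rewrite (_ : (1 + _ + _) * _ = 1 + v ^+ 2 * (1 - 2 * v)); last by ring.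
by lra.
Qed.

Section gaussian_moments.
Context {R : realType} {d : nat}.
Local Notation vec := (d.-tuple R).
Variable gam : probability vec R.
Hypothesis Hg : std_gaussian gam.

(** The Cameron--Martin formula for the constant function [1]. All Gaussian moments below are
    dominated by this exponential moment. *)
Lemma integral_expR_dot (v : vec) :
  (\int[gam]_z (expR (dot v z))%:E = (expR (sqnorm v / 2))%:E)%E.
Proof.
have H := integral_cameron_martin Hg v (measurable_cst 1%E).
rewrite /= integral_prob_cst in H.
rewrite (_ : (fun z => _) = (fun z => (expR (sqnorm v / 2))%:E *
    (1 * (expR (dot v z - sqnorm v / 2))%:E))%E); last first.
  by apply: funext => z; rewrite mul1e -EFinM -expRD addrCA subrr addr0.
rewrite ge0_integralZl//.
- by rewrite -H mule1.
- apply: emeasurable_funM => //; apply/measurable_EFinP; apply: measurableT_comp => //.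
  apply: measurable_funB => //; exact: measurable_fun_dot.
Qed.

Definition unitv (i : 'I_d) (c : R) : vec := [tuple if j == i then c else 0 | j < d].

Lemma dot_unitv i c z : dot (unitv i c) z = c * tnth z i.
Proof.
rewrite /dot (bigD1 i)//= tnth_mktuple eqxx big1 ?addr0// => j /negPf ji.
by rewrite tnth_mktuple ji mul0r.
Qed.

Lemma sqnorm_unitv i c : sqnorm (unitv i c) = c ^+ 2.
Proof. by rewrite sqnormE dot_unitv tnth_mktuple eqxx expr2. Qed.

Lemma integrable_expR_tnth i c : gam.-integrable setT (EFin \o (fun z : vec => expR (c * tnth z i))).
Proof.
apply/integrableP; split.
  apply/measurable_EFinP; apply: measurableT_comp => //.
  by apply: measurable_funM => //; exact: measurable_tnth.
rewrite (_ : (fun x => _) = (fun z => (expR (dot (unitv i c) z))%:E)).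
  by rewrite integral_expR_dot ltry.
by apply: funext => z /=; rewrite ger0_norm ?expR_ge0// dot_unitv.
Qed.

Lemma integrable_tnth_sqr i : gam.-integrable setT (EFin \o (fun z : vec => tnth z i ^+ 2)).
Proof.
apply: (@integrable_dominated _ _ _ _ _
   (fun z : vec => 2 * (expR (1 * tnth z i) + expR (-1 * tnth z i)))).
- by apply: measurable_funX; exact: measurable_tnth.
- move=> z; rewrite ger0_norm ?sqr_ge0// mul1r mulN1r; set x := tnth z i.
  have pos (y : R) : 0 <= y -> y ^+ 2 <= 2 * expR y.
    move=> y0; have := expR_ge1Dxn 1 y0; rewrite (_ : 2`! = 2%N)//.
    by have := expR_gt0 y; lra.
  have := expR_gt0 x; have := expR_gt0 (- x).
  have [x0|x0] := leP 0 x; first by have := pos x x0; lra.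
  by have := pos (- x); rewrite sqrrN => /(_ _); have := x0; lra.
- by apply: integrableZR; apply: integrableDR; exact: integrable_expR_tnth.
Qed.

Lemma integrable_tnth i : gam.-integrable setT (EFin \o (fun z : vec => tnth z i)).
Proof.
apply: (@integrable_dominated _ _ _ _ _ (fun z : vec => 1 + tnth z i ^+ 2)).
- exact: measurable_tnth.
- by move=> z; rewrite ler_norml; have := sqr_ge0 (tnth z i - 1);
    have := sqr_ge0 (tnth z i + 1); rewrite !sqrrD !expr1n; lra.
- apply: integrableDR; last exact: integrable_tnth_sqr.
  by apply: (@integrable_bounded _ _ _ _ _ 1) => // x; rewrite normr1.
Qed.

(* The Gaussian moment generating function is [exp (c^2/2)], so
   [1 + c * mean <= exp (c^2/2)] for every small [c] of either sign. *)
Lemma gauss_mean0 i : \int[gam]_z tnth z i = 0.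
Proof.
set mn := \int[gam]_z tnth z i.
have bound (c : R) : 1 + c * mn <= expR (c ^+ 2 / 2).
  have -> : 1 + c * mn = \int[gam]_z (1 + c * tnth z i).
    rewrite RintegralD//.
    - by rewrite Rintegral_prob_cst RintegralZl//; exact: integrable_tnth.
    - by apply: (@integrable_bounded _ _ _ _ _ 1) => // x; rewrite normr1.
    - by apply: integrableZR; exact: integrable_tnth.
  have -> : expR (c ^+ 2 / 2) = \int[gam]_z expR (c * tnth z i).
    rewrite -(sqnorm_unitv i) /Rintegral.
    by under eq_integral do rewrite -dot_unitv; rewrite integral_expR_dot.
  apply: le_Rintegral => //.
  - apply: integrableDR; last by apply: integrableZR; exact: integrable_tnth.
    by apply: (@integrable_bounded _ _ _ _ _ 1) => // x; rewrite normr1.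
  - exact: integrable_expR_tnth.
  - by move=> z _; exact: expR_ge1Dx.
have quad (c : R) : 0 <= c <= 1 / 2 -> expR (c ^+ 2 / 2) <= 1 + c ^+ 2.
  move=> /andP[c0 c1].
  have c2 : c ^+ 2 <= 1 / 4.
    by rewrite (le_trans (lerXn2r 2 _ _ c1)) ?nnegrE//; lra.
  have c20 := sqr_ge0 c.
  apply: (le_trans (expR_le_quadratic _)); first lra.
  have : (c ^+ 2) ^+ 2 <= c ^+ 2 * (1 / 4) by rewrite expr2 ler_wpM2l.
  by rewrite expr_div_n; lra.
have small (e : R) : 0 < e <= 1 / 2 -> `|mn| <= e.
  move=> /andP[e0 e1].
  have := bound e; have := bound (- e); rewrite sqrrN.
  have := quad e; rewrite (ltW e0) e1 => /(_ isT) qe b1 b2.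
  rewrite ler_norml; apply/andP; split.
    rewrite -(ler_pM2l e0) mulrN; move: b1 b2 qe; rewrite expr2; lra.
  rewrite -(ler_pM2l e0); move: b1 b2 qe; rewrite expr2; lra.
apply/eqP; rewrite -normr_le0; apply/ler_addgt0Pr => e e0; rewrite add0r.
have [e1|e1] := leP e (1 / 2); first by apply: small; rewrite e0.
apply: (le_trans (small (1/2) _)); first by lra.
exact: ltW.
Qed.

End gaussian_moments.

Section vector_algebra_bis.
Context {R : realType} {d : nat}.
Local Notation vec := (d.-tuple R).
Implicit Types u v x : vec.

Lemma dotBl u v x : dot (vsub v x) u = dot v u - dot x u.
Proof.
by rewrite /dot -sumrB; apply: eq_bigr => i _; rewrite tnth_mktuple mulrBl.
Qed.

Lemma dotBr u v x : dot u (vsub v x) = dot u v - dot u x.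
Proof. by rewrite dotC dotBl !(dotC u). Qed.

Lemma dot_le_l1 (M : R) u v : (forall i, `|tnth u i| <= M) ->
  `|dot u v| <= M * \sum_(i < d) `|tnth v i|.
Proof.
move=> uM; apply: (le_trans (ler_norm_sum _ _ _)); rewrite mulr_sumr.
by apply: ler_sum => i _; rewrite normrM ler_wpM2r.
Qed.

Lemma sqnorm_le_sup (M : R) u : (forall i, `|tnth u i| <= M) ->
  sqnorm u <= d%:R * M ^+ 2.
Proof.
move=> uM; rewrite mulr_natl -[d in leRHS]card_ord -sumr_const.
by apply: ler_sum => i _; rewrite -real_normK ?num_real// lerXn2r// ?nnegrE// (le_trans _ (uM i)).
Qed.

Lemma lik_le_l1 (M : R) x y t : 0 <= t -> (forall i, `|tnth x i| <= M) ->
  lik x y t <= expR (M * \sum_(i < d) `|tnth y i|).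
Proof.
move=> t0 xM; rewrite ler_expR.
have := dot_le_l1 y xM; rewrite ler_norml => /andP[_ h].
have : 0 <= t / 2 * sqnorm x by rewrite mulr_ge0 ?sqnorm_ge0// divr_ge0.
lra.
Qed.

Lemma lik_ge_l1 (M : R) x y t : 0 <= t -> (forall i, `|tnth x i| <= M) ->
  expR (- (M * \sum_(i < d) `|tnth y i|) - t / 2 * (d%:R * M ^+ 2)) <= lik x y t.
Proof.
move=> t0 xM; rewrite ler_expR.
have := dot_le_l1 y xM; rewrite ler_norml => /andP[h _].
have : t / 2 * sqnorm x <= t / 2 * (d%:R * M ^+ 2).
  by rewrite ler_wpM2l ?divr_ge0// sqnorm_le_sup.
lra.
Qed.

(** At a position on the scale [sqrt e], the likelihood over a time [e] is the Cameron--Martin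
    factor of the shift [sqrt e * x]. *)
Lemma lik_sqrt x z e : 0 <= e -> lik x (vscale (Num.sqrt e) z) e =
  expR (dot (vscale (Num.sqrt e) x) z - sqnorm (vscale (Num.sqrt e) x) / 2).
Proof.
move=> e0; rewrite /lik dotZr dotZl; congr (expR (_ - _)).
by rewrite !sqnormE dotZr dotZl mulrA -expr2 sqr_sqrtr//; ring.
Qed.

End vector_algebra_bis.

Lemma ln_le_subr1 {R : realType} (r : R) : 0 < r -> ln r <= r - 1.
Proof.
move=> r0; have h : -1 < r - 1 by lra.
by have := le_ln1Dx h; rewrite addrC subrK.
Qed.

Lemma xlnx_ge {R : realType} (r : R) : 0 < r -> r - 1 <= r * ln r.
Proof.
move=> r0; have := @ln_le_subr1 _ r^-1; rewrite invr_gt0 => /(_ r0).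
rewrite lnV ?posrE// => h.
have : r * (1 - r^-1) <= r * ln r by rewrite ler_pM2l//; lra.
by rewrite mulrBr mulr1 divff// gt_eqF.
Qed.

(** * Mixtures of Gaussian shifts over one time increment *)

Section mixtures.
Context {R : realType} {d : nat} {dO : measure_display} {Omega : measurableType dO}.
Local Notation vec := (d.-tuple R).
Variables (P : probability Omega R) (X : Omega -> vec) (M : R).
Hypotheses (mX : measurable_fun setT X) (XM : forall w i, `|tnth (X w) i| <= M).
Variables (gam : probability vec R) (e : R).
Hypotheses (Hg : std_gaussian gam) (e0 : 0 < e).
Local Notation s := (Num.sqrt e).

(** If [rho] is the likelihood of the hidden variable at the current time and position, this is the
    mixture likelihood after a further time [e] and displacement [sqrt e * z]. *)
Definition mix (rho : Omega -> R) (z : vec) : R :=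
  \int[P]_w (rho w * lik (X w) (vscale s z) e).

Lemma integrable_weight_lik (rho : Omega -> R) (C : R) y t : 0 <= t ->
  measurable_fun setT rho -> (forall w, `|rho w| <= C) ->
  P.-integrable setT (EFin \o (fun w => rho w * lik (X w) y t)).
Proof.
move=> t0 mrho rhoC.
apply: (@integrable_bounded _ _ _ _ _ (C * expR (M * \sum_(i < d) `|tnth y i|))).
  by apply: measurable_funM => //; exact: measurable_fun_lik.
move=> w; rewrite normrM ler_pM// ger0_norm ?lik_ge0//; exact: lik_le_l1.
Qed.

Section nonnegative_weight.
Variables (rho : Omega -> R) (C : R).
Hypotheses (mrho : measurable_fun setT rho) (rho0 : forall w, 0 <= rho w)
  (rhoC : forall w, rho w <= C).

Let nrhoC w : `|rho w| <= C.
Proof. by rewrite ger0_norm. Qed.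

Let sx w := vscale s (X w).

Let msx : measurable_fun setT sx.
Proof. exact: measurable_fun_vscale. Qed.

Lemma mixE z : (mix rho z)%:E = (\int[P]_w (rho w * lik (X w) (vscale s z) e)%:E)%E.
Proof. by rewrite EFin_Rintegral//; apply: integrable_weight_lik nrhoC => //; exact: ltW. Qed.

Lemma mix_ge0 z : 0 <= mix rho z.
Proof. by apply: Rintegral_ge0 => w _; rewrite mulr_ge0// lik_ge0. Qed.

Lemma measurable_weight_lik :
  measurable_fun setT (fun p : vec * Omega => rho p.2 * lik (X p.2) (vscale s p.1) e).
Proof.
apply: measurable_funM; first exact: measurableT_comp.
apply: measurable_fun_lik; first exact: measurableT_comp.
exact: measurable_fun_vscale.
Qed.

Lemma measurable_mix : measurable_fun setT (mix rho).
Proof.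
apply: measurableT_comp => //.
apply: (@measurable_ge0_integral_snd _ _ _ _ _ P
  (fun z w => (rho w * lik (X w) (vscale s z) e)%:E)).
  by apply/measurable_EFinP; exact: measurable_weight_lik.
by move=> z w; rewrite lee_fin mulr_ge0// lik_ge0.
Qed.

(** Weighting [z] by the mixture amounts to drawing [X] with weight [rho] and shifting a standard
    Gaussian by [sqrt e * X]: the Cameron--Martin formula under the integral over [P]. *)
Lemma ge0_integral_mix (F : vec -> R) : measurable_fun setT F -> (forall z, 0 <= F z) ->
  (\int[gam]_z (F z * mix rho z)%:E
   = \int[P]_w \int[gam]_z (F (vadd z (vscale s (X w))) * rho w)%:E)%E.
Proof.
move=> mF F0.
transitivity (\int[gam]_z \int[P]_w (F z * (rho w * lik (X w) (vscale s z) e))%:E)%E.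
  apply: eq_integral => z _; rewrite EFinM mixE -ge0_integralZl ?lee_fin//.
  - apply/measurable_EFinP.
    exact: (measurableT_comp measurable_weight_lik (measurable_pair1 z)).
  - by move=> w _; rewrite lee_fin mulr_ge0// lik_ge0.
rewrite (@ge0_fubini _ _ _ _ _ gam P (fun z w =>
   (F z * (rho w * lik (X w) (vscale s z) e))%:E)); last 2 first.
- apply/measurable_EFinP; apply: measurable_funM; first exact: measurableT_comp.
  exact: measurable_weight_lik.
- by move=> z w; rewrite lee_fin !mulr_ge0// lik_ge0.
apply: eq_integral => w _.
rewrite (integral_cameron_martin Hg (vscale s (X w)) (psi := fun z => (F z * rho w)%:E)); last first.
  by apply/measurable_EFinP; exact: measurable_funM.
by apply: eq_integral => z _; rewrite lik_sqrt ?(ltW e0)// -EFinM mulrA.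
Qed.

Lemma integral_mix_transfer (psi : vec -> \bar R) : measurable_fun setT psi ->
  (\int[gam]_z (psi z * (mix rho z)%:E)
   = \int[(P \x gam)%E]_p (psi (vadd p.2 (sx p.1)) * (rho p.1)%:E))%E.
Proof.
have mV : measurable_fun setT (fun p : Omega * vec => vadd p.2 (sx p.1)).
  by apply: measurable_fun_vadd => //; exact: measurableT_comp.
have mr : measurable_fun setT (fun p : Omega * vec => rho p.1) by exact: measurableT_comp.
apply: (@eq_integral_weight _ _ _ _ _ _ _ gam (P \x gam)%E id
  (fun p => vadd p.2 (sx p.1)) (mix rho) (fun p => rho p.1)) => //.
- exact: measurable_mix.
- exact: mix_ge0.
move=> B mB; rewrite ge0_integral_mix//.
rewrite fubini_tonelli1//.
- apply/measurable_EFinP; apply: measurable_funM => //.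
  by apply: measurableT_comp => //; exact: measurable_indic.
- by move=> p; rewrite lee_fin mulr_ge0.
Qed.

Lemma integral_mix : (\int[gam]_z (mix rho z)%:E = (\int[P]_w rho w)%:E)%E.
Proof.
rewrite -EFin_Rintegral; last exact: (integrable_bounded _ mrho nrhoC).
under eq_integral do rewrite -[mix rho _]mul1r.
rewrite (@ge0_integral_mix (cst 1))//.
by apply: eq_integral => w _; rewrite /= integral_prob_cst mul1r.
Qed.

Lemma integrable_mix : gam.-integrable setT (EFin \o mix rho).
Proof.
apply/integrableP; split; first by apply/measurable_EFinP; exact: measurable_mix.
under eq_integral do rewrite /= ger0_norm ?mix_ge0//.
by rewrite integral_mix ltry.
Qed.

Lemma Rintegral_mix : \int[gam]_z mix rho z = \int[P]_w rho w.
Proof. by rewrite {1}/Rintegral integral_mix. Qed.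

Let M0 (w : Omega) (i : 'I_d) : 0 <= M.
Proof. exact: le_trans (XM w i). Qed.

Let abs_shift_le i w :
  (\int[gam]_z (`|tnth (vadd z (sx w)) i| * rho w)%:E
   <= (C * (\int[gam]_z `|tnth z i| + s * M))%:E)%E.
Proof.
have in1 : gam.-integrable setT (EFin \o (fun z : vec => `|tnth z i|)).
  exact: (integrable_abse (integrable_tnth Hg i)).
have C0 : 0 <= C by exact: le_trans (rho0 w) (rhoC w).
have -> : C * (\int[gam]_z `|tnth z i| + s * M) = \int[gam]_z (C * (`|tnth z i| + s * M)).
  rewrite RintegralZl//; last first.
    apply: integrableDR => //; apply: (@integrable_bounded _ _ _ _ _ (s * M)) => // z.
    by rewrite ger0_norm// mulr_ge0//; exact: (M0 w i).
  rewrite RintegralD// ?Rintegral_prob_cst//.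
  apply: (@integrable_bounded _ _ _ _ _ (s * M)) => // z.
  by rewrite ger0_norm// mulr_ge0//; exact: (M0 w i).
rewrite -EFin_Rintegral; last first.
  apply: integrableZR; apply: integrableDR => //.
  apply: (@integrable_bounded _ _ _ _ _ (s * M)) => // z.
  by rewrite ger0_norm// mulr_ge0//; exact: (M0 w i).
have mt : measurable_fun setT (fun z : vec => tnth z i) by exact: measurable_tnth.
apply: ge0_le_integral => //.
- by move=> z _; rewrite lee_fin mulr_ge0.
- apply/measurable_EFinP; apply: measurable_funM => //; apply: measurableT_comp => //.
  by apply: measurable_fun_tnth; exact: measurable_fun_vadd.
- apply/measurable_EFinP; apply: measurable_funM => //; apply: measurable_funD => //.
  exact: measurableT_comp.
- move=> z _; rewrite lee_fin mulrC ler_pM//.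
  rewrite !tnth_mktuple (le_trans (ler_normD _ _))// lerD2l normrM ger0_norm// ler_wpM2l//.
Qed.

Lemma integrable_tnth_mix i : gam.-integrable setT (EFin \o (fun z => tnth z i * mix rho z)).
Proof.
apply/integrableP; split.
  apply/measurable_EFinP; apply: measurable_funM; last exact: measurable_mix.
  exact: measurable_tnth.
under eq_integral do rewrite /= normrM [X in _ * X]ger0_norm ?mix_ge0//.
rewrite (@ge0_integral_mix (fun z => `|tnth z i|))//; last first.
  by apply: measurableT_comp => //; exact: measurable_tnth.
apply: (@le_lt_trans _ _ (\int[P]_w (C * (\int[gam]_z `|tnth z i| + s * M))%:E)%E).
  apply: ge0_le_integral => //.
  - by move=> w _; apply: integral_ge0 => z _; rewrite lee_fin mulr_ge0.
  - apply: (@measurable_ge0_integral_snd _ _ _ _ _ gam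
      (fun w z => (`|tnth (vadd z (vscale s (X w))) i| * rho w)%:E)).
      apply/measurable_EFinP; apply: measurable_funM; last exact: measurableT_comp.
      apply: measurableT_comp => //; apply: measurable_fun_tnth.
      apply: measurable_fun_vadd => //; apply: measurable_fun_vscale.
      exact: measurableT_comp.
    by move=> w z; rewrite lee_fin mulr_ge0.
  - by move=> w _; exact: abs_shift_le.
by rewrite integral_prob_cst ltry.
Qed.

(** Under the mixture, [z] is a centred Gaussian plus [sqrt e * X], and only the second summand
    contributes to the mean. *)
Lemma Rintegral_tnth_mix i :
  \int[gam]_z (tnth z i * mix rho z) = s * \int[P]_w (rho w * tnth (X w) i).
Proof.
have mt : measurable_fun setT (fun z : vec => tnth z i) by exact: measurable_tnth.
have mtX : measurable_fun setT (fun w => tnth (X w) i) by exact: measurable_fun_tnth.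
apply: EFin_inj; rewrite -EFin_Rintegral; last exact: integrable_tnth_mix.
under eq_integral do rewrite EFinM.
rewrite (@integral_mix_transfer (fun z => (tnth z i)%:E)); last exact/measurable_EFinP.
have mF : measurable_fun setT (fun p : Omega * vec =>
    ((tnth (vadd p.2 (sx p.1)) i)%:E * (rho p.1)%:E)%E).
  apply: emeasurable_funM; apply/measurable_EFinP; last exact: measurableT_comp.
  apply: measurable_fun_tnth; apply: measurable_fun_vadd => //.
  exact: measurableT_comp.
rewrite -integral12_prod_meas1; last first.
  apply/integrable12ltyP => //.
  apply: (@le_lt_trans _ _ (\int[P]_w (C * (\int[gam]_z `|tnth z i| + s * M))%:E)%E);
    last by rewrite integral_prob_cst ltry.
  apply: ge0_le_integral => //.
  - by move=> w _; apply: integral_ge0 => z _.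
  - apply: (@measurable_ge0_integral_snd _ _ _ _ _ gam
      (fun w z => `|(tnth (vadd z (sx w)) i)%:E * (rho w)%:E|%E)) => //.
    exact: measurableT_comp.
  - move=> w _; apply: le_trans (abs_shift_le i w).
    rewrite le_eqVlt; apply/orP; left; apply/eqP.
    by apply: eq_integral => z _ /=; rewrite normrM [X in _ * X]ger0_norm.
rewrite -RintegralZl//; last first.
  apply: (@integrable_bounded _ _ _ _ _ (C * M)); first exact: measurable_funM.
  by move=> w; rewrite normrM ler_pM.
rewrite -EFin_Rintegral; last first.
  apply: integrableZR; apply: (@integrable_bounded _ _ _ _ _ (C * M)); first exact: measurable_funM.
  by move=> w; rewrite normrM ler_pM.
apply: eq_integral => w _; rewrite /fubini_F /=.
transitivity (\int[gam]_z (rho w * tnth z i + rho w * (s * tnth (X w) i))%:E)%E.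
  by apply: eq_integral => z _; rewrite -EFinM !tnth_mktuple; congr EFin; ring.
have i1 : gam.-integrable setT (EFin \o (fun z : vec => rho w * tnth z i)).
  by apply: integrableZR; exact: integrable_tnth.
have i2 : gam.-integrable setT (EFin \o (fun z : vec => rho w * (s * tnth (X w) i))).
  exact: (@integrable_bounded _ _ _ _ _ `|rho w * (s * tnth (X w) i)|).
rewrite EFin_Rintegral; last exact: integrableDR.
rewrite RintegralD// RintegralZl//; last exact: integrable_tnth.
by rewrite gauss_mean0// mulr0 add0r Rintegral_prob_cst mulrCA.
Qed.

End nonnegative_weight.
End mixtures.

Lemma measurable_funV_gt0 {R : realType} (dT : measure_display)
    (T : measurableType dT) (f : T -> R) :
  measurable_fun setT f -> (forall x, 0 < f x) ->
  measurable_fun setT (fun x => (f x)^-1).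
Proof.
move=> mf f0; rewrite (_ : (fun x => _) = (fun x => expR (- ln (f x)))).
  do 2 apply: measurableT_comp => //; exact: measurableT_comp.
by apply: funext => x; rewrite expRN lnK ?posrE.
Qed.

(** * Entropy and Fisher information over one time increment *)

Section entropy_step.
Context {R : realType} {d : nat} {dO : measure_display} {Omega : measurableType dO}.
Local Notation vec := (d.-tuple R).
Variables (P : probability Omega R) (X : Omega -> vec) (M : R).
Hypotheses (mX : measurable_fun setT X) (XM : forall w i, `|tnth (X w) i| <= M).
Variables (gam : probability vec R) (e : R).
Hypotheses (Hg : std_gaussian gam) (e0 : 0 < e).
Local Notation s := (Num.sqrt e).
Variables (rho : Omega -> R) (C : R).
Hypotheses (mrho : measurable_fun setT rho) (rho0 : forall w, 0 <= rho w)
  (rhoC : forall w, rho w <= C).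
Let g := \int[P]_w rho w.
Hypothesis g0 : 0 < g.
Let m (i : 'I_d) := \int[P]_w (rho w * tnth (X w) i).
Let h : vec := [tuple m i / g | i < d].
(** A uniform bound on [<X - h, X' - h>]: the coordinates of [X] and of its weighted mean [h] are at
    most [M] in absolute value, so those of [X - h] are at most [2 * M]. *)
Let K := d%:R * (2 * M) ^+ 2.
Local Notation mixr := (mix P X e rho).

Let nrhoC w : `|rho w| <= C.
Proof. by rewrite ger0_norm. Qed.

Let irho : P.-integrable setT (EFin \o rho).
Proof. exact: (integrable_bounded _ mrho nrhoC). Qed.

Let irhoX i : P.-integrable setT (EFin \o (fun w => rho w * tnth (X w) i)).
Proof.
apply: (@integrable_bounded _ _ _ _ _ (C * M)).
  by apply: measurable_funM => //; exact: measurable_fun_tnth.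
by move=> w; rewrite normrM ler_pM.
Qed.

Let hE i : tnth h i = m i / g.
Proof. by rewrite tnth_mktuple. Qed.

Let gh i : g * tnth h i = m i.
Proof. by rewrite hE mulrC divfK// gt_eqF. Qed.

Let h_le i : `|tnth h i| <= M.
Proof.
rewrite hE normrM normfV (gtr0_norm g0) ler_pdivrMr//.
apply: (le_trans (le_normr_Rintegral measurableT (irhoX i))).
rewrite /g -RintegralZl//; apply: le_Rintegral => //.
- exact: (integrable_abse (irhoX i)).
- exact: integrableZR.
- by move=> w _; rewrite normrM (ger0_norm (rho0 w)) mulrC ler_wpM2r.
Qed.

Lemma mix_gt0 z : 0 < mixr z.
Proof.
pose c := expR (- (M * \sum_(i < d) `|tnth (vscale s z) i|) - e / 2 * (d%:R * M ^+ 2)).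
apply: (@lt_le_trans _ _ (c * g)); first by rewrite mulr_gt0// expR_gt0.
rewrite /g -RintegralZl//; apply: le_Rintegral => //.
- exact: integrableZR.
- exact: (integrable_weight_lik P mX XM _ (ltW e0) mrho nrhoC).
- move=> w _; rewrite mulrC ler_wpM2l//; apply: lik_ge_l1 => //; exact: ltW.
Qed.

(** The likelihood of a drift frozen at the posterior mean, at which the tangent of the logarithm is
    taken. *)
Let eh z := lik h (vscale s z) e.

Let meh : measurable_fun setT eh.
Proof. by apply: measurable_fun_lik => //; exact: measurable_fun_vscale. Qed.

Let eh_gt0 z : 0 < eh z.
Proof. exact: lik_gt0. Qed.

Let A w w' := dot (vsub (X w) h) (vsub (X w') h).

Let A_le w w' : `|A w w'| <= K.
Proof.
have b (v : Omega) i : `|tnth (vsub (X v) h) i| <= 2 * M.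
  rewrite tnth_mktuple (le_trans (ler_normB _ _))//.
  by have := XM v i; have := h_le i; lra.
apply: (le_trans (ler_norm_sum _ _ _)).
rewrite /K mulr_natl -[d in leRHS]card_ord -sumr_const; apply: ler_sum => i _.
by rewrite normrM expr2 ler_pM.
Qed.

Let lik_ratio w w' z :
  lik (X w') (vscale s (vadd z (vscale s (X w)))) e / eh (vadd z (vscale s (X w)))
  = expR (dot (vscale s (vsub (X w') h)) z) *
    expR (e * dot (vsub (X w') h) (X w) - e / 2 * (sqnorm (X w') - sqnorm h)).
Proof.
have se : s * s = e by rewrite -expr2 sqr_sqrtr// ltW.
rewrite /eh /lik -expRN -!expRD; congr expR.
rewrite !dotZr !dotDr !dotZr !dotZl !dotBl !mulrDr !mulrA se.
by ring.
Qed.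

(** After the Gaussian exponential moment is taken, the exponent is [e] times a polynomial in [X w],
    [X w'] and [h] that regroups as the inner product of the two centred values. *)
Let integral_lik_ratio w w' :
  (\int[gam]_z (lik (X w') (vscale s (vadd z (vscale s (X w)))) e /
      eh (vadd z (vscale s (X w))))%:E = (expR (e * A w w'))%:E)%E.
Proof.
have se : s * s = e by rewrite -expr2 sqr_sqrtr// ltW.
under eq_integral do rewrite lik_ratio mulrC EFinM.
rewrite ge0_integralZl//; last first.
  by apply/measurable_EFinP; apply: measurableT_comp => //; exact: measurable_fun_dot.
rewrite integral_expR_dot// -EFinM -expRD; congr (expR _)%:E.
rewrite /A !sqnormE dotZr dotZl mulrA se !dotBl !dotBr (dotC h (X w')) (dotC (X w') (X w)).
by rewrite (dotC h (X w)); field.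
Qed.

(** One factor [mixr] is expanded over [X w] and the other over [X w'], which gives the average of
    [exp (e * A w w')]. The constant term yields [g ^+ 2], the linear term vanishes by the choice of
    [h], and [expR_le_quadratic] supplies the factor [2] of the remainder. *)
Lemma chi_square_bound : e * K <= 1 / 2 ->
  (\int[gam]_z (mixr z ^+ 2 / eh z)%:E <= (g ^+ 2 * (1 + 2 * (e * K) ^+ 2))%:E)%E.
Proof.
move=> eK.
set kk := 1 + 2 * (e * K) ^+ 2.
have kk0 : 0 <= kk by rewrite addr_ge0// mulr_ge0// sqr_ge0.
have mmix := measurable_mix P mX e mrho rho0.
have mF : measurable_fun setT (fun z => mixr z / eh z).
  by apply: measurable_funM => //; exact: measurable_funV_gt0.
have F0 z : 0 <= mixr z / eh z by rewrite divr_ge0// ?mix_ge0// ltW.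
have mA w : measurable_fun setT (A w).
  by apply: measurable_fun_dot => //; exact: measurable_fun_vsub.
have iA w : P.-integrable setT (EFin \o (fun w' => rho w' * A w w')).
  apply: (@integrable_bounded _ _ _ _ _ (C * K)); first exact: measurable_funM.
  by move=> w'; rewrite normrM ler_pM.
(* The centring at the weighted mean [h] removes the first-order term. *)
have intA w : \int[P]_w' (rho w' * A w w') = 0.
  rewrite (_ : (fun w' => _) = fun w' => \sum_(i < d) tnth (vsub (X w) h) i *
      (rho w' * tnth (X w') i + - tnth h i * rho w')); last first.
    apply: funext => w'; rewrite /A /dot mulr_sumr; apply: eq_bigr => i _.
    by rewrite !tnth_mktuple; ring.
  have i1 i : P.-integrable setT (EFin \o (fun w' => rho w' * tnth (X w') i + - tnth h i * rho w')).
    by apply: integrableDR; [exact: irhoX|exact: integrableZR].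
  rewrite Rintegral_sumR; last by move=> i; apply: integrableZR; exact: i1.
  rewrite big1// => i _; rewrite RintegralZl//.
  rewrite RintegralD//; last exact: integrableZR.
  by rewrite RintegralZl// -/(m i) -/g mulNr [_ * g]mulrC gh subrr mulr0.
have inner w : (\int[gam]_z (mixr (vadd z (vscale s (X w))) / eh (vadd z (vscale s (X w))))%:E
     <= (g * kk)%:E)%E.
  have msh : measurable_fun setT (fun z : vec => vadd z (vscale s (X w))).
    exact: measurable_fun_vadd.
  have mint : measurable_fun setT (fun p : vec * Omega => rho p.2 *
     (lik (X p.2) (vscale s (vadd p.1 (vscale s (X w)))) e / eh (vadd p.1 (vscale s (X w))))).
    apply: measurable_funM; first exact: measurableT_comp.
    have msh1 : measurable_fun setT (fun p : vec * Omega => vadd p.1 (vscale s (X w))).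
      exact: measurable_fun_vadd.
    apply: measurable_funM.
      apply: measurable_fun_lik; first exact: measurableT_comp.
      exact: measurable_fun_vscale.
    apply: measurable_funV_gt0 => //; exact: (measurableT_comp meh).
  rewrite (_ : (\int[gam]_z _)%E = (\int[gam]_z \int[P]_w' (rho w' *
     (lik (X w') (vscale s (vadd z (vscale s (X w)))) e / eh (vadd z (vscale s (X w)))))%:E)%E); last first.
    apply: eq_integral => z _; rewrite EFinM (mixE P mX XM e0 mrho rho0 rhoC) muleC.
    rewrite -ge0_integralZl//.
    - by apply: eq_integral => w' _; rewrite -EFinM; congr EFin; rewrite mulrCA [X in _ * X]mulrC.
    - apply/measurable_EFinP; apply: measurable_funM => //.
      exact: measurable_fun_lik.
    - by move=> w' _; rewrite lee_fin mulr_ge0// lik_ge0.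
    - by rewrite lee_fin invr_ge0 ltW.
  rewrite (@ge0_fubini _ _ _ _ _ gam P (fun z w' => (rho w' *
     (lik (X w') (vscale s (vadd z (vscale s (X w)))) e / eh (vadd z (vscale s (X w)))))%:E)); last 2 first.
  - exact/measurable_EFinP.
  - by move=> z w'; rewrite lee_fin mulr_ge0// divr_ge0 ?lik_ge0.
  (* The quadratic bound on the exponential is legitimate since [e * A w w' <= e * K <= 1 / 2]. *)
  apply: (@le_trans _ _ (\int[P]_w' (rho w' * (1 + e * A w w' + 2 * (e * K) ^+ 2))%:E)%E).
    apply: ge0_le_integral => //.
    - by move=> w' _; apply: integral_ge0 => z _; rewrite lee_fin mulr_ge0// divr_ge0 ?lik_ge0.
    - apply: (@measurable_ge0_integral_snd _ _ _ _ _ gam (fun w' z => (rho w' *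
       (lik (X w') (vscale s (vadd z (vscale s (X w)))) e / eh (vadd z (vscale s (X w)))))%:E)).
        apply/measurable_EFinP.
        exact: (measurableT_comp mint (measurable_fun_pair measurable_snd measurable_fst)).
      by move=> w' z; rewrite lee_fin mulr_ge0// divr_ge0 ?lik_ge0.
    - apply/measurable_EFinP; apply: measurable_funM => //; apply: measurable_funD => //.
      by apply: measurable_funD => //; exact: measurable_funM.
    - move=> w' _; under eq_integral do rewrite EFinM.
      rewrite ge0_integralZl ?lee_fin//; last 2 first.
      + apply/measurable_EFinP; apply: measurable_funM.
          by apply: measurable_fun_lik => //; exact: measurable_fun_vscale.
        by apply: measurable_funV_gt0 => //; exact: measurableT_comp.
      + by move=> z _; rewrite lee_fin divr_ge0 ?lik_ge0.
      rewrite integral_lik_ratio -EFinM lee_fin ler_wpM2l//.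
      have := A_le w w'; rewrite ler_norml => /andP[Al Au].
      have eA : `|e * A w w'| <= e * K by rewrite normrM (gtr0_norm e0) ler_wpM2l// ltW.
      apply: (le_trans (expR_le_quadratic _)).
        by rewrite (le_trans _ eK)// ler_wpM2l// ltW.
      rewrite lerD2l ler_wpM2l// -real_normK ?num_real// lerXn2r// ?nnegrE//.
      exact: le_trans eA.
  rewrite (_ : (fun w' => _) = (fun w' => (kk * rho w' + e * (rho w' * A w w'))%:E)); last first.
    by apply: funext => w'; congr EFin; rewrite /kk; ring.
  rewrite EFin_Rintegral; last by apply: integrableDR; exact: integrableZR.
  rewrite RintegralD//; [|exact: integrableZR|exact: integrableZR].
  by rewrite !RintegralZl// intA mulr0 addr0 mulrC.
have -> : (\int[gam]_z (mixr z ^+ 2 / eh z)%:E = \int[gam]_z (mixr z / eh z * mixr z)%:E)%E.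
  by apply: eq_integral => z _; congr EFin; rewrite expr2 mulrAC.
rewrite (ge0_integral_mix P mX XM Hg e0 mrho rho0 rhoC mF F0).
apply: (@le_trans _ _ (\int[P]_w (g * kk * rho w)%:E)%E).
  apply: ge0_le_integral => //.
  - by move=> w _; apply: integral_ge0 => z _; rewrite lee_fin mulr_ge0.
  - apply: (@measurable_ge0_integral_snd _ _ _ _ _ gam (fun w z =>
      (mixr (vadd z (vscale s (X w))) / eh (vadd z (vscale s (X w))) * rho w)%:E)).
      apply/measurable_EFinP; apply: measurable_funM; last exact: measurableT_comp.
      apply: (measurableT_comp mF); apply: measurable_fun_vadd => //.
      by apply: measurable_fun_vscale; exact: measurableT_comp.
    by move=> w z; rewrite lee_fin mulr_ge0.
  - by apply/measurable_EFinP; exact: measurable_funM.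
  - move=> w _; under eq_integral do rewrite mulrC EFinM.
    rewrite ge0_integralZl ?lee_fin//; last 2 first.
    + by apply/measurable_EFinP; apply: (measurableT_comp mF); exact: measurable_fun_vadd.
    + by move=> z _; rewrite lee_fin.
    by rewrite mulrC EFinM lee_wpmul2l ?lee_fin.
rewrite EFin_Rintegral; last exact: integrableZR.
by rewrite RintegralZl// -/g lee_fin expr2 mulrAC.
Qed.

(* The logarithm is bounded by its tangent at the Gaussian with the same
   conditional mean [h]; what remains is a chi-square term of order [e^2]. *)
Lemma entropy_step_le : e * K <= 1 / 2 ->
  (\int[gam]_z (1 + mixr z * ln (mixr z))%:E
   <= (1 + g * ln g + e / 2 * (\sum_(i < d) m i ^+ 2 / g) + g * (2 * (e * K) ^+ 2))%:E)%E.
Proof.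
move=> eK.
have mmix := measurable_mix P mX e mrho rho0.
have chi0 z : 0 <= mixr z ^+ 2 / eh z by rewrite divr_ge0 ?sqr_ge0// ltW.
have ichi : gam.-integrable setT (EFin \o (fun z => mixr z ^+ 2 / eh z)).
  apply/integrableP; split.
    apply/measurable_EFinP; apply: measurable_funM; first exact: measurable_funX.
    exact: measurable_funV_gt0.
  under eq_integral do rewrite /= ger0_norm//.
  by rewrite (le_lt_trans (chi_square_bound eK)) ?ltry.
pose c := ln g - e / 2 * sqnorm h - 1.
pose lin z := \sum_(i < d) s * tnth h i * (tnth z i * mixr z).
have ilin i : gam.-integrable setT (EFin \o (fun z => s * tnth h i * (tnth z i * mixr z))).
  by apply: integrableZR; exact: (integrable_tnth_mix P mX XM Hg e0 mrho rho0 rhoC).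
have imix := integrable_mix P mX XM Hg e0 mrho rho0 rhoC.
(* With [r = mixr z], write [ln r = ln g + ln (eh z) + ln (r / (g * eh z))] and bound the last
   logarithm by [r / (g * eh z) - 1]; multiplying by [r] gives [bd], whose terms are all
   integrable. *)
pose bd z := 1 + c * mixr z + lin z + g^-1 * (mixr z ^+ 2 / eh z).
have i1 : gam.-integrable setT (EFin \o (fun z : vec => 1 + c * mixr z)).
  apply: integrableDR; last exact: integrableZR.
  by apply: (@integrable_bounded _ _ _ _ _ 1) => // z; rewrite normr1.
have i2 : gam.-integrable setT (EFin \o (fun z : vec => 1 + c * mixr z + lin z)).
  by apply: integrableDR => //; exact: integrable_sumR.
have ibd : gam.-integrable setT (EFin \o bd).
  by apply: integrableDR => //; exact: integrableZR.
apply: (@le_trans _ _ (\int[gam]_z (bd z)%:E)%E).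
  apply: ge0_le_integral => //.
  - move=> z _; rewrite lee_fin; have := xlnx_ge (mix_gt0 z); have := mix_gt0 z; lra.
  - apply/measurable_EFinP; apply: measurable_funD => //; apply: measurable_funM => //.
    exact: measurableT_comp.
  - exact: measurable_int ibd.
  - move=> z _; rewrite lee_fin /bd -!addrA lerD2l.
    set r := mixr z; have r0 : 0 < r by exact: mix_gt0.
    have lnr : ln r = ln g + (dot h (vscale s z) - e / 2 * sqnorm h) + ln (r / (g * eh z)).
      rewrite ln_div ?posrE// ?mulr_gt0// lnM ?posrE// [ln (eh z)]expRK; ring.
    have := @ln_le_subr1 _ (r / (g * eh z)); rewrite divr_gt0 ?mulr_gt0// => /(_ isT) lnle.
    have linE : lin z = r * dot h (vscale s z).
      rewrite dotZr /lin /dot !mulr_sumr; apply: eq_bigr => i _; rewrite -/r; ring.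
    rewrite linE lnr.
    have -> : g^-1 * (r ^+ 2 / eh z) = r * (r / (g * eh z)).
      by rewrite expr2 invfM; ring.
    have : r * ln (r / (g * eh z)) <= r * (r / (g * eh z) - 1) by rewrite ler_pM2l.
    by rewrite /c; lra.
rewrite EFin_Rintegral// lee_fin /bd RintegralD//; last exact: integrableZR.
rewrite RintegralD//; last exact: integrable_sumR.
rewrite RintegralD//; [|by apply: (@integrable_bounded _ _ _ _ _ 1) => // z; rewrite normr1|exact: integrableZR].
rewrite Rintegral_prob_cst RintegralZl// (Rintegral_mix P mX XM Hg e0 mrho rho0 rhoC) -/g.
rewrite Rintegral_sumR// RintegralZl//.
(* Half of this is cancelled by the term [- e / 2 * sqnorm h] of [c]; the other half is the Fisher
   term. *)
have -> : \sum_(i < d) \int[gam]_z (s * tnth h i * (tnth z i * mixr z)) =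
          e * (g * sqnorm h).
  rewrite /sqnorm !mulr_sumr; apply: eq_bigr => i _.
  rewrite RintegralZl//; last exact: (integrable_tnth_mix P mX XM Hg e0 mrho rho0 rhoC).
  rewrite (Rintegral_tnth_mix P mX XM Hg e0 mrho rho0 rhoC) -/(m i) -gh.
  by rewrite mulrACA -expr2 sqr_sqrtr ?(ltW e0)//; ring.
have -> : \sum_(i < d) m i ^+ 2 / g = g * sqnorm h.
  rewrite /sqnorm mulr_sumr; apply: eq_bigr => i _; rewrite -gh exprMn expr2.
  by field; rewrite gt_eqF.
have : g^-1 * \int[gam]_z (mixr z ^+ 2 / eh z) <= g * (1 + 2 * (e * K) ^+ 2).
  rewrite mulrC ler_pdivrMr// mulrAC -expr2 -lee_fin -EFin_Rintegral//.
  exact: chi_square_bound.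
by rewrite /c; lra.
Qed.

End entropy_step.

Section fisher_step.
Context {R : realType} {d : nat} {dO : measure_display} {Omega : measurableType dO}.
Local Notation vec := (d.-tuple R).
Variables (P : probability Omega R) (X : Omega -> vec) (M : R).
Hypotheses (mX : measurable_fun setT X) (XM : forall w i, `|tnth (X w) i| <= M).
Variables (gam : probability vec R) (e : R).
Hypotheses (Hg : std_gaussian gam) (e0 : 0 < e).
Variables (rho : Omega -> R) (C : R).
Hypotheses (mrho : measurable_fun setT rho) (rho0 : forall w, 0 <= rho w)
  (rhoC : forall w, rho w <= C).
Let g := \int[P]_w rho w.
Hypothesis g0 : 0 < g.
Let m (i : 'I_d) := \int[P]_w (rho w * tnth (X w) i).
Local Notation mixr := (mix P X e rho).
Local Notation mixX i := (mix P X e (fun w => rho w * tnth (X w) i)).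

Let nrhoC w : `|rho w| <= C.
Proof. by rewrite ger0_norm. Qed.

Let mtX i : measurable_fun setT (fun w => tnth (X w) i).
Proof. exact: measurable_fun_tnth. Qed.

(* Shifting [X i] by its bound makes the weight nonnegative. *)
Let rhop i w := rho w * (tnth (X w) i + M).

Let mrhop i : measurable_fun setT (rhop i).
Proof. by apply: measurable_funM => //; exact: measurable_funD. Qed.

Let rhop0 i w : 0 <= rhop i w.
Proof. by rewrite mulr_ge0//; have := XM w i; rewrite ler_norml => /andP[]; lra. Qed.

Let rhopC i w : rhop i w <= C * (M + M).
Proof.
have := XM w i; rewrite ler_norml => /andP[l u].
by rewrite ler_pM//; lra.
Qed.

Let mixXE i z : mixX i z = mix P X e (rhop i) z - M * mixr z.
Proof.
have i1 : P.-integrable setT (EFin \o (fun w => rho w * lik (X w) (vscale (Num.sqrt e) z) e)).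
  exact: (integrable_weight_lik P mX XM _ (ltW e0) mrho nrhoC).
have i2 : P.-integrable setT (EFin \o (fun w => rhop i w * lik (X w) (vscale (Num.sqrt e) z) e)).
  apply: (integrable_weight_lik P mX XM _ (ltW e0) (mrhop i) (C := C * (M + M))) => w.
  by rewrite ger0_norm.
rewrite /mix -RintegralZl// -RintegralB//; last exact: integrableZR.
by apply: eq_Rintegral => w _; rewrite /rhop; ring.
Qed.

Let imixr : gam.-integrable setT (EFin \o mixr).
Proof. exact: (integrable_mix P mX XM Hg e0 mrho rho0 rhoC). Qed.

Let imixp i : gam.-integrable setT (EFin \o mix P X e (rhop i)).
Proof. exact: (integrable_mix P mX XM Hg e0 (mrhop i) (rhop0 i) (rhopC i)). Qed.

Let imixX i : gam.-integrable setT (EFin \o mixX i).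
Proof.
rewrite (_ : _ \o _ = EFin \o (fun z => mix P X e (rhop i) z + - M * mixr z)).
  by apply: integrableDR => //; exact: integrableZR.
by apply: funext => z /=; rewrite mixXE mulNr.
Qed.

Let RintegralmixX i : \int[gam]_z mixX i z = m i.
Proof.
under eq_Rintegral do rewrite mixXE.
rewrite RintegralB//; last exact: integrableZR.
rewrite RintegralZl// (Rintegral_mix P mX XM Hg e0 (mrhop i) (rhop0 i) (rhopC i)).
rewrite (Rintegral_mix P mX XM Hg e0 mrho rho0 rhoC).
have ir : P.-integrable setT (EFin \o rho) by exact: (integrable_bounded _ mrho nrhoC).
rewrite -RintegralZl// -RintegralB//; last 2 first.
- by apply: (integrable_bounded _ (mrhop i) (C := C * (M + M))) => w; rewrite ger0_norm.
- exact: integrableZR.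
by apply: eq_Rintegral => w _; rewrite /rhop; ring.
Qed.

Lemma measurable_mix_coord i : measurable_fun setT (mixX i).
Proof. by have /measurable_int/measurable_EFinP := imixX i. Qed.

(** Jensen's inequality for the convex function [a^2 / b], through its tangents [2 h a - h^2 b] at
    [h = m i / g]: the numerators [mixX i] and the denominator [mixr] integrate to [m i] and [g]. *)
Lemma fisher_step_le :
  ((\sum_(i < d) m i ^+ 2 / g)%:E
   <= \int[gam]_z (\sum_(i < d) mixX i z ^+ 2 / mixr z)%:E)%E.
Proof.
have mpos z : 0 < mixr z by exact: (mix_gt0 mX XM e0 mrho rho0 rhoC g0).
have mmix := measurable_mix P mX e mrho rho0.
pose F z := \sum_(i < d) mixX i z ^+ 2 / mixr z.
have F0 z : 0 <= F z by apply: sumr_ge0 => i _; rewrite divr_ge0 ?sqr_ge0// ltW.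
have mF : measurable_fun setT F.
  apply: measurable_sum => i; apply: measurable_funM.
    by apply: measurable_funX; exact: measurable_mix_coord.
  exact: measurable_funV_gt0.
have [Foo|Foo] := ltP (\int[gam]_z (F z)%:E)%E +oo%E; last first.
  by rewrite (le_trans _ Foo)// leey.
have iF : gam.-integrable setT (EFin \o F).
  apply/integrableP; split; first exact/measurable_EFinP.
  by under eq_integral do rewrite /= ger0_norm//.
rewrite EFin_Rintegral// lee_fin.
pose hh i := m i / g.
have iL i : gam.-integrable setT
    (EFin \o (fun z => (2 * hh i) * mixX i z + - hh i ^+ 2 * mixr z)).
  by apply: integrableDR; exact: integrableZR.
have -> : \sum_(i < d) m i ^+ 2 / g =
    \int[gam]_z (\sum_(i < d) ((2 * hh i) * mixX i z + - hh i ^+ 2 * mixr z)).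
  rewrite Rintegral_sumR//; apply: eq_bigr => i _.
  rewrite RintegralD//; [|exact: integrableZR|exact: integrableZR].
  rewrite !RintegralZl// RintegralmixX (Rintegral_mix P mX XM Hg e0 mrho rho0 rhoC) -/g /hh.
  by field; rewrite gt_eqF.
apply: le_Rintegral => //; first exact: integrable_sumR.
move=> z _; apply: ler_sum => i _.
rewrite ler_pdivlMr//; set a := mixX i z; set b := mixr z.
by have := sqr_ge0 (a - hh i * b); rewrite !expr2; lra.
Qed.

End fisher_step.

(** Cauchy--Schwarz in variance form: expand the integral of [r (x - h)^2], where [h] is the
    weighted mean of [x]. *)
Lemma weighted_sqr_le {R : realType} (dT : measure_display) (T : measurableType dT)
    (P : probability T R) (r x : T -> R) :
  (forall w, 0 <= r w) ->
  P.-integrable setT (EFin \o r) ->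
  P.-integrable setT (EFin \o (fun w => r w * x w)) ->
  P.-integrable setT (EFin \o (fun w => r w * x w ^+ 2)) ->
  0 < \int[P]_w r w ->
  (\int[P]_w (r w * x w)) ^+ 2 / \int[P]_w r w <= \int[P]_w (r w * x w ^+ 2).
Proof.
move=> r0 i0 i1 i2 g0; set g := \int[P]_w r w; set m := \int[P]_w (r w * x w).
pose h := m / g.
have : 0 <= \int[P]_w (r w * x w ^+ 2 + (- (2 * h) * (r w * x w) + h ^+ 2 * r w)).
  apply: Rintegral_ge0 => w _.
  have : 0 <= r w * (x w - h) ^+ 2 by rewrite mulr_ge0 ?sqr_ge0.
  by rewrite !expr2; lra.
rewrite RintegralD//; last by apply: integrableDR; exact: integrableZR.
rewrite RintegralD//; [|exact: integrableZR|exact: integrableZR].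
rewrite !RintegralZl// -/g -/m /h.
have -> : - (2 * (m / g)) * m + (m / g) ^+ 2 * g = - (m ^+ 2 / g).
  by field; rewrite gt_eqF.
lra.
Qed.

(** * Entropy and Fisher information along time, for a bounded hidden variable *)

Section entropy_along_time.
Context {R : realType} {d : nat} {dO : measure_display} {Omega : measurableType dO}.
Local Notation vec := (d.-tuple R).
Variables (P : probability Omega R) (X : Omega -> vec) (gam : probability vec R).

Definition G t y : R := \int[P]_w lik (X w) y t.
Definition mom t i y : R := \int[P]_w (lik (X w) y t * tnth (X w) i).

(* [ent t - 1] is the relative entropy of the comparison process at time [t]
   with respect to Brownian motion; the shift by [1] keeps the integrand
   nonnegative. *)
Definition ent t : \bar R :=
  (\int[gam]_z (let y := vscale (Num.sqrt t) z in 1 + G t y * ln (G t y))%:E)%E.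

(** [mom / G] is the posterior mean at [y] and [G] is the density of [Y_t] relative to the Gaussian
    of variance [t]. Since [mom^2 / G = (mom / G)^2 G], this is the second moment of the posterior
    mean at time [t]. *)
Definition fish t : \bar R :=
  (\int[gam]_z (let y := vscale (Num.sqrt t) z in
     \sum_(i < d) mom t i y ^+ 2 / G t y)%:E)%E.

Hypothesis mX : measurable_fun setT X.

Lemma measurable_G t : measurable_fun setT (G t).
Proof.
apply: measurableT_comp => //.
exact: measurable_evidence.
Qed.

End entropy_along_time.

Section bounded_entropy.
Context {R : realType} {d : nat} {dO : measure_display} {Omega : measurableType dO}.
Local Notation vec := (d.-tuple R).
Variables (P : probability Omega R) (X : Omega -> vec) (gam : probability vec R).
Variable (M : R).
Hypotheses (mX : measurable_fun setT X) (XM : forall w i, `|tnth (X w) i| <= M).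
Hypothesis Hg : std_gaussian gam.
Local Notation G := (G P X).
Local Notation mom := (mom P X).
Local Notation ent := (ent P X gam).
Local Notation fish := (fish P X gam).
Let K := d%:R * (2 * M) ^+ 2.

Let C (y : vec) := expR (M * \sum_(i < d) `|tnth y i|).

Let likC t y w : 0 <= t -> lik (X w) y t <= C y.
Proof. by move=> t0; exact: lik_le_l1. Qed.

Let mlik t y : measurable_fun setT (fun w => lik (X w) y t).
Proof. exact: measurable_fun_lik. Qed.

Let ilik t y : 0 <= t -> P.-integrable setT (EFin \o (fun w => lik (X w) y t)).
Proof.
move=> t0; apply: (integrable_bounded _ (mlik t y) (C := C y)) => w.
by rewrite ger0_norm ?lik_ge0// likC.
Qed.

Lemma bounded_G_gt0 t y : 0 <= t -> 0 < G t y.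
Proof.
move=> t0.
pose c := expR (- (M * \sum_(i < d) `|tnth y i|) - t / 2 * (d%:R * M ^+ 2)).
apply: (@lt_le_trans _ _ c); first exact: expR_gt0.
rewrite -[c](Rintegral_prob_cst P); apply: le_Rintegral => //.
- by apply: (@integrable_bounded _ _ _ _ _ `|c|).
- exact: ilik.
- by move=> w _; exact: lik_ge_l1.
Qed.

Let GD t e y z : G (t + e) (vadd y z) = \int[P]_w (lik (X w) y t * lik (X w) z e).
Proof. by apply: eq_Rintegral => w _; rewrite likD. Qed.

Let momD t e i y z : mom (t + e) i (vadd y z) =
  \int[P]_w (lik (X w) y t * tnth (X w) i * lik (X w) z e).
Proof. by apply: eq_Rintegral => w _; rewrite likD mulrAC. Qed.

(** Tonelli's theorem gives measurability after [X] is shifted by [M] to become nonnegative; the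
    shift contributes a multiple of [G]. *)
Lemma bounded_measurable_mom t i : 0 <= t -> measurable_fun setT (mom t i).
Proof.
move=> t0.
have mp : measurable_fun setT (fun y => \int[P]_w (lik (X w) y t * (tnth (X w) i + M))).
  apply: measurableT_comp => //.
  apply: (@measurable_ge0_integral_snd _ _ _ _ _ P
    (fun y w => (lik (X w) y t * (tnth (X w) i + M))%:E)).
    apply/measurable_EFinP; apply: measurable_funM.
      by apply: measurable_fun_lik => //; exact: measurableT_comp.
    by apply: measurable_funD => //; apply: measurable_fun_tnth; exact: measurableT_comp.
  move=> y w; rewrite lee_fin mulr_ge0 ?lik_ge0//.
  by have := XM w i; rewrite ler_norml => /andP[]; lra.
rewrite (_ : mom t i = fun y => \int[P]_w (lik (X w) y t * (tnth (X w) i + M)) + - M * G t y).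
  by apply: measurable_funD => //; apply: measurable_funM => //; exact: measurable_G.
apply: funext => y.
have mtX : measurable_fun setT (fun w => tnth (X w) i) by exact: measurable_fun_tnth.
rewrite -RintegralZl//; last exact: ilik.
rewrite -RintegralD//.
- by apply: eq_Rintegral => w _; ring.
- apply: (@integrable_bounded _ _ _ _ _ (C y * (M + M))).
    by apply: measurable_funM => //; exact: measurable_funD.
  move=> w; rewrite normrM ler_pM//; first by rewrite ger0_norm ?lik_ge0// likC.
  have := XM w i; rewrite ler_norml => /andP[l u].
  by rewrite ger0_norm; lra.
- by apply: integrableZR; exact: ilik.
Qed.

Let ment t : 0 <= t -> measurable_fun setT (fun y => 1 + G t y * ln (G t y)).
Proof.
move=> t0; apply: measurable_funD => //; apply: measurable_funM; first exact: measurable_G.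
by apply: measurableT_comp => //; exact: measurable_G.
Qed.

Let ent_ge0 t y : 0 <= t -> 0 <= 1 + G t y * ln (G t y).
Proof.
move=> t0; have G0 := bounded_G_gt0 y t0.
by have := xlnx_ge G0; lra.
Qed.

Let mfish t : 0 <= t -> measurable_fun setT (fun y => \sum_(i < d) mom t i y ^+ 2 / G t y).
Proof.
move=> t0; apply: measurable_sum => i; apply: measurable_funM.
  by apply: measurable_funX; exact: bounded_measurable_mom.
apply: measurable_funV_gt0; first exact: measurable_G.
by move=> y; exact: bounded_G_gt0.
Qed.

Let fish_ge0 t y : 0 <= t -> 0 <= \sum_(i < d) mom t i y ^+ 2 / G t y.
Proof.
by move=> t0; apply: sumr_ge0 => i _; rewrite divr_ge0 ?sqr_ge0// ltW// bounded_G_gt0.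
Qed.

Let mscale (a : R) : measurable_fun setT (fun z : vec => vscale a z).
Proof. exact: measurable_fun_vscale. Qed.

Lemma integral_G t : 0 <= t ->
  (\int[gam]_z (G t (vscale (Num.sqrt t) z))%:E = 1)%E.
Proof.
rewrite le_eqVlt => /predU1P[<-|t0].
  rewrite sqrtr0 -[RHS](integral_prob_cst gam); apply: eq_integral => z _.
  rewrite vscale0 /G; under eq_Rintegral do rewrite lik00.
  by rewrite Rintegral_prob_cst.
have r0 (w : Omega) : (0 : R) <= cst 1 w by [].
have r1 (w : Omega) : cst 1 w <= (1 : R) by [].
rewrite -[RHS](_ : (\int[P]_w (cst 1 w : R))%:E = 1%E); last by rewrite Rintegral_prob_cst.
rewrite -(integral_mix P mX XM Hg t0 (measurable_cst _) r0 r1).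
apply: eq_integral => z _; congr EFin.
by apply: eq_Rintegral => w _; rewrite mul1r.
Qed.

(** The Gaussian at time [t + e] is split into its value at time [t] and an independent increment;
    for each value [y], [fisher_step_le] applies with weight [lik (X w) y t]. *)
Lemma fish_mono t e : 0 <= t -> 0 < e -> (fish t <= fish (t + e))%E.
Proof.
move=> t0 e0; have te0 : 0 <= t + e by rewrite addr_ge0// ltW.
rewrite /fish -(ge0_gauss_step Hg t0 e0 (psi := fun y =>
   (\sum_(i < d) mom (t + e) i y ^+ 2 / G (t + e) y)%:E)); last 2 first.
- by apply/measurable_EFinP; exact: mfish.
- by move=> y; rewrite lee_fin fish_ge0.
apply: ge0_le_integral => //.
- by move=> z _; rewrite lee_fin fish_ge0.
- by apply/measurable_EFinP; apply: (measurableT_comp (mfish t0)).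
- apply: (@measurable_ge0_integral_snd _ _ _ _ _ gam (fun z z' =>
   (\sum_(i < d) mom (t + e) i (vadd (vscale (Num.sqrt t) z) (vscale (Num.sqrt e) z')) ^+ 2 /
     G (t + e) (vadd (vscale (Num.sqrt t) z) (vscale (Num.sqrt e) z')))%:E)).
    apply/measurable_EFinP; apply: (measurableT_comp (mfish te0)).
    by apply: measurable_fun_vadd; exact: measurable_fun_vscale.
  by move=> z z'; rewrite lee_fin fish_ge0.
- move=> z _; set y := vscale (Num.sqrt t) z.
  have := @fisher_step_le _ _ _ _ P X M mX XM gam e Hg e0 (fun w => lik (X w) y t) (C y)
    (mlik t y) (fun w => lik_ge0 _ _ _) (fun w => likC y w t0) (bounded_G_gt0 y t0).
  move=> /le_trans; apply.
  rewrite le_eqVlt; apply/orP; left; apply/eqP; apply: eq_integral => z' _.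
  by congr EFin; apply: eq_bigr => i _; rewrite momD GD.
Qed.

(** [entropy_step_le] is applied at each position [y] at time [t], with weight [lik (X w) y t] of
    total mass [G t y]. The average over [y] turns its terms into the entropy, the Fisher
    information and a constant error. *)
Lemma ent_chunk t e : 0 <= t -> 0 < e -> e * K <= 1 / 2 ->
  (ent (t + e) <= ent t + (e / 2)%:E * fish t + (2 * (e * K) ^+ 2)%:E)%E.
Proof.
move=> t0 e0 eK; have te0 : 0 <= t + e by rewrite addr_ge0// ltW.
rewrite {1}/ent -(ge0_gauss_step Hg t0 e0 (psi := fun y =>
   (1 + G (t + e) y * ln (G (t + e) y))%:E)); last 2 first.
- by apply/measurable_EFinP; exact: ment.
- by move=> y; rewrite lee_fin ent_ge0.
have k0 : 0 <= 2 * (e * K) ^+ 2 by rewrite mulr_ge0// sqr_ge0.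
have m1 : measurable_fun setT (fun z => (1 + G t (vscale (Num.sqrt t) z) *
    ln (G t (vscale (Num.sqrt t) z)))%:E).
  by apply/measurable_EFinP; exact: (measurableT_comp (ment t0)).
have m2 : measurable_fun setT (fun z => (\sum_(i < d) mom t i (vscale (Num.sqrt t) z) ^+ 2 /
    G t (vscale (Num.sqrt t) z))%:E).
  by apply/measurable_EFinP; exact: (measurableT_comp (mfish t0)).
have m3 : measurable_fun setT (fun z => (G t (vscale (Num.sqrt t) z))%:E).
  by apply/measurable_EFinP; exact: (measurableT_comp (measurable_G P mX t)).
have G0 y : 0 <= G t y by rewrite ltW// bounded_G_gt0.
have e20 : 0 <= e / 2 by rewrite divr_ge0// ltW.
(* The pointwise error carries the factor [G t y]; writing [1] as the integral of [G] brings the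
   whole right-hand side under one integral. *)
rewrite -[X in (_ <= _ + X)%E]mule1 -(integral_G t0) /ent /fish.
rewrite -!ge0_integralZl//; last 2 first.
- by move=> z _; rewrite lee_fin.
- by move=> z _; rewrite lee_fin fish_ge0.
rewrite -ge0_integralD//; last 3 first.
- by move=> z _; rewrite lee_fin ent_ge0.
- by move=> z _; apply: mule_ge0; rewrite lee_fin// fish_ge0.
- exact: emeasurable_funM.
rewrite -ge0_integralD//; last 4 first.
- move=> z _; apply: adde_ge0; first by rewrite lee_fin ent_ge0.
  by apply: mule_ge0; rewrite lee_fin// fish_ge0.
- by apply: emeasurable_funD => //; exact: emeasurable_funM.
- by move=> z _; apply: mule_ge0; rewrite lee_fin.
- exact: emeasurable_funM.
apply: ge0_le_integral => //.
- by move=> z _; apply: integral_ge0 => z' _; rewrite lee_fin ent_ge0.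
- apply: (@measurable_ge0_integral_snd _ _ _ _ _ gam (fun z z' =>
   (1 + G (t + e) (vadd (vscale (Num.sqrt t) z) (vscale (Num.sqrt e) z')) *
     ln (G (t + e) (vadd (vscale (Num.sqrt t) z) (vscale (Num.sqrt e) z'))))%:E)).
    apply/measurable_EFinP; apply: (measurableT_comp (ment te0)).
    by apply: measurable_fun_vadd; exact: measurable_fun_vscale.
  by move=> z z'; rewrite lee_fin ent_ge0.
- apply: emeasurable_funD; last exact: emeasurable_funM.
  by apply: emeasurable_funD => //; exact: emeasurable_funM.
- move=> z _; set y := vscale (Num.sqrt t) z.
  have := @entropy_step_le _ _ _ _ P X M mX XM gam e Hg e0 (fun w => lik (X w) y t) (C y)
    (mlik t y) (fun w => lik_ge0 _ _ _) (fun w => likC y w t0) (bounded_G_gt0 y t0) eK.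
  rewrite -!EFinM -!EFinD [in X in (_ <= X)%E -> _]mulrC.
  move=> H; rewrite -/y; apply: (le_trans _ (le_trans H _)).
    rewrite le_eqVlt; apply/orP; left; apply/eqP; apply: eq_integral => z' _.
    by rewrite GD.
  by rewrite lee_fin /G /mom -/K; lra.
Qed.

End bounded_entropy.

Lemma lee_affine_regroup {R : realType} (E F F' : \bar R) (x y p q : R) :
  0 <= x -> 0 <= y -> (0 <= F)%E -> (F <= F')%E ->
  (E + x%:E * F + p%:E + y%:E * F + q%:E <= E + (x + y)%:E * F' + (p + q)%:E)%E.
Proof.
move=> x0 y0 F0 FF.
have -> : (E + x%:E * F + p%:E + y%:E * F + q%:E
           = E + (x%:E * F + y%:E * F) + (p%:E + q%:E))%E.
  by rewrite -!addeA; congr (_ + _)%E; congr (_ + _)%E; rewrite addeCA.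
rewrite -ge0_muleDl ?lee_fin// -!EFinD leeD2r// leeD2l//.
by rewrite lee_wpmul2l// lee_fin addr_ge0.
Qed.

Lemma G00 {R : realType} {d : nat} {dO : measure_display} {Omega : measurableType dO}
  (P : probability Omega R) (X : Omega -> d.-tuple R) : G P X 0 vzero = 1.
Proof.
rewrite -[RHS](Rintegral_prob_cst P).
by apply: eq_Rintegral => w _; rewrite lik00.
Qed.

(** The induction step rests on the nonnegative product of [dmax - delta j.+1] and [b j.+1 - b j],
    which trades [delta * b j.+1] for [delta * b j] plus a term of the telescoping sum. *)
Lemma telescoped_bound {R : realType} (E : nat -> \bar R) (b delta : nat -> R)
    (dmax : R) n :
  E 0%N = 1%E ->
  (forall j, E j.+1 <= E j + (delta j.+1 / 2 * b j.+1)%:E)%E ->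
  (forall k, b k <= b k.+1) ->
  (forall k, (k < n)%N -> delta k.+1 <= dmax) ->
  (E n <= (1 + dmax / 2 * (b n - b 0%N) + \sum_(k < n) delta k.+1 / 2 * b k)%:E)%E.
Proof.
move=> E0 inc bmono dle.
suff step j : (j <= n)%N ->
    (E j <= (1 + dmax / 2 * (b j - b 0%N) + \sum_(k < j) delta k.+1 / 2 * b k)%:E)%E.
  exact: step.
elim: j => [_|j IH jn]; first by rewrite E0 big_ord0 subrr mulr0 !addr0.
apply: (le_trans (inc j)).
apply: (@le_trans _ _ ((1 + dmax / 2 * (b j - b 0%N) +
   \sum_(k < j) delta k.+1 / 2 * b k)%:E + (delta j.+1 / 2 * b j.+1)%:E)%E).
  by rewrite leeD2r// IH// ltnW.
rewrite -EFinD lee_fin big_ord_recr/=.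
have : (dmax - delta j.+1) * (b j.+1 - b j) >= 0.
  by rewrite mulr_ge0// subr_ge0// dle.
by lra.
Qed.

Section bounded_entropy_increment.
Context {R : realType} {d : nat} {dO : measure_display} {Omega : measurableType dO}.
Local Notation vec := (d.-tuple R).
Variables (P : probability Omega R) (X : Omega -> vec) (gam : probability vec R).
Variable (M : R).
Hypotheses (mX : measurable_fun setT X) (XM : forall w i, `|tnth (X w) i| <= M).
Hypothesis Hg : std_gaussian gam.
Local Notation ent := (ent P X gam).
Local Notation fish := (fish P X gam).
Let K := d%:R * (2 * M) ^+ 2.

Let fish_ge0 t : 0 <= t -> (0 <= fish t)%E.
Proof.
move=> t0; apply: integral_ge0 => z _; rewrite lee_fin; apply: sumr_ge0 => i _.
by rewrite divr_ge0 ?sqr_ge0// ltW// (bounded_G_gt0 P mX XM).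
Qed.

(** By monotonicity the Fisher information of each piece is replaced by its value at the latest
    time, so that the terms add up. *)
Lemma ent_chunks t e j : 0 <= t -> 0 < e -> e * K <= 1 / 2 ->
  (ent (t + e *+ j) <= ent t + (e *+ j / 2)%:E * fish (t + e *+ j)
     + (2 * (e * K) ^+ 2 *+ j)%:E)%E.
Proof.
move=> t0 e0 eK; elim: j => [|j IH].
  by rewrite !mulr0n addr0 mul0r mul0e !adde0.
have tj0 : 0 <= t + e *+ j by rewrite addr_ge0// mulrn_wge0// ltW.
have e20 : 0 <= e / 2 by rewrite divr_ge0// ltW.
have ej0 : 0 <= e *+ j / 2 by rewrite divr_ge0// mulrn_wge0// ltW.
rewrite mulrSr addrA.
apply: (le_trans (ent_chunk P mX XM Hg tj0 e0 eK)).
have mono := fish_mono P mX XM Hg tj0 e0.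
apply: (@le_trans _ _ (ent t + (e *+ j / 2)%:E * fish (t + e *+ j)
     + (2 * (e * K) ^+ 2 *+ j)%:E + (e / 2)%:E * fish (t + e *+ j)
     + (2 * (e * K) ^+ 2)%:E)%E).
  by rewrite leeD2r// leeD2r.
apply: (le_trans (lee_affine_regroup _ _ _ ej0 e20 (fish_ge0 tj0) mono)).
by rewrite -mulrDl -!mulrSr.
Qed.

(** With [n] pieces of length [e / n] the accumulated error is [2 (e K)^2 / n], which can be made
    smaller than any [r]. *)
Lemma ent_increment t e : 0 <= t -> 0 < e ->
  (ent (t + e) <= ent t + (e / 2)%:E * fish (t + e))%E.
Proof.
move=> t0 e0; apply/lee_addgt0Pr => r r0.
have K0 : 0 <= K by rewrite mulr_ge0// sqr_ge0.
(* Any [n] above [B] makes the pieces short enough for the one-piece bound, through the first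
   summand, and the total error at most [r], through the second. *)
pose B := 2 * (e * K) + 2 * (e * K) ^+ 2 / r + 1.
have eK0 : 0 <= e * K by rewrite mulr_ge0// ltW.
have B2 : 0 <= 2 * (e * K) ^+ 2 / r by rewrite divr_ge0 ?(ltW r0)// mulr_ge0 ?sqr_ge0.
have [n nB] : exists n : nat, B < n%:R.
  by exists (Num.truncn B).+1; exact: truncnS_gt.
have n0 : 0 < n%:R :> R by apply: le_lt_trans nB; rewrite /B; lra.
have n_neq0 : n%:R != 0 :> R by rewrite gt_eqF.
pose u := e / n%:R.
have u0 : 0 < u by rewrite divr_gt0.
have un : u *+ n = e by rewrite -mulr_natr divfK.
have uK : u * K <= 1 / 2.
  by rewrite /u mulrAC ler_pdivrMr//; move: nB; rewrite /B; lra.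
have := ent_chunks n t0 u0 uK; rewrite un => /le_trans; apply.
rewrite leeD2l// lee_fin.
have -> : 2 * (u * K) ^+ 2 *+ n = 2 * (e * K) ^+ 2 / n%:R.
  by rewrite -mulr_natr /u; field.
rewrite ler_pdivrMr//.
have : 2 * (e * K) ^+ 2 / r <= n%:R by move: nB; rewrite /B; lra.
by rewrite ler_pdivrMr// => ?; rewrite [r * _]mulrC.
Qed.

Lemma bounded_integrable_sqnorm : P.-integrable setT (EFin \o (fun w => sqnorm (X w))).
Proof.
apply: (@integrable_bounded _ _ _ _ _ (d%:R * M ^+ 2)).
  exact: measurable_fun_sqnorm.
by move=> w; rewrite ger0_norm ?sqnorm_ge0// sqnorm_le_sup.
Qed.

(** Conditional Cauchy--Schwarz bounds the squared posterior mean by the posterior second moment,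
    and averaging over positions returns the second moment of [X]. *)
Lemma fish_le t : 0 <= t -> (fish t <= (\int[P]_w sqnorm (X w))%:E)%E.
Proof.
move=> t0.
pose S y := \int[P]_w (sqnorm (X w) * lik (X w) y t).
have ilik (r : Omega -> R) (c : R) y : measurable_fun setT r -> (forall w, `|r w| <= c) ->
    P.-integrable setT (EFin \o (fun w => r w * lik (X w) y t)).
  by move=> mr rc; exact: (integrable_weight_lik P mX XM y t0 mr rc).
have nb (i : 'I_d) w : `|tnth (X w) i ^+ 2| <= M ^+ 2.
  by rewrite normrX lerXn2r// ?nnegrE// (le_trans _ (XM w i)).
have mtX i : measurable_fun setT (fun w => tnth (X w) i) by exact: measurable_fun_tnth.
have nS w : `|sqnorm (X w)| <= d%:R * M ^+ 2.
  by rewrite ger0_norm ?sqnorm_ge0// sqnorm_le_sup.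
have mS : measurable_fun setT (fun w => sqnorm (X w)) by exact: measurable_fun_sqnorm.
have pw y : \sum_(i < d) mom P X t i y ^+ 2 / G P X t y <= S y.
  rewrite (_ : S y = \sum_(i < d) \int[P]_w (lik (X w) y t * tnth (X w) i ^+ 2)); last first.
    rewrite -Rintegral_sumR.
      apply: eq_Rintegral => w _; rewrite mulrC mulr_sumr //.
    move=> i; rewrite (_ : _ \o _ = EFin \o (fun w => tnth (X w) i ^+ 2 * lik (X w) y t)).
      by apply: (ilik _ (M ^+ 2)) => //; exact: measurable_funX.
    by apply: funext => w /=; rewrite mulrC.
  apply: ler_sum => i _; apply: weighted_sqr_le.
  - by move=> w; exact: lik_ge0.
  - rewrite (_ : _ \o _ = EFin \o (fun w => cst 1 w * lik (X w) y t)).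
      by apply: (ilik _ 1) => // w; rewrite normr1.
    by apply: funext => w /=; rewrite mul1r.
  - rewrite (_ : _ \o _ = EFin \o (fun w => tnth (X w) i * lik (X w) y t)).
      by apply: (ilik _ M).
    by apply: funext => w /=; rewrite mulrC.
  - rewrite (_ : _ \o _ = EFin \o (fun w => tnth (X w) i ^+ 2 * lik (X w) y t)).
      by apply: (ilik _ (M ^+ 2)) => //; exact: measurable_funX.
    by apply: funext => w /=; rewrite mulrC.
  - exact: (bounded_G_gt0 P mX XM).
have S0 y : 0 <= S y.
  by apply: Rintegral_ge0 => w _; rewrite mulr_ge0 ?lik_ge0 ?sqnorm_ge0.
have mSy : measurable_fun setT S.
  apply: measurableT_comp => //.
  apply: (@measurable_ge0_integral_snd _ _ _ _ _ P
    (fun y w => (sqnorm (X w) * lik (X w) y t)%:E)).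
    apply/measurable_EFinP; apply: measurable_funM.
      exact: (measurableT_comp mS measurable_snd).
    by apply: measurable_fun_lik => //; exact: (measurableT_comp mX measurable_snd).
  by move=> y w; rewrite lee_fin mulr_ge0 ?lik_ge0 ?sqnorm_ge0.
have msc : measurable_fun setT (fun z : vec => vscale (Num.sqrt t) z).
  exact: measurable_fun_vscale.
apply: (@le_trans _ _ (\int[gam]_z (S (vscale (Num.sqrt t) z))%:E)%E).
  apply: ge0_le_integral => //.
  - move=> z _; rewrite lee_fin; apply: sumr_ge0 => i _.
    by rewrite divr_ge0 ?sqr_ge0// ltW// (bounded_G_gt0 P mX XM).
  - apply/measurable_EFinP; apply: measurable_sum => i; apply: measurable_funM.
      apply: measurable_funX.
      exact: (measurableT_comp (bounded_measurable_mom P mX XM i t0) msc).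
    apply: measurable_funV_gt0; last by move=> z; exact: (bounded_G_gt0 P mX XM).
    exact: (measurableT_comp (measurable_G P mX t) msc).
  - by apply/measurable_EFinP; exact: measurableT_comp.
  - by move=> z _; rewrite lee_fin.
(* [integral_mix] needs a positive time; at time [0] the likelihood is identically [1]. *)
move: t0; rewrite le_eqVlt => /predU1P[te|t0].
  rewrite -[X in (_ <= X)%E](integral_prob_cst gam).
  rewrite le_eqVlt; apply/orP; left; apply/eqP; apply: eq_integral => z _.
  congr EFin; rewrite /S -te sqrtr0 vscale0.
  by apply: eq_Rintegral => w _; rewrite lik00 mulr1.
have r0 w : 0 <= sqnorm (X w) by exact: sqnorm_ge0.
have r1 w : sqnorm (X w) <= d%:R * M ^+ 2 by rewrite sqnorm_le_sup.
by rewrite -(integral_mix P mX XM Hg t0 mS r0 r1).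
Qed.

Lemma fish_fin t : 0 <= t -> fish t \is a fin_num.
Proof.
move=> t0; rewrite ge0_fin_numE ?fish_ge0//.
by rewrite (le_lt_trans (fish_le t0)) ?ltry.
Qed.

Lemma fish0 : fish 0 = (\sum_(i < d) (\int[P]_w tnth (X w) i) ^+ 2)%:E.
Proof.
rewrite -[RHS](integral_prob_cst gam); apply: eq_integral => z _.
rewrite sqrtr0 vscale0 /=; congr EFin; apply: eq_bigr => i _.
rewrite G00 divr1; congr (_ ^+ 2).
by apply: eq_Rintegral => w _; rewrite lik00 mul1r.
Qed.

Lemma ent0 : ent 0 = 1%E.
Proof.
rewrite -[RHS](integral_prob_cst gam); apply: eq_integral => z _.
by rewrite sqrtr0 vscale0 /= G00 ln1 mulr0 addr0.
Qed.

Variables (delta : nat -> R) (dmax : R).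
Hypothesis delta_gt0 : forall k, 0 < delta k.+1.
Hypothesis dmax_ge0 : 0 <= dmax.

Let a k := fine (fish (elapsed delta k)).

(* Each increment is charged to the Fisher information at the end of the step;
   moving it to the beginning costs a telescoping sum. *)
Lemma bounded_ent_le n : (forall k, (k < n)%N -> delta k.+1 <= dmax) ->
  (ent (elapsed delta n) <=
    (1 + dmax / 2 * (\int[P]_w sqnorm (X w) - \sum_(i < d) (\int[P]_w tnth (X w) i) ^+ 2)
     + \sum_(k < n) delta k.+1 / 2 * a k)%:E)%E.
Proof.
move=> dle.
have el0 k : 0 <= elapsed delta k by exact: elapsed_ge0.
have amono k : a k <= a k.+1.
  apply: fine_le; [exact: (fish_fin (el0 _))|exact: (fish_fin (el0 _))|].
  rewrite elapsedS; exact: (fish_mono P mX XM Hg (el0 k) (delta_gt0 k)).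
have inc j : (ent (elapsed delta j.+1) <=
    ent (elapsed delta j) + (delta j.+1 / 2 * a j.+1)%:E)%E.
  rewrite EFinM (fineK (fish_fin (el0 j.+1))) elapsedS.
  exact: (ent_increment (el0 j) (delta_gt0 j)).
have e0 : ent (elapsed delta 0) = 1%E by rewrite elapsed0; exact: ent0.
have an : a n <= \int[P]_w sqnorm (X w).
  by rewrite -lee_fin (fineK (fish_fin (el0 n))); exact: (fish_le (el0 n)).
have a0 : a 0%N = \sum_(i < d) (\int[P]_w tnth (X w) i) ^+ 2.
  by rewrite /a elapsed0 fish0.
apply: (le_trans (telescoped_bound (E := fun k => ent (elapsed delta k)) e0 inc amono dle)).
rewrite lee_fin lerD2r lerD2l ler_wpM2l ?divr_ge0// -a0.
exact: (lerB an (lexx _)).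
Qed.

End bounded_entropy_increment.

(** * Square-integrable hidden variables, by truncation *)

Section square_integrable.
Context {R : realType} {d : nat} {dO : measure_display} {Omega : measurableType dO}.
Local Notation vec := (d.-tuple R).
Variables (P : probability Omega R) (X : Omega -> vec) (gam : probability vec R).
Hypothesis mX : measurable_fun setT X.
Hypothesis iX2 : P.-integrable setT (EFin \o (fun w => sqnorm (X w))).
Hypothesis Hg : std_gaussian gam.
Local Notation G := (G P X).
Local Notation mom := (mom P X).
Local Notation at_ t z := (vscale (Num.sqrt t) z).

Lemma tnth_sqr_le (x : vec) i : tnth x i ^+ 2 <= sqnorm x.
Proof. by rewrite /sqnorm (bigD1 i)//= lerDl; apply: sumr_ge0 => j _; exact: sqr_ge0. Qed.

Lemma abs_tnth_le (x : vec) i : `|tnth x i| <= 1 + sqnorm x.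
Proof.
have := tnth_sqr_le x i; rewrite ler_norml.
have := sqr_ge0 (tnth x i - 1); have := sqr_ge0 (tnth x i + 1).
by rewrite !sqrrD !expr1n; lra.
Qed.

Lemma measurable_coord i : measurable_fun setT (fun w => tnth (X w) i).
Proof. exact: measurable_fun_tnth. Qed.

Lemma integrable_coord_sqr i : P.-integrable setT (EFin \o (fun w => tnth (X w) i ^+ 2)).
Proof.
apply: (@integrable_dominated _ _ _ _ _ (fun w => sqnorm (X w))) => //.
  by apply: measurable_funX; exact: measurable_coord.
by move=> w; rewrite ger0_norm ?sqr_ge0// tnth_sqr_le.
Qed.

Lemma integrable_coord i : P.-integrable setT (EFin \o (fun w => tnth (X w) i)).
Proof.
apply: (@integrable_dominated _ _ _ _ _ (fun w => 1 + sqnorm (X w))) => //.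
- exact: measurable_coord.
- by move=> w; exact: abs_tnth_le.
- apply: integrableDR => //.
  by apply: (@integrable_bounded _ _ _ _ _ 1) => // w; rewrite normr1.
Qed.

(** For [u = sqrt t * x] the exponent [<u, z> - |u|^2 / 2] is at most [|z|^2 / 2]. The bound is
    uniform in [x], so it dominates where the hidden variable is unbounded; this is why positions
    are written as [sqrt t * z]. *)
Lemma lik_at_le (x z : vec) t : 0 <= t -> lik x (at_ t z) t <= expR (sqnorm z / 2).
Proof.
move=> t0; rewrite lik_sqrt// ler_expR; set u := vscale _ _.
have : 0 <= sqnorm (vsub u z) by exact: sqnorm_ge0.
by rewrite !sqnormE dotBl !dotBr (dotC z u); lra.
Qed.

Lemma integral_lik_at (x : vec) t : 0 <= t ->
  (\int[gam]_z (lik x (at_ t z) t)%:E = 1)%E.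
Proof.
move=> t0.
have H := integral_cameron_martin Hg (vscale (Num.sqrt t) x) (measurable_cst 1%E).
rewrite /= integral_prob_cst in H; rewrite H.
by apply: eq_integral => z _; rewrite mul1e lik_sqrt.
Qed.

Lemma measurable_lik_at t z : measurable_fun setT (fun w => lik (X w) (at_ t z) t).
Proof. exact: measurable_fun_lik. Qed.

Lemma integrable_lik_weight (f : Omega -> R) t z : 0 <= t ->
  measurable_fun setT f -> P.-integrable setT (EFin \o f) ->
  P.-integrable setT (EFin \o (fun w => lik (X w) (at_ t z) t * f w)).
Proof.
move=> t0 mf intf.
apply: (@integrable_dominated _ _ _ _ _ (fun w => expR (sqnorm z / 2) * `|f w|)).
- by apply: measurable_funM => //; exact: measurable_lik_at.
- by move=> w; rewrite normrM (ger0_norm (lik_ge0 _ _ _)) ler_wpM2r// lik_at_le.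
- by apply: integrableZR; exact: (integrable_abse intf).
Qed.

Lemma integrable_lik_at t z : 0 <= t ->
  P.-integrable setT (EFin \o (fun w => lik (X w) (at_ t z) t)).
Proof.
move=> t0; apply: (@integrable_bounded _ _ _ _ _ (expR (sqnorm z / 2))).
  exact: measurable_lik_at.
by move=> w; rewrite ger0_norm ?lik_ge0// lik_at_le.
Qed.

(* Jensen's inequality for the exponential. *)
Lemma G_ge t z : 0 <= t ->
  expR (\sum_(i < d) tnth (at_ t z) i * \int[P]_w tnth (X w) i
        - t / 2 * \int[P]_w sqnorm (X w)) <= G t (at_ t z).
Proof.
move=> t0; set c := (X in expR X).
pose u w := \sum_(i < d) tnth (at_ t z) i * tnth (X w) i + - (t / 2) * sqnorm (X w).
have i1 : P.-integrable setT (EFin \o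
    (fun w => \sum_(i < d) tnth (at_ t z) i * tnth (X w) i)).
  by apply: integrable_sumR => i; apply: integrableZR; exact: integrable_coord.
have iu : P.-integrable setT (EFin \o u).
  by apply: integrableDR => //; exact: integrableZR.
have uE : \int[P]_w u w = c.
  rewrite RintegralD//; last exact: integrableZR.
  rewrite RintegralZl// Rintegral_sumR; last first.
    by move=> i; apply: integrableZR; exact: integrable_coord.
  rewrite mulNr; congr (_ - _); apply: eq_bigr => i _.
  by rewrite RintegralZl//; exact: integrable_coord.
have i1c : P.-integrable setT (EFin \o (fun w : Omega => 1 - c)).
  exact: (@integrable_bounded _ _ _ _ _ `|1 - c|).
(* The right-hand side integrates the tangent of the exponential at [c], the mean of the
   exponent. *)
have -> : expR c = \int[P]_w (expR c * ((1 - c) + u w)).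
  rewrite RintegralZl//; last exact: integrableDR.
  by rewrite RintegralD// Rintegral_prob_cst uE subrK mulr1.
apply: le_Rintegral => //.
- by apply: integrableZR; exact: integrableDR.
- exact: integrable_lik_at.
- move=> w _; rewrite (_ : lik _ _ _ = expR c * expR (u w - c)).
    by rewrite ler_pM2l ?expR_gt0// -addrA [- c + _]addrC expR_ge1Dx.
  have ee (a b : R) : expR a * expR (b - a) = expR b by rewrite -expRD addrC subrK.
  rewrite ee /lik /u mulNr; congr expR; congr (_ - _).
  by apply: eq_bigr => i _; rewrite mulrC.
Qed.

Lemma G_gt0 t z : 0 <= t -> 0 < G t (at_ t z).
Proof. by move=> t0; apply: lt_le_trans (G_ge z t0); exact: expR_gt0. Qed.

Lemma G_le t z : 0 <= t -> G t (at_ t z) <= expR (sqnorm z / 2).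
Proof.
move=> t0; rewrite -[leRHS](Rintegral_prob_cst P); apply: le_Rintegral => //.
- exact: integrable_lik_at.
- exact: (@integrable_bounded _ _ _ _ _ `|expR (sqnorm z / 2)|).
- by move=> w _; exact: lik_at_le.
Qed.

Lemma evidence_at t z : 0 <= t -> evidence P X t (at_ t z) = (G t (at_ t z))%:E.
Proof. by move=> t0; rewrite /evidence EFin_Rintegral//; exact: integrable_lik_at. Qed.

(** Unnormalized posterior second moment: an integrable majorant of the Fisher integrand, common to
    [X] and all its truncations. *)
Definition smom t y : R := \int[P]_w (lik (X w) y t * sqnorm (X w)).

Lemma fish_integrand_le t z : 0 <= t ->
  \sum_(i < d) mom t i (at_ t z) ^+ 2 / G t (at_ t z) <= smom t (at_ t z).
Proof.
move=> t0.
have i2 i : P.-integrable setT (EFin \o (fun w => lik (X w) (at_ t z) t * tnth (X w) i ^+ 2)).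
  apply: integrable_lik_weight => //; last exact: integrable_coord_sqr.
  by apply: measurable_funX; exact: measurable_coord.
rewrite (_ : smom _ _ = \sum_(i < d) \int[P]_w (lik (X w) (at_ t z) t * tnth (X w) i ^+ 2)).
  apply: ler_sum => i _; apply: weighted_sqr_le => //.
  - by move=> w; exact: lik_ge0.
  - exact: integrable_lik_at.
  - apply: integrable_lik_weight => //; last exact: integrable_coord.
    exact: measurable_coord.
  - exact: G_gt0.
by rewrite -Rintegral_sumR//; apply: eq_Rintegral => w _; rewrite mulr_sumr.
Qed.

Lemma smom_ge0 t y : 0 <= smom t y.
Proof. by apply: Rintegral_ge0 => w _; rewrite mulr_ge0 ?lik_ge0 ?sqnorm_ge0. Qed.

Lemma measurable_smom t : measurable_fun setT (smom t).
Proof.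
apply: measurableT_comp => //.
apply: (@measurable_ge0_integral_snd _ _ _ _ _ P
  (fun y w => (lik (X w) y t * sqnorm (X w))%:E)).
  apply/measurable_EFinP; apply: measurable_funM.
    by apply: measurable_fun_lik => //; exact: (measurableT_comp mX measurable_snd).
  by apply: measurable_fun_sqnorm; exact: (measurableT_comp mX measurable_snd).
by move=> y w; rewrite lee_fin mulr_ge0 ?lik_ge0 ?sqnorm_ge0.
Qed.

Let mat t : measurable_fun setT (fun z : vec => at_ t z).
Proof. exact: measurable_fun_vscale. Qed.

Lemma integral_smom t : 0 <= t ->
  (\int[gam]_z (smom t (at_ t z))%:E = (\int[P]_w sqnorm (X w))%:E)%E.
Proof.
move=> t0; rewrite -EFin_Rintegral//.
have mS : measurable_fun setT (fun w => sqnorm (X w)) by exact: measurable_fun_sqnorm.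
transitivity (\int[gam]_z \int[P]_w (lik (X w) (at_ t z) t * sqnorm (X w))%:E)%E.
  by apply: eq_integral => z _; rewrite EFin_Rintegral//; exact: integrable_lik_weight.
rewrite (@ge0_fubini _ _ _ _ _ gam P
  (fun z w => (lik (X w) (at_ t z) t * sqnorm (X w))%:E)); last 2 first.
- apply/measurable_EFinP; apply: measurable_funM.
    apply: measurable_fun_lik; first exact: (measurableT_comp mX measurable_snd).
    exact: (measurableT_comp (mat t) measurable_fst).
  exact: (measurableT_comp mS measurable_snd).
- by move=> z w; rewrite lee_fin mulr_ge0 ?lik_ge0 ?sqnorm_ge0.
apply: eq_integral => w _; under eq_integral do rewrite mulrC EFinM.
rewrite ge0_integralZl//.
- by rewrite integral_lik_at// mule1.
- by apply/measurable_EFinP; exact: measurable_fun_lik.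
- by move=> z _; rewrite lee_fin lik_ge0.
- by rewrite lee_fin sqnorm_ge0.
Qed.

(** The weight [1 + sqnorm X + X_i] is nonnegative, so Tonelli's theorem applies to it, and the
    known parts are subtracted. For [t < 0] the square root is [0] and the function is constant. *)
Lemma measurable_mom t i : measurable_fun setT (fun z => mom t i (at_ t z)).
Proof.
pose mp (y : vec) := \int[P]_w (lik (X w) y t * (1 + sqnorm (X w) + tnth (X w) i)).
have mmp : measurable_fun setT mp.
  apply: measurableT_comp => //.
  apply: (@measurable_ge0_integral_snd _ _ _ _ _ P
    (fun y w => (lik (X w) y t * (1 + sqnorm (X w) + tnth (X w) i))%:E)).
    have mXs : measurable_fun setT (fun p : vec * Omega => X p.2).
      exact: (measurableT_comp mX measurable_snd).
    apply/measurable_EFinP; apply: measurable_funM; first exact: measurable_fun_lik.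
    apply: measurable_funD; last exact: measurable_fun_tnth.
    by apply: measurable_funD => //; exact: measurable_fun_sqnorm.
  move=> y w; rewrite lee_fin mulr_ge0 ?lik_ge0//.
  by have := abs_tnth_le (X w) i; rewrite ler_norml => /andP[]; lra.
have mG := measurable_G P mX t.
have [t0|t0] := leP 0 t; last first.
  rewrite (_ : (fun z => _) = fun z => mom t i vzero); first exact: measurable_cst.
  by apply: funext => z; rewrite ler0_sqrtr ?vscale0// ltW.
rewrite (_ : (fun z => _) = fun z => mp (at_ t z) - (G t (at_ t z) + smom t (at_ t z))).
  apply: measurable_funB; first exact: (measurableT_comp mmp (mat t)).
  apply: measurable_funD; first exact: (measurableT_comp mG (mat t)).
  exact: (measurableT_comp (measurable_smom t) (mat t)).
apply: funext => z.
have mS : measurable_fun setT (fun w => sqnorm (X w)) by exact: measurable_fun_sqnorm.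
have i0 := integrable_lik_at z t0.
have i1 := integrable_lik_weight z t0 (measurable_coord i) (integrable_coord i).
have i2 := integrable_lik_weight z t0 mS iX2.
rewrite /mp (_ : (fun w => _) = fun w => (lik (X w) (at_ t z) t +
   lik (X w) (at_ t z) t * sqnorm (X w)) + lik (X w) (at_ t z) t * tnth (X w) i); last first.
  by apply: funext => w; ring.
rewrite RintegralD//; last exact: integrableDR.
by rewrite RintegralD// /G /mom /smom; ring.
Qed.

End square_integrable.

Lemma cvg_sumR {R : realType} (I : Type) (r : seq I) (f : I -> nat -> R) (l : I -> R) :
  (forall i, f i n @[n --> \oo] --> l i) ->
  (\sum_(i <- r) f i n) @[n --> \oo] --> \sum_(i <- r) l i.
Proof.
move=> fl; elim: r => [|i r IH].
  by under eq_fun do rewrite big_nil; rewrite big_nil; exact: cvg_cst.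
by under eq_fun do rewrite big_cons; rewrite big_cons; exact: cvgD.
Qed.

Lemma limn_einf_le {R : realType} (u : (\bar R)^nat) (v : R^nat) (l : R) :
  (forall n, u n <= (v n)%:E)%E -> v n @[n --> \oo] --> l -> (limn_einf u <= l%:E)%E.
Proof.
move=> uv vl; rewrite limn_einf_lim.
have vl' : (v n)%:E @[n --> \oo] --> l%:E.
  by apply/fine_cvgP; split; [exact: nearW|exact: vl].
rewrite -(cvg_lim _ vl')//; apply: lee_lim => //.
- exact: is_cvg_einfs.
- by apply: cvgP vl'.
- apply: nearW => n; apply: (le_trans _ (uv n)).
  by apply: ereal_inf_lbound; exists n => //=.
Qed.

Lemma dominated_cvg_Rintegral {R : realType} (dT : measure_display)
    (T : measurableType dT) (P : probability T R) (f_ : nat -> T -> R) (f g : T -> R) :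
  (forall n, measurable_fun setT (f_ n)) -> measurable_fun setT f ->
  (forall x, f_ n x @[n --> \oo] --> f x) ->
  P.-integrable setT (EFin \o g) -> (forall n x, `|f_ n x| <= g x) ->
  \int[P]_x f_ n x @[n --> \oo] --> \int[P]_x f x.
Proof.
move=> mf_ mf cf ig fg.
have [||||_ _ H] := @dominated_convergence _ _ _ P _ measurableT
   (fun n => EFin \o f_ n) (EFin \o f) (EFin \o g) _ _ _ ig _.
- by move=> n; exact/measurable_EFinP.
- exact/measurable_EFinP.
- by apply: aeW => x _; apply/fine_cvgP; split; [exact: nearW|exact: cf].
- by apply: aeW => x n _; rewrite /= lee_fin.
apply: (@fine_cvg _ _ _ _ (fun n => \int[P]_x (f_ n x)%:E)%E).
rewrite -EFin_Rintegral; first exact: H.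
apply: (integrable_dominated mf _ ig) => x.
have : `|f_ n x| @[n --> \oo] --> `|f x| by exact: cvg_norm (cf x).
by move=> /cvg_lim <-//; apply: limr_le; [exact: (cvgP _ (cvg_norm (cf x)))|exact: nearW].
Qed.

Section truncation.
Context {R : realType} {d : nat} {dO : measure_display} {Omega : measurableType dO}.
Local Notation vec := (d.-tuple R).
Variables (P : probability Omega R) (X : Omega -> vec) (gam : probability vec R).
Hypothesis mX : measurable_fun setT X.
Hypothesis iX2 : P.-integrable setT (EFin \o (fun w => sqnorm (X w))).
Hypothesis Hg : std_gaussian gam.
Local Notation at_ t z := (vscale (Num.sqrt t) z).

Let mat t : measurable_fun setT (fun z : vec => at_ t z).
Proof. exact: measurable_fun_vscale. Qed.

(** Values outside the ball are sent to the origin, so that at each point of the sample space every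
    function of the truncation is eventually constant in [n], with no continuity required. *)
Definition trunc (n : nat) (w : Omega) : vec :=
  if sqnorm (X w) <= n%:R then X w else vzero.

Lemma sqnorm0 : sqnorm (vzero : vec) = 0.
Proof. by rewrite /sqnorm big1// => i _; rewrite tnth_mktuple expr0n. Qed.

Lemma measurable_trunc n : measurable_fun setT (trunc n).
Proof.
apply: measurable_fun_ifT => //.
by apply: measurable_fun_ler => //; exact: measurable_fun_sqnorm.
Qed.

Lemma trunc_sqnorm_le n w : sqnorm (trunc n w) <= sqnorm (X w).
Proof. by rewrite /trunc; case: ifP => // _; rewrite sqnorm0 sqnorm_ge0. Qed.

Lemma trunc_bounded n w i : `|tnth (trunc n w) i| <= 1 + n%:R.
Proof.
apply: (le_trans (abs_tnth_le _ _)); rewrite lerD2l /trunc.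
by case: ifP => // _; rewrite sqnorm0.
Qed.

Lemma trunc_eventually w : \forall n \near \oo, trunc n w = X w.
Proof.
exists (Num.truncn (sqnorm (X w))).+1 => // n /= hn.
rewrite /trunc ifT// (le_trans (ltW (truncnS_gt _)))// ler_nat//.
Qed.

Lemma trunc_cvg (F : vec -> R) w : F (trunc n w) @[n --> \oo] --> F (X w).
Proof.
apply: cvg_near_cst; have := trunc_eventually w.
by apply: filterS => n ->.
Qed.

Lemma integrable_sqnorm_trunc n :
  P.-integrable setT (EFin \o (fun w => sqnorm (trunc n w))).
Proof. exact: (bounded_integrable_sqnorm P (measurable_trunc n) (trunc_bounded n)). Qed.

Let mS : measurable_fun setT (fun w => sqnorm (X w)).
Proof. exact: measurable_fun_sqnorm. Qed.

Lemma cvg_G_trunc t z : 0 <= t ->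
  G P (trunc n) t (at_ t z) @[n --> \oo] --> G P X t (at_ t z).
Proof.
move=> t0; apply: (@dominated_cvg_Rintegral _ _ _ _ _ _ (fun=> expR (sqnorm z / 2))).
- by move=> n; apply: measurable_lik_at; exact: measurable_trunc.
- exact: measurable_lik_at.
- by move=> w; exact: (@trunc_cvg (fun x => lik x (at_ t z) t) w).
- exact: (@integrable_bounded _ _ _ _ _ `|expR (sqnorm z / 2)|).
- by move=> n w; rewrite ger0_norm ?lik_ge0// lik_at_le.
Qed.

Lemma cvg_mom_trunc t i z : 0 <= t ->
  mom P (trunc n) t i (at_ t z) @[n --> \oo] --> mom P X t i (at_ t z).
Proof.
move=> t0; apply: (@dominated_cvg_Rintegral _ _ _ _ _ _
  (fun w => expR (sqnorm z / 2) * (1 + sqnorm (X w)))).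
- move=> n; apply: measurable_funM.
    by apply: measurable_lik_at; exact: measurable_trunc.
  by apply: measurable_fun_tnth; exact: measurable_trunc.
- apply: measurable_funM; first exact: measurable_lik_at.
  exact: measurable_fun_tnth.
- by move=> w; exact: (@trunc_cvg (fun x => lik x (at_ t z) t * tnth x i) w).
- apply: integrableZR; apply: integrableDR => //.
  by apply: (@integrable_bounded _ _ _ _ _ 1) => // w; rewrite normr1.
- move=> n w; rewrite normrM ler_pM//.
    by rewrite ger0_norm ?lik_ge0// lik_at_le.
  by rewrite (le_trans (abs_tnth_le _ _))// lerD2l trunc_sqnorm_le.
Qed.

Lemma cvg_sqnorm_trunc :
  \int[P]_w sqnorm (trunc n w) @[n --> \oo] --> \int[P]_w sqnorm (X w).
Proof.
apply: (@dominated_cvg_Rintegral _ _ _ _ _ _ (fun w => sqnorm (X w))) => //.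
- by move=> n; apply: measurable_fun_sqnorm; exact: measurable_trunc.
- by move=> w; exact: (@trunc_cvg (@sqnorm R d) w).
- by move=> n w; rewrite ger0_norm ?sqnorm_ge0// trunc_sqnorm_le.
Qed.

Lemma cvg_mean_trunc i :
  \int[P]_w tnth (trunc n w) i @[n --> \oo] --> \int[P]_w tnth (X w) i.
Proof.
apply: (@dominated_cvg_Rintegral _ _ _ _ _ _ (fun w => 1 + sqnorm (X w))) => //.
- by move=> n; apply: measurable_fun_tnth; exact: measurable_trunc.
- exact: measurable_fun_tnth.
- by move=> w; exact: (@trunc_cvg (fun x => tnth x i) w).
- apply: integrableDR => //.
  by apply: (@integrable_bounded _ _ _ _ _ 1) => // w; rewrite normr1.
- by move=> n w; rewrite (le_trans (abs_tnth_le _ _))// lerD2l trunc_sqnorm_le.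
Qed.

Lemma smom_trunc_le n t z : 0 <= t ->
  smom P (trunc n) t (at_ t z) <= smom P X t (at_ t z).
Proof.
move=> t0; apply: le_Rintegral => //.
- apply: integrable_lik_weight => //; first exact: measurable_trunc.
    by apply: measurable_fun_sqnorm; exact: measurable_trunc.
  exact: integrable_sqnorm_trunc.
- exact: integrable_lik_weight.
- move=> w _; rewrite /trunc; case: ifP => // _.
  by rewrite sqnorm0 mulr0 mulr_ge0 ?lik_ge0 ?sqnorm_ge0.
Qed.

Let fishI (Z : Omega -> vec) t z := \sum_(i < d) mom P Z t i (at_ t z) ^+ 2 / G P Z t (at_ t z).

Let mfishI (Z : Omega -> vec) t : 0 <= t -> measurable_fun setT Z ->
  P.-integrable setT (EFin \o (fun w => sqnorm (Z w))) -> measurable_fun setT (fishI Z t).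
Proof.
move=> t0 mZ iZ; apply: measurable_sum => i; apply: measurable_funM.
  by apply: measurable_funX; exact: measurable_mom.
apply: measurable_funV_gt0; last by move=> z; exact: G_gt0.
exact: (measurableT_comp (measurable_G P mZ t) (mat t)).
Qed.

Let fishI_ge0 (Z : Omega -> vec) t z : 0 <= t -> measurable_fun setT Z ->
  P.-integrable setT (EFin \o (fun w => sqnorm (Z w))) -> 0 <= fishI Z t z.
Proof.
move=> t0 mZ iZ; apply: sumr_ge0 => i _; rewrite divr_ge0 ?sqr_ge0// ltW//.
exact: G_gt0.
Qed.

Lemma integrable_fish_integrand t : 0 <= t -> gam.-integrable setT (EFin \o fishI X t).
Proof.
move=> t0; apply: (@integrable_dominated _ _ _ _ _ (fun z => smom P X t (at_ t z))).
- exact: mfishI.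
- by move=> z; rewrite ger0_norm ?fishI_ge0//; exact: fish_integrand_le.
- apply/integrableP; split.
    apply/measurable_EFinP.
    exact: (measurableT_comp (measurable_smom P mX t) (mat t)).
  under eq_integral do rewrite /= ger0_norm ?smom_ge0//.
  by rewrite integral_smom// ltry.
Qed.

(** The integrands converge pointwise since the limit of the denominators is positive, and all are
    dominated by [smom] of the untruncated variable, whose integral is the second moment of [X]. *)
Lemma cvg_fish_trunc t : 0 <= t ->
  fine (fish P (trunc n) gam t) @[n --> \oo] --> fine (fish P X gam t).
Proof.
move=> t0.
apply: (@dominated_cvg_Rintegral _ _ _ gam (fun n => fishI (trunc n) t) (fishI X t)
  (fun z => smom P X t (at_ t z))).
- move=> n; apply: mfishI => //; first exact: measurable_trunc.
  exact: integrable_sqnorm_trunc.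
- exact: mfishI.
- move=> z; apply: cvg_sumR => i; apply: cvgM.
    by rewrite /comp; under eq_fun do rewrite expr2; rewrite expr2;
      apply: cvgM; exact: cvg_mom_trunc.
  apply: cvgV; last exact: cvg_G_trunc.
  by rewrite gt_eqF// G_gt0.
- apply/integrableP; split.
    apply/measurable_EFinP.
    exact: (measurableT_comp (measurable_smom P mX t) (mat t)).
  under eq_integral do rewrite /= ger0_norm ?smom_ge0//.
  by rewrite integral_smom// ltry.
- move=> n z.
  have iT := integrable_sqnorm_trunc n; have mT := measurable_trunc n.
  rewrite ger0_norm ?fishI_ge0//.
  exact: (le_trans (fish_integrand_le mT iT z t0) (smom_trunc_le n z t0)).
Qed.

(** Fatou's lemma applies because [1 + r ln r >= r], by [xlnx_ge]; pointwise convergence uses the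
    continuity of the logarithm at the positive limit. *)
Lemma ent_le_liminf t : 0 <= t ->
  (ent P X gam t <= limn_einf (fun n => ent P (trunc n) gam t))%E.
Proof.
move=> t0.
pose I (Z : Omega -> vec) z := (1 + G P Z t (at_ t z) * ln (G P Z t (at_ t z)))%:E.
have mI (Z : Omega -> vec) : measurable_fun setT Z -> measurable_fun setT (I Z).
  move=> mZ; have mG : measurable_fun setT (fun z => G P Z t (at_ t z)).
    exact: (measurableT_comp (measurable_G P mZ t) (mat t)).
  apply/measurable_EFinP; apply: measurable_funD => //; apply: measurable_funM => //.
  exact: measurableT_comp.
have I0 (Z : Omega -> vec) z : measurable_fun setT Z ->
    P.-integrable setT (EFin \o (fun w => sqnorm (Z w))) -> (0 <= I Z z)%E.
  move=> mZ iZ; rewrite lee_fin; have G0 := G_gt0 mZ iZ z t0.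
  by have := xlnx_ge G0; lra.
have /le_trans : (ent P X gam t <= \int[gam]_z limn_einf (fun n => I (trunc n) z))%E.
  rewrite le_eqVlt; apply/orP; left; apply/eqP; apply: eq_integral => z _.
  apply/esym; apply: (cvg_limn_einf_sup _).1.
  apply/fine_cvgP; split; first exact: nearW.
  apply: cvgD; first exact: cvg_cst.
  apply: cvgM; first exact: cvg_G_trunc.
  apply: (cvg_comp (fun n => G P (trunc n) t (at_ t z)) (@ln R)); first exact: cvg_G_trunc.
  by apply: continuous_ln; exact: G_gt0.
apply; apply: fatou => //.
- by move=> n; apply: mI; exact: measurable_trunc.
- by move=> n z _; apply: I0; [exact: measurable_trunc|exact: integrable_sqnorm_trunc].
Qed.

Variables (delta : nat -> R) (dmax : R).
Hypothesis delta_gt0 : forall k, 0 < delta k.+1.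
Hypothesis dmax_ge0 : 0 <= dmax.

Lemma ent_le n : (forall k, (k < n)%N -> delta k.+1 <= dmax) ->
  (ent P X gam (elapsed delta n) <=
    (1 + dmax / 2 * (\int[P]_w sqnorm (X w) - \sum_(i < d) (\int[P]_w tnth (X w) i) ^+ 2)
     + \sum_(k < n) delta k.+1 / 2 * fine (fish P X gam (elapsed delta k)))%:E)%E.
Proof.
move=> dle.
have el0 k : 0 <= elapsed delta k by exact: elapsed_ge0.
apply: (le_trans (ent_le_liminf (el0 n))).
pose b (Z : Omega -> vec) : R :=
  1 + dmax / 2 * (\int[P]_w sqnorm (Z w) - \sum_(i < d) (\int[P]_w tnth (Z w) i) ^+ 2)
     + \sum_(k < n) delta k.+1 / 2 * fine (fish P Z gam (elapsed delta k)).
have cb : b (trunc m) @[m --> \oo] --> b X.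
  apply: cvgD.
    apply: cvgD; first exact: cvg_cst.
    apply: cvgM; first exact: cvg_cst.
    apply: cvgB; first exact: cvg_sqnorm_trunc.
    apply: cvg_sumR => i.
    by under eq_fun do rewrite expr2; rewrite expr2; apply: cvgM; exact: cvg_mean_trunc.
  apply: cvg_sumR => k; apply: cvgM; first exact: cvg_cst.
  exact: cvg_fish_trunc.
apply: (limn_einf_le _ cb) => m.
exact: (bounded_ent_le P (measurable_trunc m) (trunc_bounded m) Hg delta_gt0 dmax_ge0 dle).
Qed.

End truncation.

(** * The posterior mean as a conditional expectation *)

Section products_of_square_integrable.
Context {R : realType} {dT : measure_display} {T : measurableType dT}.
Variable P : probability T R.
Implicit Types U V : T -> R.

Lemma integrable_mulR U V : measurable_fun setT U -> measurable_fun setT V ->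
  P.-integrable setT (EFin \o (fun w => U w ^+ 2)) ->
  P.-integrable setT (EFin \o (fun w => V w ^+ 2)) ->
  P.-integrable setT (EFin \o (fun w => U w * V w)).
Proof.
move=> mU mV iU iV.
apply: (@integrable_dominated _ _ _ _ _ (fun w => U w ^+ 2 + V w ^+ 2)).
- exact: measurable_funM.
- move=> w; rewrite ler_norml.
  have := sqr_ge0 (U w + V w); have := sqr_ge0 (U w - V w).
  by have := sqr_ge0 (U w); have := sqr_ge0 (V w); rewrite !expr2; lra.
- exact: integrableDR.
Qed.

Lemma integrable_sqrD U V : measurable_fun setT U -> measurable_fun setT V ->
  P.-integrable setT (EFin \o (fun w => U w ^+ 2)) ->
  P.-integrable setT (EFin \o (fun w => V w ^+ 2)) ->
  P.-integrable setT (EFin \o (fun w => (U w + V w) ^+ 2)).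
Proof.
move=> mU mV iU iV.
apply: (@integrable_dominated _ _ _ _ _ (fun w => 2 * (U w ^+ 2 + V w ^+ 2))).
- by apply: measurable_funX; exact: measurable_funD.
- move=> w; rewrite ger0_norm ?sqr_ge0//.
  by have := sqr_ge0 (U w - V w); rewrite !expr2; lra.
- by apply: integrableZR; exact: integrableDR.
Qed.

Lemma integrable_sqrZ (a : R) U :
  P.-integrable setT (EFin \o (fun w => U w ^+ 2)) ->
  P.-integrable setT (EFin \o (fun w => (a * U w) ^+ 2)).
Proof.
move=> iU; rewrite (_ : _ \o _ = EFin \o (fun w => a ^+ 2 * U w ^+ 2)).
  exact: integrableZR.
by apply: funext => w /=; rewrite exprMn.
Qed.

Lemma integrable_of_sqr U : measurable_fun setT U ->
  P.-integrable setT (EFin \o (fun w => U w ^+ 2)) -> P.-integrable setT (EFin \o U).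
Proof.
move=> mU iU; rewrite (_ : _ \o _ = EFin \o (fun w => U w * 1)).
  apply: integrable_mulR => //.
  by apply: (@integrable_bounded _ _ _ _ _ 1) => // w; rewrite expr1n normr1.
by apply: funext => w /=; rewrite mulr1.
Qed.

End products_of_square_integrable.

Section posterior_mean.
Context {R : realType} {d : nat} {dO : measure_display} {Omega : measurableType dO}.
Local Notation vec := (d.-tuple R).
Variables (P : probability Omega R) (X : Omega -> vec) (N : nat -> Omega -> vec).
Variables (delta : nat -> R) (gam : probability vec R).
Hypotheses (mX : measurable_fun setT X) (mN : forall k, measurable_fun setT (N k)).
Hypothesis delta_gt0 : forall k, 0 < delta k.+1.
Hypothesis Hg : std_gaussian gam.
Hypothesis Hiid : iid_std_gaussian_indep_of P X N.
Hypothesis iX2 : P.-integrable setT (EFin \o (fun w => sqnorm (X w))).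
Local Notation Y := (Yproc delta X N).
Local Notation at_ t z := (vscale (Num.sqrt t) z).
Local Notation el := (elapsed delta).
Variable k : nat.
Let t := el k.
Let t0 : 0 <= t. Proof. exact: elapsed_ge0. Qed.
Let mY : measurable_fun setT (Y k).
Proof. exact: (measurable_Y delta mX mN). Qed.
Let mat : measurable_fun setT (fun z : vec => at_ t z).
Proof. exact: measurable_fun_vscale. Qed.
Local Notation ww := (fun p : Omega * vec => lik (X p.1) (at_ t p.2) t).

Let mww : measurable_fun setT ww.
Proof.
apply: measurable_fun_lik; first exact: (measurableT_comp mX measurable_fst).
exact: (measurableT_comp mat measurable_snd).
Qed.

(** Extends [ge0_expect_comparison] to signed integrands: nonnegative indicators suffice to identify
    the joint law of [X] and [Y k]. *)
Lemma integral_joint (psi : vec * vec -> \bar R) : measurable_fun setT psi ->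
  (\int[P]_w psi (X w, Y k w)
   = \int[(P \x gam)%E]_p (psi (X p.1, at_ t p.2) * (ww p)%:E))%E.
Proof.
move=> mpsi.
transitivity (\int[P]_w (psi (X w, Y k w) * (cst 1 w)%:E))%E.
  by apply: eq_integral => w _; rewrite mule1.
have mV2 : measurable_fun setT (fun p : Omega * vec => (X p.1, at_ t p.2)).
  apply: measurable_fun_pair; first exact: (measurableT_comp mX measurable_fst).
  exact: (measurableT_comp mat measurable_snd).
apply: (@eq_integral_weight _ _ _ _ _ _ _ P (P \x gam)%E (fun w => (X w, Y k w))
  (fun p => (X p.1, at_ t p.2)) (cst 1) ww) => //.
- exact: measurable_fun_pair.
- by move=> p; exact: lik_ge0.
move=> B mB.
rewrite fubini_tonelli1; last 2 first.
- apply/measurable_EFinP; apply: measurable_funM => //.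
  by apply: measurableT_comp => //; exact: measurable_indic.
- by move=> p; rewrite lee_fin mulr_ge0// lik_ge0.
under eq_integral do rewrite mulr1.
rewrite (@ge0_expect_comparison _ _ _ _ P X N delta gam mX mN delta_gt0 Hg Hiid k
  (fun x y => (\1_B (x, y))%:E)).
- by apply: eq_integral => w _; apply: eq_integral => z _; rewrite /= EFinM.
- apply/measurable_EFinP.
  rewrite (_ : (fun p : vec * vec => _) = \1_B); first exact: measurable_indic.
  by apply: funext => -[].
- by move=> x y; rewrite lee_fin.
Qed.

Lemma integral_marginal (psi : vec -> \bar R) : measurable_fun setT psi ->
  (\int[P]_w psi (Y k w) = \int[gam]_z (psi (at_ t z) * (G P X t (at_ t z))%:E))%E.
Proof.
move=> mpsi.
transitivity (\int[P]_w (psi (Y k w) * (cst 1 w)%:E))%E.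
  by apply: eq_integral => w _; rewrite mule1.
have mG : measurable_fun setT (fun z => G P X t (at_ t z)).
  exact: (measurableT_comp (measurable_G P mX t) mat).
apply: (@eq_integral_weight _ _ _ _ _ _ _ P gam (Y k) (fun z => at_ t z) (cst 1)
  (fun z => G P X t (at_ t z))) => //.
- by move=> z; rewrite ltW// G_gt0.
move=> B mB; under eq_integral do rewrite mulr1.
rewrite (@ge0_expect_comparison _ _ _ _ P X N delta gam mX mN delta_gt0 Hg Hiid k
  (fun x y => (\1_B y)%:E)); last 2 first.
- by apply/measurable_EFinP; apply: measurableT_comp => //; exact: measurable_indic.
- by move=> x y; rewrite lee_fin.
rewrite (@ge0_fubini _ _ _ _ _ P gam (fun w z =>
   (\1_B (at_ t z))%:E * (lik (X w) (at_ t z) t)%:E)%E); last 2 first.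
- apply: emeasurable_funM; apply/measurable_EFinP => //.
  apply: measurableT_comp; first exact: measurable_indic.
  exact: (measurableT_comp mat measurable_snd).
- by move=> w z; rewrite mule_ge0// lee_fin lik_ge0.
apply: eq_integral => z _; rewrite ge0_integralZl//.
- by rewrite EFin_Rintegral//; exact: integrable_lik_at.
- by apply/measurable_EFinP; exact: measurable_lik_at.
- by move=> w _; rewrite lee_fin lik_ge0.
Qed.

Lemma integrable_marginal (psi : vec -> R) : measurable_fun setT psi ->
  P.-integrable setT (EFin \o (fun w => psi (Y k w))) ->
  gam.-integrable setT (EFin \o (fun z => psi (at_ t z) * G P X t (at_ t z))).
Proof.
move=> mpsi /integrableP[_ ipsi]; apply/integrableP; split.
  apply/measurable_EFinP; apply: measurable_funM; first exact: measurableT_comp.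
  exact: (measurableT_comp (measurable_G P mX t) mat).
rewrite (@integral_marginal (fun y => `|(psi y)%:E|%E)) in ipsi; last first.
  by apply: measurableT_comp => //; exact/measurable_EFinP.
apply: le_lt_trans ipsi; rewrite le_eqVlt; apply/orP; left; apply/eqP.
apply: eq_integral => z _ /=; rewrite normrM EFinM; congr (_ * _%:E)%E.
by rewrite gtr0_norm// G_gt0.
Qed.

(* The inner rescaling makes the definition measurable also at time [0], where
   only the value at the origin matters. *)
Definition hhat (y : vec) : vec :=
  let y' := at_ t (vscale (Num.sqrt t)^-1 y) in
  [tuple mom P X t i y' / G P X t y' | i < d].

Lemma hhat_at z i : tnth (hhat (at_ t z)) i = mom P X t i (at_ t z) / G P X t (at_ t z).
Proof.
rewrite tnth_mktuple; suff -> : at_ t (vscale (Num.sqrt t)^-1 (at_ t z)) = at_ t z by [].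
rewrite !vscaleA; have [->|s0] := eqVneq (Num.sqrt t) 0; first by rewrite !mul0r.
by rewrite divff// mul1r.
Qed.

Lemma measurable_hhat : measurable_fun setT hhat.
Proof.
apply/measurable_fun_tnthP => i; rewrite /comp /=.
under eq_fun do rewrite tnth_mktuple.
have msc : measurable_fun setT (fun y : vec => vscale (Num.sqrt t)^-1 y).
  exact: measurable_fun_vscale.
apply: measurable_funM.
  exact: (measurableT_comp (measurable_mom mX iX2 t i) msc).
apply: measurable_funV_gt0; last by move=> y; exact: G_gt0.
exact: (measurableT_comp (measurable_G P mX t) (measurableT_comp mat msc)).
Qed.

Let mhi i : measurable_fun setT (fun y => tnth (hhat y) i).
Proof. by apply: measurable_fun_tnth; exact: measurable_hhat. Qed.

Lemma integral_sqnorm_hhat :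
  (\int[P]_w (sqnorm (hhat (Y k w)))%:E = fish P X gam t)%E.
Proof.
rewrite (@integral_marginal (fun y => (sqnorm (hhat y))%:E)); last first.
  by apply/measurable_EFinP; apply: measurable_fun_sqnorm; exact: measurable_hhat.
apply: eq_integral => z _; rewrite -EFinM; congr EFin.
rewrite /sqnorm mulr_suml; apply: eq_bigr => i _; rewrite hhat_at.
have := G_gt0 mX iX2 z t0; move: (G _ _ _ _) => g g0.
by field; rewrite gt_eqF.
Qed.

Lemma integrable_sqnorm_hhat :
  P.-integrable setT (EFin \o (fun w => sqnorm (hhat (Y k w)))).
Proof.
apply/integrableP; split.
  apply/measurable_EFinP; apply: measurable_fun_sqnorm.
  exact: (measurableT_comp measurable_hhat mY).
under eq_integral do rewrite /= ger0_norm ?sqnorm_ge0//.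
rewrite integral_sqnorm_hhat.
have /integrableP[_] := integrable_fish_integrand mX iX2 Hg t0.
apply: le_lt_trans; apply: ge0_le_integral => //.
- move=> z _; rewrite lee_fin; apply: sumr_ge0 => i _; rewrite divr_ge0 ?sqr_ge0//.
  by rewrite ltW// G_gt0.
- apply/measurable_EFinP; apply: measurable_sum => i; apply: measurable_funM.
    by apply: measurable_funX; exact: measurable_mom.
  apply: measurable_funV_gt0; last by move=> z; exact: G_gt0.
  exact: (measurableT_comp (measurable_G P mX t) mat).
- apply: measurableT_comp => //.
  by have /measurable_int := integrable_fish_integrand mX iX2 Hg t0.
- by move=> z _; rewrite /= lee_fin ler_norm.
Qed.

Lemma integrable_hhat_sqr i :
  P.-integrable setT (EFin \o (fun w => tnth (hhat (Y k w)) i ^+ 2)).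
Proof.
apply: (@integrable_dominated _ _ _ _ _ (fun w => sqnorm (hhat (Y k w)))).
- by apply: measurable_funX; exact: (measurableT_comp (mhi i) mY).
- by move=> w; rewrite ger0_norm ?sqr_ge0// tnth_sqr_le.
- exact: integrable_sqnorm_hhat.
Qed.

(* [hhat] is the posterior mean of [X] given [Y k]. *)
Lemma Rintegral_hhat (phi : vec -> R) i : measurable_fun setT phi ->
  P.-integrable setT (EFin \o (fun w => phi (Y k w) ^+ 2)) ->
  \int[P]_w (phi (Y k w) * tnth (X w) i) = \int[P]_w (phi (Y k w) * tnth (hhat (Y k w)) i).
Proof.
move=> mphi iphi.
have mpY : measurable_fun setT (fun w => phi (Y k w)) by exact: measurableT_comp.
have iX : P.-integrable setT (EFin \o (fun w => phi (Y k w) * tnth (X w) i)).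
  apply: integrable_mulR => //; first exact: measurable_coord.
  exact: integrable_coord_sqr.
apply: EFin_inj; rewrite -!EFin_Rintegral//; last first.
  apply: integrable_mulR => //; last exact: integrable_hhat_sqr.
  exact: (measurableT_comp (mhi i) mY).
pose psi (p : vec * vec) := (phi p.2 * tnth p.1 i)%:E.
have mpsi : measurable_fun setT psi.
  apply/measurable_EFinP; apply: measurable_funM; first exact: (measurableT_comp mphi measurable_snd).
  by apply: measurable_fun_tnth; exact: measurable_fst.
pose F (p : Omega * vec) := (psi (X p.1, at_ t p.2) * (ww p)%:E)%E.
have mF : measurable_fun setT F.
  apply: emeasurable_funM; last exact/measurable_EFinP.
  apply: (measurableT_comp mpsi); apply: measurable_fun_pair.
    exact: (measurableT_comp mX measurable_fst).
  exact: (measurableT_comp mat measurable_snd).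
have iF : (P \x gam)%E.-integrable setT F.
  apply/integrableP; split => //.
  have /integrableP[_] := iX.
  rewrite (@integral_joint (fun p => `|psi p|%E)); last exact: measurableT_comp.
  apply: le_lt_trans; rewrite le_eqVlt; apply/orP; left; apply/eqP.
  apply: eq_integral => p _; rewrite /F abseM; congr (_ * _)%E.
  by rewrite /= gtr0_norm// lik_gt0.
rewrite (integral_joint mpsi) -(integral21_prod_meas1 iF).
rewrite (@integral_marginal (fun y => (phi y * tnth (hhat y) i)%:E)); last first.
  by apply/measurable_EFinP; exact: measurable_funM.
apply: eq_integral => z _; rewrite /fubini_G /F /psi /=.
rewrite hhat_at -EFinM.
have -> : phi (at_ t z) * (mom P X t i (at_ t z) / G P X t (at_ t z)) * G P X t (at_ t z)
   = phi (at_ t z) * mom P X t i (at_ t z).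
  by rewrite -!mulrA mulVf ?mulr1// gt_eqF// G_gt0.
have im := integrable_lik_weight mX z t0 (measurable_coord mX i) (integrable_coord mX iX2 i).
rewrite -RintegralZl// -EFin_Rintegral; last exact: integrableZR.
by apply: eq_integral => w _; rewrite -EFinM; congr EFin; ring.
Qed.

(** Over every event [Y k] in [E], [h] and [hhat] have the same integral as [X]. Hence they agree
    almost everywhere for the law of [Y k], and the exceptional set is pulled back to the sample
    space. *)
Lemma cond_exp_ae_hhat (h : vec -> vec) : cond_exp_version P X (Y k) h ->
  {ae P, forall w, h (Y k w) = hhat (Y k w)}.
Proof.
move=> [mh [ih Hh]].
suff H i : {ae P, forall w, tnth (h (Y k w)) i = tnth (hhat (Y k w)) i}.
  have : {ae P, forall w, forall i, tnth (h (Y k w)) i = tnth (hhat (Y k w)) i}.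
    exact: (filter_forall (f := fun i w => tnth (h (Y k w)) i = tnth (hhat (Y k w)) i) _ H).
  by apply: filterS => w Hw; exact: eq_from_tnth.
have mhi' : measurable_fun setT (fun y => tnth (h y) i) by exact: measurable_fun_tnth.
have [A [mA A0 sA]] : ae_eq (dist P mY) setT (EFin \o (fun y => tnth (h y) i))
    (EFin \o (fun y => tnth (hhat y) i)).
  apply: integral_ae_eq => //.
  - apply/integrableP; split; first exact/measurable_EFinP.
    rewrite (@ge0_integral_dist _ _ _ _ _ _ _ mY (fun y => `|(tnth (h y) i)%:E|%E)) //.
      by have /integrableP[] := ih i.
    by apply: measurableT_comp => //; exact/measurable_EFinP.
  - exact/measurable_EFinP.
  - move=> E _ mE.
    have mi : measurable_fun setT (fun w => \1_E (Y k w) : R).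
      by apply: measurableT_comp => //; exact: measurable_indic.
    have ii : P.-integrable setT (EFin \o (fun w => (\1_E (Y k w) : R) ^+ 2)).
      apply: (@integrable_bounded _ _ _ _ _ 1) => [|w]; first exact: measurable_funX.
      by rewrite indicE; case: (_ \in _); rewrite /= ?expr1n ?expr0n/= ?normr1 ?normr0.
    have E1 (U : Omega -> R) : P.-integrable setT (EFin \o (fun w => \1_E (Y k w) * U w)) ->
        (\int[P]_(w in Y k @^-1` E) (U w)%:E = (\int[P]_w (\1_E (Y k w) * U w)%R)%:E)%E.
      move=> iU; rewrite -EFin_Rintegral// [LHS]integral_mkcond; apply: eq_integral => w _.
      by rewrite epatch_indic /= -EFinM mulrC.
    have mYE : measurable (Y k @^-1` E) by rewrite -[X in measurable X]setTI; exact: mY.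
    have iXi : P.-integrable setT (EFin \o (fun w => \1_E (Y k w) * tnth (X w) i)).
      apply: integrable_mulR => //; first exact: measurable_coord.
      exact: integrable_coord_sqr.
    have ihh : P.-integrable setT (EFin \o (fun w => \1_E (Y k w) * tnth (hhat (Y k w)) i)).
      apply: integrable_mulR => //; last exact: integrable_hhat_sqr.
      exact: (measurableT_comp (mhi i) mY).
    transitivity (\int[P]_(w in Y k @^-1` E) (tnth (h (Y k w)) i)%:E)%E.
      apply: (@integral_pushforward _ _ _ _ _ (Y k) mY P E (fun y => (tnth (h y) i)%:E)) => //.
      - exact/measurable_EFinP.
      - exact: (integrableS measurableT mYE (@subsetT _ _) (ih i)).
    have mE1 : measurable_fun setT (\1_E : vec -> R) by exact: measurable_indic.
    rewrite -Hh// E1// (@Rintegral_hhat (\1_E) i mE1 ii) -E1//; apply/esym.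
    apply: (@integral_pushforward _ _ _ _ _ (Y k) mY P E (fun y => (tnth (hhat y) i)%:E)) => //.
    - exact/measurable_EFinP.
    - apply: (integrableS measurableT mYE (@subsetT _ _)).
      apply: (@integrable_of_sqr _ _ _ P (fun w => tnth (hhat (Y k w)) i)).
        exact: (measurableT_comp (mhi i) mY).
      exact: integrable_hhat_sqr.
exists (Y k @^-1` A); split.
- by rewrite -[X in measurable X]setTI; exact: mY.
- exact: A0.
- by move=> w Hw; apply: sA => /= H2; apply: Hw; have [] := H2 I.
Qed.

End posterior_mean.

(** * Moments along the comparison process *)

Section linear_combinations.
Context {R : realType} {dT : measure_display} {T : measurableType dT}.
Variable P : probability T R.
Variables (U V W : T -> R) (a b c : R).
Hypothesis iU : P.-integrable setT (EFin \o U).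
Hypothesis iV : P.-integrable setT (EFin \o V).
Hypothesis iW : P.-integrable setT (EFin \o W).

Lemma integrable_lin3 :
  P.-integrable setT (EFin \o (fun w => a * U w + b * V w + c * W w)).
Proof.
by apply: (@integrableDR _ _ _ P (fun w => a * U w + b * V w) (fun w => c * W w));
  [apply: (@integrableDR _ _ _ P (fun w => a * U w) (fun w => b * V w))|]; exact: integrableZR.
Qed.

Lemma Rintegral_lin3 : \int[P]_w (a * U w + b * V w + c * W w)
  = a * \int[P]_w U w + b * \int[P]_w V w + c * \int[P]_w W w.
Proof.
have ia := integrableZR a iU; have ib := integrableZR b iV; have ic := integrableZR c iW.
rewrite RintegralD//; last exact: integrableDR.
by rewrite RintegralD// !RintegralZl.
Qed.

End linear_combinations.

Section comparison_moments.
Context {R : realType} {d : nat} {dO : measure_display} {Omega : measurableType dO}.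
Local Notation vec := (d.-tuple R).
Variables (P : probability Omega R) (X : Omega -> vec) (N : nat -> Omega -> vec).
Variables (delta : nat -> R) (gam : probability vec R).
Hypotheses (mX : measurable_fun setT X) (mN : forall k, measurable_fun setT (N k)).
Hypothesis delta_gt0 : forall k, 0 < delta k.+1.
Hypothesis Hg : std_gaussian gam.
Hypothesis Hiid : iid_std_gaussian_indep_of P X N.
Hypothesis iX2 : P.-integrable setT (EFin \o (fun w => sqnorm (X w))).
Local Notation Y := (Yproc delta X N).
Local Notation at_ t z := (vscale (Num.sqrt t) z).
Local Notation el := (elapsed delta).
Local Notation hh k := (hhat P X delta k).

Let mY k : measurable_fun setT (Y k).
Proof. exact: (measurable_Y delta mX mN). Qed.

Lemma trace_covE : trace_cov P X
  = (\int[P]_w sqnorm (X w) - \sum_(i < d) (\int[P]_w tnth (X w) i) ^+ 2)%:E.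
Proof.
have i1 : P.-integrable setT (EFin \o (fun=> 1)).
  by apply: (@integrable_bounded _ _ _ _ _ 1) => // w; rewrite normr1.
rewrite /trace_cov /sqnorm Rintegral_sumR; last by move=> i; exact: integrable_coord_sqr.
rewrite -sumrB -sumEFin; apply: eq_bigr => i _; rewrite /expect.
rewrite -[fine _]/(\int[P]_w tnth (X w) i); set m := \int[P]_w tnth (X w) i.
have i2 := integrable_coord_sqr mX iX2 i; have i3 := integrable_coord mX iX2 i.
transitivity (\int[P]_w (1 * tnth (X w) i ^+ 2 + (- 2 * m) * tnth (X w) i + m ^+ 2 * 1)%:E)%E.
  by apply: eq_integral => w _; congr EFin; ring.
rewrite EFin_Rintegral; last exact: integrable_lin3.
by rewrite Rintegral_lin3// Rintegral_prob_cst -/m; congr EFin; ring.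
Qed.

Lemma past_Y k A : measurable A -> <<s past X N k >> (Y k @^-1` A).
Proof.
move=> mA.
have mS := @measurable_gproc R d delta (fun (_ : nat) (x _ : vec) => x) (@mydrift R d) _
  (g_sigma_algebraType (past X N k)) X N k (@measurable_past_X _ _ _ _ X N k)
  (fun j => @measurable_past_N _ _ _ _ X N k j).
have := mS measurableT A mA; rewrite setTI.
rewrite (_ : Y k = gproc delta (fun (_ : nat) (x _ : vec) => x) X N k)//.
by apply: funext => w; exact: YprocE.
Qed.

(** The next noise vector may be replaced by an independent Gaussian coordinate, also for signed
    integrands. *)
Lemma integral_noise k (psi : vec * vec -> \bar R) : measurable_fun setT psi ->
  (\int[P]_w psi (Y k w, N k.+1 w) = \int[(P \x gam)%E]_p psi (Y k p.1, p.2))%E.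
Proof.
move=> mpsi.
have mV1 : measurable_fun setT (fun w => (Y k w, N k.+1 w)) by exact: measurable_fun_pair.
have mV2 : measurable_fun setT (fun p : Omega * vec => (Y k p.1, p.2)).
  by apply: measurable_fun_pair => //; exact: (measurableT_comp (mY k) measurable_fst).
transitivity (\int[P]_w (psi (Y k w, N k.+1 w) * (cst 1 w)%:E))%E.
  by apply: eq_integral => w _; rewrite mule1.
transitivity (\int[(P \x gam)%E]_p (psi (Y k p.1, p.2) * (cst 1 p)%:E))%E; last first.
  by apply: eq_integral => w _; rewrite mule1.
apply: (@eq_integral_weight _ _ _ _ _ _ _ P (P \x gam)%E (fun w => (Y k w, N k.+1 w))
  (fun p => (Y k p.1, p.2)) (cst 1) (cst 1)) => //.
move=> B mB; rewrite fubini_tonelli1; last 2 first.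
- apply/measurable_EFinP; apply: measurable_funM => //.
  by apply: measurableT_comp => //; exact: measurable_indic.
- by move=> p; rewrite lee_fin mulr_ge0.
rewrite (@ge0_integral_fresh _ _ _ _ P X N gam mX mN Hiid Hg _ _ k (Y k)
  (fun y z => (\1_B (y, z) * 1)%:E))//.
- by move=> A; exact: past_Y.
- apply/measurable_EFinP; apply: measurable_funM => //.
  rewrite (_ : (fun p : vec * vec => _) = \1_B); first exact: measurable_indic.
  by apply: funext => -[].
Qed.

Lemma integrable_noise_sqr k i :
  P.-integrable setT (EFin \o (fun w => tnth (N k.+1 w) i ^+ 2)).
Proof.
apply/integrableP; split.
  by apply/measurable_EFinP; apply: measurable_funX; exact: measurable_fun_tnth.
have /integrableP[_] := integrable_tnth_sqr Hg i.
apply: le_lt_trans; rewrite le_eqVlt; apply/orP; left; apply/eqP.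
have mabs : measurable_fun setT (fun z : vec => `|(tnth z i ^+ 2)%:E|%E).
  apply: measurableT_comp => //; apply/measurable_EFinP; apply: measurable_funX.
  exact: measurable_tnth.
rewrite (@integral_noise k (fun p => `|(tnth p.2 i ^+ 2)%:E|%E)); last first.
  exact: (measurableT_comp mabs measurable_snd).
rewrite fubini_tonelli1//; last exact: (measurableT_comp mabs measurable_snd).
by rewrite /fubini_F /= integral_prob_cst.
Qed.

(* The fresh noise is centred and independent of the current position. *)
Lemma Rintegral_noise k (phi : vec -> R) i : measurable_fun setT phi ->
  P.-integrable setT (EFin \o (fun w => phi (Y k w) ^+ 2)) ->
  \int[P]_w (phi (Y k w) * tnth (N k.+1 w) i) = 0.
Proof.
move=> mphi iphi.
have mpY : measurable_fun setT (fun w => phi (Y k w)) by exact: measurableT_comp.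
have iN : P.-integrable setT (EFin \o (fun w => phi (Y k w) * tnth (N k.+1 w) i)).
  apply: integrable_mulR => //; first exact: measurable_fun_tnth.
  exact: integrable_noise_sqr.
apply: EFin_inj; rewrite -EFin_Rintegral//.
pose psi (p : vec * vec) := (phi p.1 * tnth p.2 i)%:E.
have mpsi : measurable_fun setT psi.
  apply/measurable_EFinP; apply: measurable_funM; first exact: (measurableT_comp mphi measurable_fst).
  by apply: measurable_fun_tnth; exact: measurable_snd.
pose F (p : Omega * vec) := psi (Y k p.1, p.2).
have mF : measurable_fun setT F.
  apply: (measurableT_comp mpsi); apply: measurable_fun_pair => //.
  exact: (measurableT_comp (mY k) measurable_fst).
have iF : (P \x gam)%E.-integrable setT F.
  apply/integrableP; split => //.
  have /integrableP[_] := iN.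
  by rewrite (@integral_noise k (fun p => `|psi p|%E))//; exact: measurableT_comp.
rewrite (@integral_noise k psi mpsi) -(integral12_prod_meas1 iF).
rewrite -[RHS](integral_prob_cst P); apply: eq_integral => w _.
rewrite /fubini_F /F /psi /= EFin_Rintegral; last by apply: integrableZR; exact: integrable_tnth.
by rewrite RintegralZl ?gauss_mean0 ?mulr0//; exact: integrable_tnth.
Qed.

Lemma integrable_Y_sqr k i : P.-integrable setT (EFin \o (fun w => tnth (Y k w) i ^+ 2)).
Proof.
elim: k => [|k IH].
  rewrite (_ : _ \o _ = EFin \o (fun=> 0)).
    by apply: (@integrable_bounded _ _ _ _ _ 0) => // w; rewrite normr0.
  by apply: funext => w /=; rewrite tnth_mktuple expr0n.
rewrite (_ : _ \o _ = EFin \o (fun w => (tnth (Y k w) i + delta k.+1 * tnth (X w) i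
    + Num.sqrt (delta k.+1) * tnth (N k.+1 w) i) ^+ 2)); last first.
  by apply: funext => w /=; rewrite !tnth_mktuple.
have m1 : measurable_fun setT (fun w => tnth (Y k w) i) by exact: measurable_fun_tnth.
have m2 : measurable_fun setT (fun w => delta k.+1 * tnth (X w) i).
  by apply: measurable_funM => //; exact: measurable_fun_tnth.
have m3 : measurable_fun setT (fun w => Num.sqrt (delta k.+1) * tnth (N k.+1 w) i).
  by apply: measurable_funM => //; exact: measurable_fun_tnth.
apply: (@integrable_sqrD _ _ _ P (fun w => tnth (Y k w) i + delta k.+1 * tnth (X w) i)) => //.
- exact: measurable_funD.
- apply: integrable_sqrD => //; apply: integrable_sqrZ; exact: integrable_coord_sqr.
- by apply: integrable_sqrZ; exact: integrable_noise_sqr.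
Qed.

Lemma at_scale t (y : vec) : 0 < t -> at_ t (vscale (Num.sqrt t)^-1 y) = y.
Proof.
move=> t0; apply: eq_from_tnth => i; rewrite !tnth_mktuple mulrA divff ?mul1r//.
by rewrite gt_eqF// sqrtr_gt0.
Qed.

(** With [z = y / sqrt t], the upper bound on [G] is [lik_at_le] averaged over [X] and the lower
    bound is Jensen's inequality. Both logarithms grow at most quadratically in [y], which makes
    [ln G] integrable along the comparison process. *)
Lemma abs_lnG_le t (y : vec) : 0 < t -> `|ln (G P X t y)| <=
  \sum_(i < d) (((Num.sqrt t)^-1 * tnth y i) ^+ 2
      + (tnth y i ^+ 2 + (\int[P]_w tnth (X w) i) ^+ 2))
  + t / 2 * \int[P]_w sqnorm (X w).
Proof.
move=> t0; have t0' := ltW t0; pose z := vscale (Num.sqrt t)^-1 y.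
have Gp : 0 < G P X t y by have := G_gt0 mX iX2 z t0'; rewrite at_scale.
have h1 := G_ge mX iX2 z t0'; rewrite at_scale// in h1.
have h2 := G_le P mX z t0'; rewrite at_scale// in h2.
rewrite -[G _ _ _ _]lnK ?posrE// ler_expR in h1.
rewrite -[G _ _ _ _]lnK ?posrE// ler_expR in h2.
move: h1 h2; move: (ln _) => l h1 h2.
have c0 : 0 <= t / 2 * \int[P]_w sqnorm (X w).
  by rewrite mulr_ge0 ?divr_ge0//; apply: Rintegral_ge0 => w _; exact: sqnorm_ge0.
have z0 : 0 <= sqnorm z by exact: sqnorm_ge0.
set S := \sum_(i < d) _.
have e1 : sqnorm z <= S.
  by apply: ler_sum => i _; rewrite tnth_mktuple lerDl addr_ge0 ?sqr_ge0.
have e2 : - S <= \sum_(i < d) tnth y i * \int[P]_w tnth (X w) i.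
  rewrite -sumrN; apply: ler_sum => i _; move: (\int[P]_w _) => m.
  have := sqr_ge0 ((Num.sqrt t)^-1 * tnth y i); move: (_ ^+ 2) => u u0.
  have := sqr_ge0 (tnth y i + m); have := sqr_ge0 (tnth y i); have := sqr_ge0 m.
  by rewrite sqrrD mulr2n; lra.
by rewrite ler_norml; apply/andP; split; lra.
Qed.

Lemma integrable_lnG n :
  P.-integrable setT (EFin \o (fun w => ln (G P X (el n.+1) (Y n.+1 w)))).
Proof.
have ic (c : R) : P.-integrable setT (EFin \o (fun=> c)).
  by apply: (@integrable_bounded _ _ _ _ _ `|c|).
apply: (@integrable_dominated _ _ _ P _ (fun w =>
  \sum_(i < d) (((Num.sqrt (el n.+1))^-1 * tnth (Y n.+1 w) i) ^+ 2
      + (tnth (Y n.+1 w) i ^+ 2 + (\int[P]_w tnth (X w) i) ^+ 2))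
  + el n.+1 / 2 * \int[P]_w sqnorm (X w))).
- apply: measurableT_comp; first exact: measurable_ln.
  exact: (measurableT_comp (measurable_G P mX _) (mY n.+1)).
- by move=> w; apply: abs_lnG_le; exact: elapsed_gt0.
apply: integrableDR => //; apply: integrable_sumR => i; apply: integrableDR.
  by apply: integrable_sqrZ; exact: integrable_Y_sqr.
by apply: integrableDR => //; exact: integrable_Y_sqr.
Qed.

(** [G] is the density of [Y n.+1] relative to the Gaussian, so the integral of [G ln G] is the
    expectation of [ln G] along the process; the [1] is the shift built into [ent]. *)
Lemma ent_lnG n : ent P X gam (el n.+1)
  = (1 + \int[P]_w ln (G P X (el n.+1) (Y n.+1 w)))%:E.
Proof.
have iln := integrable_lnG n; move: iln.
have t0 : 0 <= el n.+1 by exact: elapsed_ge0.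
have mlG : measurable_fun setT (fun y => ln (G P X (el n.+1) y)).
  by apply: measurableT_comp; [exact: measurable_ln|exact: measurable_G].
move=> iln; have iG := integrable_marginal mX mN delta_gt0 Hg Hiid iX2 mlG iln.
rewrite EFinD -EFin_Rintegral//.
rewrite (@integral_marginal _ _ _ _ P X N delta gam mX mN delta_gt0 Hg Hiid iX2 n.+1
  (fun y => (ln (G P X (el n.+1) y))%:E)); last exact/measurable_EFinP.
have i1 : gam.-integrable setT (EFin \o (fun=> 1)).
  by apply: (@integrable_bounded _ _ _ _ _ 1) => // w; rewrite normr1.
have := integralD measurableT i1 iG; rewrite /= integral_prob_cst => H.
apply: (etrans _ H); apply: eq_integral => z _ /=.
by rewrite -EFinD; congr EFin; rewrite mulrC.
Qed.

Section step.
Variables (k : nat) (g : vec -> vec).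
Hypothesis mg : measurable_fun setT g.
Hypothesis ig : P.-integrable setT (EFin \o (fun w => sqnorm (g (Y k w)))).

Let mgY i : measurable_fun setT (fun w => tnth (g (Y k w)) i).
Proof. by apply: measurable_fun_tnth; exact: (measurableT_comp mg (mY k)). Qed.

Let ig2 i : P.-integrable setT (EFin \o (fun w => tnth (g (Y k w)) i ^+ 2)).
Proof.
apply: (integrable_dominated _ _ ig) => [|w]; first exact: measurable_funX.
by rewrite ger0_norm ?sqr_ge0// tnth_sqr_le.
Qed.

Let igX i : P.-integrable setT (EFin \o (fun w => tnth (g (Y k w)) i * tnth (X w) i)).
Proof.
apply: integrable_mulR => //; first exact: measurable_coord.
exact: integrable_coord_sqr.
Qed.

Let igN i : P.-integrable setT (EFin \o (fun w => tnth (g (Y k w)) i * tnth (N k.+1 w) i)).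
Proof.
apply: integrable_mulR => //; first exact: measurable_fun_tnth.
exact: integrable_noise_sqr.
Qed.

Let ihh i : P.-integrable setT (EFin \o (fun w => tnth (hh k (Y k w)) i ^+ 2)).
Proof. exact: (integrable_hhat_sqr mX mN delta_gt0 Hg Hiid iX2). Qed.

Let mhh i : measurable_fun setT (fun w => tnth (hh k (Y k w)) i).
Proof.
have mh : measurable_fun setT (hh k) by exact: measurable_hhat.
by apply: measurable_fun_tnth; exact: (measurableT_comp mh (mY k)).
Qed.

Let igh i : P.-integrable setT
  (EFin \o (fun w => tnth (g (Y k w)) i * tnth (hh k (Y k w)) i)).
Proof.
by apply: integrable_mulR; [exact: mgY|exact: mhh|exact: ig2|exact: ihh].
Qed.

(** For [g = f k.+1] this is the exponent of [invlik] at step [k.+1], evaluated along the comparison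
    process. *)
Definition step_log (w : Omega) : R :=
  - dot (g (Y k w)) (vsub (Y k.+1 w) (Y k w)) + delta k.+1 / 2 * sqnorm (g (Y k w)).

Let dlt := delta k.+1.

Let step_logE : step_log = fun w => \sum_(i < d)
  (- dlt * (tnth (g (Y k w)) i * tnth (X w) i)
   + - Num.sqrt dlt * (tnth (g (Y k w)) i * tnth (N k.+1 w) i)
   + dlt / 2 * tnth (g (Y k w)) i ^+ 2).
Proof.
apply: funext => w; rewrite /step_log /dot /sqnorm mulr_sumr -sumrN -big_split/=.
by apply: eq_bigr => i _; rewrite !tnth_mktuple -/dlt; ring.
Qed.

Let sub_sqnormE w : sqnorm (vsub (g (Y k w)) (hh k (Y k w))) = \sum_(i < d)
  (1 * tnth (g (Y k w)) i ^+ 2 + - 2 * (tnth (g (Y k w)) i * tnth (hh k (Y k w)) i)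
   + 1 * tnth (hh k (Y k w)) i ^+ 2).
Proof.
rewrite /sqnorm; apply: eq_bigr => i _; rewrite tnth_mktuple.
by move: (tnth (hh k _) i) => u; ring.
Qed.

Lemma integrable_step_log : P.-integrable setT (EFin \o step_log).
Proof. by rewrite step_logE; apply: integrable_sumR => i; exact: integrable_lin3. Qed.

Lemma integrable_sqnorm_sub : P.-integrable setT
  (EFin \o (fun w => sqnorm (vsub (g (Y k w)) (hh k (Y k w))))).
Proof.
rewrite (_ : (fun w => _) = fun w => \sum_(i < d)
  (1 * tnth (g (Y k w)) i ^+ 2 + - 2 * (tnth (g (Y k w)) i * tnth (hh k (Y k w)) i)
   + 1 * tnth (hh k (Y k w)) i ^+ 2)); last by apply: funext => w; exact: sub_sqnormE.
apply: integrable_sumR => i.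
by apply: integrable_lin3; [exact: ig2|exact: igh|exact: ihh].
Qed.

(* Completing the square: [-2 g.X] averages to [-2 g.hhat]. *)
Lemma Rintegral_step_log : \int[P]_w step_log w
  = delta k.+1 / 2 * \int[P]_w sqnorm (vsub (g (Y k w)) (hh k (Y k w)))
    - delta k.+1 / 2 * fine (fish P X gam (el k)).
Proof.
have -> : fine (fish P X gam (el k)) = \int[P]_w sqnorm (hh k (Y k w)).
  by rewrite -(integral_sqnorm_hhat mX mN delta_gt0 Hg Hiid iX2).
rewrite -/dlt step_logE Rintegral_sumR; last by move=> i; exact: integrable_lin3.
rewrite [X in _ = _ * X - _](_ : _ = \sum_(i < d)
  (1 * \int[P]_w (tnth (g (Y k w)) i ^+ 2)
   + - 2 * \int[P]_w (tnth (g (Y k w)) i * tnth (hh k (Y k w)) i)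
   + 1 * \int[P]_w (tnth (hh k (Y k w)) i ^+ 2))); last first.
  transitivity (\int[P]_w \sum_(i < d) (1 * tnth (g (Y k w)) i ^+ 2
      + - 2 * (tnth (g (Y k w)) i * tnth (hh k (Y k w)) i)
      + 1 * tnth (hh k (Y k w)) i ^+ 2)).
    by apply: eq_Rintegral => w _; exact: sub_sqnormE.
  rewrite Rintegral_sumR; last by move=> i; exact: (integrable_lin3 _ _ _ (ig2 i) (igh i) (ihh i)).
  by apply: eq_bigr => i _; exact: (Rintegral_lin3 _ _ _ (ig2 i) (igh i) (ihh i)).
rewrite /sqnorm Rintegral_sumR// !mulr_sumr -sumrB; apply: eq_bigr => i _.
rewrite Rintegral_lin3//.
have mgi : measurable_fun setT (fun y => tnth (g y) i) by exact: measurable_fun_tnth.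
rewrite (Rintegral_noise (phi := fun y => tnth (g y) i))//.
rewrite (Rintegral_hhat mX mN delta_gt0 Hg Hiid iX2 (phi := fun y => tnth (g y) i))//.
move: (\int[P]_w _) (\int[P]_w _) (\int[P]_w _) => a b c.
by field.
Qed.

(** Any version of the conditional expectation agrees almost surely with [hhat]. *)
Lemma expect_sqnorm_sub (h : vec -> vec) : cond_exp_version P X (Y k) h ->
  expect P (fun w => sqnorm (vsub (g (Y k w)) (h (Y k w))))
  = (\int[P]_w sqnorm (vsub (g (Y k w)) (hh k (Y k w))))%:E.
Proof.
move=> Hh; have mh := Hh.1.
rewrite -EFin_Rintegral; last exact: integrable_sqnorm_sub.
have mhk : measurable_fun setT (hh k) by exact: measurable_hhat.
apply: ae_eq_integral => //.
- apply/measurable_EFinP; apply: measurable_fun_sqnorm; apply: measurable_fun_vsub.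
    exact: (measurableT_comp mg (mY k)).
  exact: (measurableT_comp mh (mY k)).
- apply/measurable_EFinP; apply: measurable_fun_sqnorm; apply: measurable_fun_vsub.
    exact: (measurableT_comp mg (mY k)).
  exact: (measurableT_comp mhk (mY k)).
- have := cond_exp_ae_hhat mX mN delta_gt0 Hg Hiid iX2 Hh.
  by apply: filterS => w -> _.
Qed.

End step.

End comparison_moments.

(** * The divergence between the path laws *)

Section relative_entropy.
Context {R : realType} {d : nat} {dO : measure_display} {Omega : measurableType dO}.
Local Notation vec := (d.-tuple R).
Variables (P : probability Omega R) (X : Omega -> vec) (N Nt : nat -> Omega -> vec).
Variables (delta : nat -> R) (f : nat -> vec -> vec).
Hypotheses (mX : measurable_fun setT X) (mN : forall k, measurable_fun setT (N k)).
Hypothesis mNt : forall k, measurable_fun setT (Nt k).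
Hypothesis delta_gt0 : forall k, 0 < delta k.+1.
Hypothesis mf : forall k, measurable_fun setT (f k.+1).
Hypothesis Hiid : iid_std_gaussian_indep_of P X N.
Hypothesis Hiidt : iid_std_gaussian P Nt.
Hypothesis iX2 : P.-integrable setT (EFin \o (fun w => sqnorm (X w))).
Local Notation Y := (Yproc delta X N).
Local Notation Z := (Zproc delta f Nt).
Local Notation el := (elapsed delta).

(** The law of the first noise vector serves as the reference Gaussian: the independence hypothesis
    at length [1], with no constraint on [X]. *)
Lemma std_gaussian_noise : std_gaussian (dist P (mN 1%N)).
Proof.
move=> B mB.
have := @Hiid 1%N setT (fun=> B) measurableT (fun=> mB).
rewrite preimage_setT setTI probability_setT mul1e big_nat1 => <-.
congr (P _); apply/seteqP; split => w /= H.
  by case=> [|[|k]] i //= _; exact: H.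
by move=> i; exact: (H 1%N i isT).
Qed.

Variable n : nat.
Hypothesis if2 : forall k, (k < n.+1)%N ->
  P.-integrable setT (EFin \o (fun w => sqnorm (f k.+1 (Y k w)))).

(** The logarithm of the path density is [ln G] at the end point plus the exponents of the inverse
    step likelihoods. Each summand is integrable along the comparison process, so the integral
    splits. *)
Lemma KL_paths : KL (law P (path_of Y n.+1)) (law P (path_of Z n.+1))
  = (\int[P]_w ln (G P X (el n.+1) (Y n.+1 w))
     + \sum_(k < n.+1) \int[P]_w step_log X N delta k (f k.+1) w)%:E.
Proof.
have Hg := std_gaussian_noise.
have elp : 0 < el n.+1 by exact: elapsed_gt0.
have efin y : evidence P X (el n.+1) y \is a fin_num.
  (* At a positive time every position has the form [sqrt t * z], where the likelihood is bounded
     uniformly in the hidden variable. *)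
  by rewrite -(at_scale y elp) (evidence_at P mX _ (ltW elp)).
have mYp : measurable_fun setT (path_of Y n.+1).
  by apply: measurable_path_of; exact: (measurable_Y delta mX mN).
have mZp : measurable_fun setT (path_of Z n.+1).
  by apply: measurable_path_of; exact: (measurable_Z delta mNt mf).
have Hd := is_density_path mX mN mNt delta_gt0 mf Hg Hiid Hiidt efin.
apply: (etrans (@KL_density _ _ _ (dist P mYp) (dist P mZp) _ Hd)).
have logE w : ln (path_density P X delta f (path_of Y n.+1 w))
    = ln (G P X (el n.+1) (Y n.+1 w)) + \sum_(k < n.+1) step_log X N delta k (f k.+1) w.
  rewrite /path_density (@pos_path _ _ _ _ n.+1 Y w n.+1)//.
  rewrite -[fine _]/(G P X (el n.+1) (Y n.+1 w)).
  have -> : \prod_(k < n.+1) invlik delta f k.+1 (pos (path_of Y n.+1 w) k)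
      (pos (path_of Y n.+1 w) k.+1)
    = expR (\sum_(k < n.+1) step_log X N delta k (f k.+1) w).
    rewrite expR_sum; apply: eq_bigr => k _.
    rewrite (@pos_path _ _ _ _ n.+1 Y w k)//; last exact: ltnW.
    by rewrite (@pos_path _ _ _ _ n.+1 Y w k.+1).
  rewrite lnM ?posrE ?expR_gt0// ?expRK//.
  by have := G_gt0 mX iX2 (vscale (Num.sqrt (el n.+1))^-1 (Y n.+1 w)) (ltW elp); rewrite at_scale.
have iln := integrable_lnG mX mN delta_gt0 Hg Hiid iX2 n.
have ist (k : 'I_n.+1) : P.-integrable setT (EFin \o step_log X N delta k (f k.+1)).
  exact: (integrable_step_log mX mN Hg Hiid iX2 (mf k) (if2 (ltn_ord k))).
have iS : P.-integrable setT (EFin \o (fun w => \sum_(k < n.+1) step_log X N delta k (f k.+1) w)).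
  exact: integrable_sumR.
apply: (etrans (@integral_pushforward _ _ _ _ _ _ mYp P setT
  (fun p => (ln (path_density P X delta f p))%:E) _ _ measurableT)).
- apply/measurable_EFinP; apply: measurableT_comp; first exact: measurable_ln.
  exact: measurable_path_density.
- rewrite preimage_setT.
  rewrite (_ : _ \o _ = EFin \o (fun w => ln (G P X (el n.+1) (Y n.+1 w))
     + \sum_(k < n.+1) step_log X N delta k (f k.+1) w)); first exact: integrableDR.
  by apply: funext => w; rewrite /comp logE.
rewrite preimage_setT.
transitivity (\int[P]_w (ln (G P X (el n.+1) (Y n.+1 w))
     + \sum_(k < n.+1) step_log X N delta k (f k.+1) w)%:E)%E.
  by apply: eq_integral => w _; rewrite /comp logE.
rewrite EFin_Rintegral; last exact: integrableDR.
by rewrite RintegralD// Rintegral_sumR.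
Qed.

(** The Fisher terms cancel: the entropy bound contributes them with a plus sign, completing the
    square in the step terms with a minus sign. *)
Lemma KL_paths_le (dmax : R) (h : nat -> vec -> vec) :
  0 <= dmax -> (forall k, (k < n.+1)%N -> delta k.+1 <= dmax) ->
  (forall k, (k < n.+1)%N -> cond_exp_version P X (Y k) (h k.+1)) ->
  (KL (law P (path_of Y n.+1)) (law P (path_of Z n.+1))
   <= (dmax / 2)%:E * trace_cov P X
      + \sum_(k < n.+1) (delta k.+1 / 2)%:E *
          expect P (fun w => sqnorm (vsub (f k.+1 (Y k w)) (h k.+1 (Y k w)))))%E.
Proof.
move=> dmax0 dle Hh; have Hg := std_gaussian_noise.
pose S k := \int[P]_w sqnorm (vsub (f k.+1 (Y k w)) (hhat P X delta k (Y k w))).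
rewrite (eq_bigr (fun k : 'I_n.+1 => (delta k.+1 / 2 * S k)%:E)); last first.
  move=> k _; rewrite [RHS]EFinM; congr (_ * _)%E.
  exact: (expect_sqnorm_sub mX mN delta_gt0 Hg Hiid iX2 (mf k) (if2 (ltn_ord k))
    (Hh k (ltn_ord k))).
rewrite sumEFin (trace_covE mX iX2) -EFinM -EFinD KL_paths lee_fin.
have := ent_le mX iX2 Hg delta_gt0 dmax0 dle.
rewrite (ent_lnG mX mN delta_gt0 Hg Hiid iX2 n) lee_fin => H.
have -> : \sum_(k < n.+1) \int[P]_w step_log X N delta k (f k.+1) w
  = \sum_(k < n.+1) delta k.+1 / 2 * S k
    - \sum_(k < n.+1) delta k.+1 / 2 * fine (fish P X (dist P (mN 1%N)) (el k)).
  rewrite -sumrB; apply: eq_bigr => k _.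
  exact: (Rintegral_step_log mX mN delta_gt0 Hg Hiid iX2 (mf k) (if2 (ltn_ord k))).
have aux (a b c e : R) : 1 + a <= 1 + b + c -> a + (e - c) <= b + e by lra.
exact: (aux _ _ _ _ H).
Qed.

End relative_entropy.

Lemma integrable_expect_lty {R : realType} (dO : measure_display) (Omega : measurableType dO)
    (P : probability Omega R) (V : Omega -> R) :
  measurable_fun setT V -> (forall w, 0 <= V w) -> (expect P V < +oo)%E ->
  P.-integrable setT (EFin \o V).
Proof.
move=> mV V0 EV; apply/integrableP; split; first exact/measurable_EFinP.
by under eq_integral do rewrite /= ger0_norm//.
Qed.

Theorem theorem1 (R : realType) (d : nat)
  (dO : measure_display) (Omega : measurableType dO) (P : probability Omega R)
  (X : Omega -> d.-tuple R)
  (N Nt : nat -> Omega -> d.-tuple R)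
  (delta : nat -> R)
  (f : nat -> d.-tuple R -> d.-tuple R)
  (n : nat)
  (h : nat -> d.-tuple R -> d.-tuple R) :
  measurable_fun setT X ->
  (forall k, measurable_fun setT (N k)) ->
  (forall k, measurable_fun setT (Nt k)) ->
  (* X has finite second moments *)
  (expect P (fun w => sqnorm (X w)) < +oo)%E ->
  (* positive step sizes *)
  (forall k, (1 <= k)%N -> 0 < delta k) ->
  (* N_1, N_2, ... i.i.d. standard Gaussian, independent of X *)
  iid_std_gaussian_indep_of P X N ->
  (* N~_1, N~_2, ... i.i.d. standard Gaussian *)
  iid_std_gaussian P Nt ->
  (* measurable drifts *)
  (forall k, (1 <= k)%N -> measurable_fun setT (f k)) ->
  (1 <= n)%N ->
  (* E || f_k(Y_{k-1}) ||^2 < oo for k = 1..n *)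
  (forall k, (1 <= k <= n)%N ->
     (expect P (fun w => sqnorm (f k (Yproc delta X N k.-1 w))) < +oo)%E) ->
  (* h_k(Y_{k-1}) is (a version of) E[X | Y_{k-1}] for k = 1..n *)
  (forall k, (1 <= k <= n)%N ->
     cond_exp_version P X (Yproc delta X N k.-1) (h k)) ->
  (KL (law P (path_of (Yproc delta X N) n))
      (law P (path_of (Zproc delta f Nt) n))
   <= ((\big[Num.max/0]_(1 <= k < n.+1) delta k) / 2)%:E * trace_cov P X
      + \sum_(1 <= k < n.+1)
          (delta k / 2)%:E *
          expect P (fun w => sqnorm (vsub (f k (Yproc delta X N k.-1 w))
                                         (h k (Yproc delta X N k.-1 w)))))%E.
Proof.
move=> mX mN mNt EX2 dpos Hiid Hiidt mf n1 Ef Hh.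
have dpos' k : 0 < delta k.+1 by exact: dpos.
have mf' k : measurable_fun setT (f k.+1) by exact: mf.
have iX2 : P.-integrable setT (EFin \o (fun w => sqnorm (X w))).
  apply: integrable_expect_lty => //; first exact: measurable_fun_sqnorm.
  by move=> w; exact: sqnorm_ge0.
(* A path of length [m.+1] ends at a positive time, as the control of [ln G] at the end point
   requires. *)
case: n n1 Ef Hh => // m _ Ef Hh.
set dmax := \big[Num.max/0]_(1 <= k < m.+2) delta k.
rewrite big_add1 big_mkord.
apply: (KL_paths_le mX mN mNt dpos' mf' Hiid Hiidt iX2).
- move=> k km; apply: integrable_expect_lty.
  + apply: measurable_fun_sqnorm.
    have mYk : measurable_fun setT (Yproc delta X N k) by exact: measurable_Y.
    exact: (measurableT_comp (mf' k) mYk).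
  + by move=> w; exact: sqnorm_ge0.
  + exact: (Ef k.+1).
- exact: bigmax_ge_id.
- by move=> k km; apply: le_bigmax_seq => //; rewrite mem_index_iota.
- by move=> k km; exact: (Hh k.+1).
Qed.
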